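(* The form $\Theta_g^*\omega_{FS}$ on $\mathbb{H}_g$ descends to $\mathsf{A}_g=\operatorname{Sp}(2g,\mathbb{Z})\backslash\mathbb{H}_g$; that is, it is invariant under the action of $\operatorname{Sp}(2g,\mathbb{Z})$ on $\mathbb{H}_g$.
   Context: $g\ge1$; $\mathbb{H}_g$ is the Siegel upper half space of symmetric complex $g\times g$ matrices with positive definite imaginary part, on which $\operatorname{Sp}(2g,\mathbb{Z})$ acts by $\begin{pmatrix}a&b\\c&d\end{pmatrix}\cdot\tau=(a\tau+b)(c\tau+d)^{-1}$; $\mathsf{A}_g$ is the moduli space of principally polarized abelian varieties of dimension $g$. For $u\in U:=\frac12\mathbb{Z}^g/\mathbb{Z}^g$, $z\in\mathbb{C}^g$, $\tau\in\mathbb{H}_g$, set $\theta_u(z;\tau)=\sum_{m\in\mathbb{Z}^g}\exp(2\pi\sqrt{-1}(m+u)^t\tau(m+u)+4\pi\sqrt{-1}(m+u)^tz)$ (independent of the representative of $u$). The second order theta nullwert map is $\Theta_g:\mathbb{H}_g\to\mathbb{P}^{2^g-1}$, $\tau\mapsto[\theta_u(0;\tau)]_{u\in U}$. The Fubini–Study form on projective space is $\omega_{FS}=\frac{\sqrt{-1}}{2}\partial\overline\partial\log|Z|^2$ in homogeneous coordinates $Z$. *)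

(* Defs.v *)
From HB Require Import structures.
From mathcomp Require Export all_boot all_order all_algebra complex.
From mathcomp Require Export all_classical all_reals all_analysis.
(* [summability.sum] is kept qualified: imported, it would shadow the type
   [sum]. *)
From mathcomp Require showcase.summability.

Set Implicit Arguments.
Unset Strict Implicit.
Unset Printing Implicit Defensive.

Import Order.TTheory GRing.Theory Num.Theory.
Import numFieldNormedType.Exports.

Local Open Scope classical_set_scope.
Local Open Scope ring_scope.

Section Siegel.
Variables (R : realType) (g : nat).

Definition siegel_half_space : set 'M[R[i]]_g :=
  [set tau | tau^T = tau /\
    forall x : 'cV[R]_g, x != 0 ->
      0 < (x^T *m map_mx (@complex.Im R) tau *m x) 0 0].

Definition symplectic_form : 'M[int]_(g + g) :=
  block_mx 0 1%:M (- 1%:M) 0.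

Definition Sp2gZ : set 'M[int]_(g + g) :=
  [set M | M^T *m symplectic_form *m M = symplectic_form].

Definition siegel_action (M : 'M[int]_(g + g)) (tau : 'M[R[i]]_g) :
    'M[R[i]]_g :=
  let a := map_mx intr (ulsubmx M) in
  let b := map_mx intr (ursubmx M) in
  let c := map_mx intr (dlsubmx M) in
  let d := map_mx intr (drsubmx M) in
  (a *m tau + b) *m invmx (c *m tau + d).

End Siegel.

Section Theta.
Variable R : realType.

Definition cexp (z : R[i]) : R[i] :=
  Complex (expR (complex.Re z) * cos (complex.Im z))
          (expR (complex.Re z) * sin (complex.Im z)).

(* The sum over Z^g is the limit of the finite partial sums along the directed
   set of finite subsets of Z^g (unconditional summation). *)
Definition theta (g : nat) (u z : 'cV[R[i]]_g) (tau : 'M[R[i]]_g) : R[i]^o :=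
  summability.sum (fun m : 'cV[int]_g =>
    let w := map_mx intr m + u in
    cexp (2 * (@pi R)%:C%C * 'i%C * (w^T *m tau *m w) 0 0
          + 4 * (@pi R)%:C%C * 'i%C * (w^T *m z) 0 0) : R[i]^o).

(* U = (1/2)Z^g / Z^g is indexed by e in {0,1}^g, standing for the class
   of e/2. *)
Definition half_char (g : nat) (e : 'cV['I_2]_g) : 'cV[R[i]]_g :=
  \col_i ((e i 0 : nat)%:R / 2).

(* The homogeneous coordinates of the second order theta nullwert map, indexed
   by the 2^g elements of U through [enum_val]. *)
Definition theta_null (g : nat) (tau : 'M[R[i]]_g) :
    'rV[R[i]]_#|{: 'cV['I_2]_g}| :=
  \row_k theta (half_char (enum_val k)) 0 tau.

End Theta.

Section Forms.
Variable R : realType.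

(* A complex-valued differential 2-form on (an open subset of) a complex vector
   space, or on a complex submanifold of it: eta p v w is its value at the point
   p on the tangent vectors v and w. *)
Definition two_form (V : Type) := V -> V -> V -> R[i].

(* Pullback along a holomorphic map, whose differential df_p(v) is the complex
   directional derivative 'D_v f p.  Only the values of f on the complex line
   p + C v near p matter; so for f defined on the Siegel half space, an open
   subset of the space of symmetric matrices, and v symmetric, the values taken
   outside of the half space are irrelevant. *)
Definition pullback (m n p q : nat)
    (f : 'M[R[i]]_(m, n) -> 'M[R[i]]_(p, q))
    (eta : two_form 'M[R[i]]_(p, q)) : two_form 'M[R[i]]_(m, n) :=
  fun x v w => eta (f x) ('D_v f x) ('D_w f x).

Section Wirtinger.
Variable N : nat.
Implicit Types (f : 'rV[R[i]]_N -> R[i]) (Z v V W : 'rV[R[i]]_N).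

(* Derivative of the complex-valued f at Z along the real line Z + R v. *)
Definition real_derive f Z v : R[i] :=
  Complex (derive1 (fun t : R => complex.Re (f (Z + t%:C%C *: v))) 0)
          (derive1 (fun t : R => complex.Im (f (Z + t%:C%C *: v))) 0).

(* d/dZ_a = (d/dx_a - i d/dy_a)/2 and d/d\bar Z_a = (d/dx_a + i d/dy_a)/2,
   where Z_a = x_a + i y_a. *)
Definition wirtinger (a : 'I_N) f Z : R[i] :=
  (real_derive f Z (delta_mx 0 a)
   - 'i%C * real_derive f Z ('i%C *: delta_mx 0 a)) / 2.

Definition wirtinger_bar (a : 'I_N) f Z : R[i] :=
  (real_derive f Z (delta_mx 0 a)
   + 'i%C * real_derive f Z ('i%C *: delta_mx 0 a)) / 2.

(* \partial\bar\partial f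
     = \sum_(a, b) (d^2 f / dZ_a d\bar Z_b) dZ_a /\ d\bar Z_b,
   with (alpha /\ beta)(V, W) = alpha(V) beta(W) - alpha(W) beta(V). *)
Definition ddbar f : two_form 'rV[R[i]]_N := fun Z V W =>
  \sum_a \sum_b wirtinger a (wirtinger_bar b f) Z *
    (V 0 a * ((W 0 b)^*)%C - W 0 a * ((V 0 b)^*)%C).

Definition log_sqnorm Z : R[i] :=
  (ln (\sum_a (complex.Re (Z 0 a) ^+ 2 + complex.Im (Z 0 a) ^+ 2)))%:C%C.

(* The Fubini-Study form in homogeneous coordinates, i.e. its pullback to
   C^N \ {0} along the projection C^N \ {0} -> P^(N-1).  The pullback of the
   form on P^(N-1) along a holomorphic map with homogeneous coordinates F is
   the pullback along F of the form below. *)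
Definition fubini_study : two_form 'rV[R[i]]_N := fun Z V W =>
  'i%C / 2 * ddbar log_sqnorm Z V W.

End Wirtinger.

Definition theta_fubini_study (g : nat) : two_form 'M[R[i]]_g :=
  pullback (@theta_null R g) (@fubini_study _).

End Forms.

(* Main.v *)
(* Every [M] in [Sp(2g, Z)] acts on the homogeneous coordinates by
   [Theta (M tau) = c(tau) Theta (tau) U] for a constant unitary matrix [U].  It
   suffices to see this on generators: Euclid's algorithm on the entries of a
   symplectic matrix writes it as a product of translations [tau + b], changes
   of lattice [a tau a^T] and inversions in a single coordinate.  The first two
   only multiply or permute the theta constants.  A one-coordinate inversion is
   the one-dimensional Poisson formula for the Gaussian, applied with the other
   summation indices fixed; the Poisson formula is the limit, as the mesh [1/N]
   tends to 0, of the inversion formula for the Fourier transform on [Z/N].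

   [Theta] vanishes nowhere: if it did at [tau], the addition formula
   [theta(y)^2 = sum_u theta_u(0; tau) theta_u(y; tau)] would kill the function
   [theta( . ; tau / 2)], whose constant Fourier coefficient is 1.

   Finally the Fubini-Study form in homogeneous coordinates is the antisymmetric
   part of [<V, W> / |Z|^2 - <V, Z> <Z, W> / |Z|^4], which does not change under
   [Z -> c Z U], [V -> (s Z + c V) U], [W -> (t Z + c W) U]; and this is how
   [Theta] and its derivatives transform, with [s] and [t] coming from the
   derivatives of [c(tau)]. *)

(* The constant [c(tau)] is only known to exist, separately for each [tau]: no branch of the square
   root of [det (c tau + d)] is chosen, and the constant of the Poisson formula is never evaluated.
   Hence [c] cannot be differentiated. What is differentiated is the proportionality of
   [Theta (M tau)] and [Theta (tau) U], written as vanishing 2 by 2 minors; [s] and [t] are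
   recovered from this by dividing by a nonzero coordinate, which is where the nonvanishing of
   [Theta] enters. It also gives [c <> 0]. Analytic arguments are replaced by explicit estimates.
   Each theta term is expanded to second order with a Gaussian bound uniform in the increment, so
   that [Theta] can be differentiated along the curve traced by the action, not only along lines. In
   the Poisson formula the contour shift becomes a walk: a Riemann sum of mesh [h] is moved in [1/h]
   steps, each costing [O(h^2)]. Tangent vectors are symmetric, so the lines along them stay in the
   half space near [tau], where modularity is available. *)
Require Import Defs.
From mathcomp Require Import ring lra zify.
From mathcomp Require Import perm finmap.
Set Implicit Arguments.
Unset Strict Implicit.
Unset Printing Implicit Defensive.
Import Order.TTheory GRing.Theory Num.Theory.
Import numFieldNormedType.Exports.
Local Open Scope classical_set_scope.
Local Open Scope ring_scope.
Local Notation normc := ComplexField.Normc.normc.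
Local Notation Re := complex.Re.
Local Notation Im := complex.Im.

(** * Complex norm and exponential *)

Section ComplexNorm.
Variable R : realType.
Implicit Types (x y : R) (z w : R[i]).

Lemma normc_def z : `|z| = (normc z)%:C%C. Proof. by []. Qed.

Lemma normc_ge0 z : 0 <= normc z.
Proof. by case: z => a b; exact: sqrtr_ge0. Qed.

Lemma normcD z w : normc (z + w) <= normc z + normc w.
Proof. by rewrite -lecR rmorphD /=; exact: (ler_normD z w). Qed.

Lemma normcM z w : normc (z * w) = normc z * normc w.
Proof. exact: ComplexField.Normc.normcM. Qed.

Lemma normcN z : normc (- z) = normc z.
Proof. by case: z => a b /=; rewrite !sqrrN. Qed.

Lemma normc_real x : normc x%:C%C = `|x|.
Proof. by rewrite /= expr0n addr0 sqrtr_sqr. Qed.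

Lemma normc0 : normc (0 : R[i]) = 0.
Proof. exact: ComplexField.Normc.normc0. Qed.

Lemma normc_eq0 z : (normc z == 0) = (z == 0).
Proof.
apply/eqP/eqP; first exact: ComplexField.Normc.eq0_normc.
by move=> ->; rewrite normc0.
Qed.

Lemma normc_gt0 z : (0 < normc z) = (z != 0).
Proof. by rewrite lt_def normc_ge0 andbT normc_eq0. Qed.

Lemma normc_sum I (r : seq I) (P : pred I) (F : I -> R[i]) :
  normc (\sum_(i <- r | P i) F i) <= \sum_(i <- r | P i) normc (F i).
Proof.
elim/big_rec2: _ => [|i y z _ le]; first by rewrite normc0.
by apply: le_trans (normcD _ _) _; rewrite lerD2l.
Qed.

Lemma normc_Re z : `|Re z| <= normc z.
Proof. by case: z => a b /=; rewrite -sqrtr_sqr ler_wsqrtr // lerDl sqr_ge0. Qed.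

Lemma normc_Im z : `|Im z| <= normc z.
Proof. by case: z => a b /=; rewrite -sqrtr_sqr ler_wsqrtr // lerDr sqr_ge0. Qed.

Lemma normc_ReIm z : normc z <= `|Re z| + `|Im z|.
Proof.
case: z => a b /=.
rewrite -(@ler_pXn2r _ 2) ?nnegrE ?sqrtr_ge0 ?addr_ge0//.
rewrite sqr_sqrtr ?addr_ge0 ?sqr_ge0// sqrrD !real_normK ?num_real//.
have : 0 <= `|a| * `|b| by rewrite mulr_ge0.
by move: (`|a| * `|b|) => t; lra.
Qed.

Lemma normc_lt_small z : (forall e : R, 0 < e -> normc z <= e) -> z = 0.
Proof.
move=> h; apply/eqP; rewrite -normc_eq0 eq_le normc_ge0 andbT.
by apply/ler_addgt0Pl => e e0; rewrite addr0; exact: h.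
Qed.

End ComplexNorm.

Section ComplexExp.
Variable R : realType.
Implicit Types (x y : R) (z w : R[i]).

Lemma cexp0 : cexp (0 : R[i]) = 1.
Proof. by rewrite /cexp /= expR0 cos0 sin0 mulr1 mulr0. Qed.

Lemma cexpD z w : cexp (z + w) = cexp z * cexp w.
Proof.
case: z w => [a b] [c d]; rewrite /cexp /=; simpc.
by rewrite expRD cosD sinD; congr Complex; ring.
Qed.

Lemma normc_cexp z : normc (cexp z) = expR (Re z).
Proof.
by rewrite /= !exprMn -mulrDr cos2Dsin2 mulr1 sqrtr_sqr ger0_norm// expR_ge0.
Qed.

Lemma cexp_neq0 z : cexp z != 0.
Proof. by rewrite -normc_eq0 normc_cexp gt_eqF// expR_gt0. Qed.

Lemma cexpN z : cexp (- z) = (cexp z)^-1.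
Proof.
by apply: (mulfI (cexp_neq0 z)); rewrite -cexpD subrr cexp0 mulfV ?cexp_neq0.
Qed.

Lemma cexpMn z n : cexp (z *+ n) = cexp z ^+ n.
Proof. by elim: n => [|n ih]; rewrite ?cexp0// mulrS cexpD ih exprS. Qed.

Definition twopii : R[i] := 2 * (@pi R)%:C%C * 'i%C.

Lemma twopiiE : twopii = Complex 0 (2 * pi).
Proof.
rewrite /twopii; have -> : (2 : R[i]) = (2 : R)%:C%C by rewrite rmorph_nat.
by rewrite -rmorphM /=; simpc.
Qed.

Lemma cexp_int (k : int) : cexp (twopii * k%:~R) = 1.
Proof.
have h : cexp twopii = 1.
  by rewrite twopiiE /cexp /= !mulr_natl cos2pi sin2pi expR0 mulr0 mulr1.
case: k => n.
  by rewrite -pmulrn mulr_natr cexpMn h expr1n.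
by rewrite NegzE mulrNz mulrN cexpN -pmulrn mulr_natr cexpMn h expr1n invr1.
Qed.

(** Two mean value steps: [df] vanishes at 0, so [|df s| <= B s <= B] on the unit interval. This is
    a second order Taylor estimate with the constant 1 in place of 1/2. *)
Lemma expR_MVT (x : R) (f df ddf : R -> R) (B : R) :
  (forall t : R, is_derive t (1 : R) f (df t)) -> (forall t : R, is_derive t (1 : R) df (ddf t)) ->
  df 0 = 0 -> (forall t, 0 <= t <= 1 -> `|ddf t| <= B) -> `|f 1 - f 0| <= B.
Proof.
move=> hf hdf df0 hB.
have cont (g dg : R -> R) a b : (forall t : R, is_derive t (1 : R) g (dg t)) ->
   {within `[a, b], continuous g}.
  move=> hg; apply: derivable_within_continuous => t _.
  by case: (hg t).
have [s hs] := @MVT R f df 0 1 ltr01 (fun t _ => hf t) (cont _ _ _ _ hf).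
move: (hs); rewrite in_itv /= => /andP[s0 s1].
rewrite subr0 mulr1 => ->.
have [r hr] := @MVT R df ddf 0 s s0 (fun t _ => hdf t) (cont _ _ _ _ hdf).
move: (hr); rewrite in_itv /= => /andP[r0 r1].
rewrite df0 !subr0 => ->; rewrite normrM (gtr0_norm s0).
apply: le_trans (ler_wpM2r (ltW s0) (hB r _)) _.
  by rewrite (ltW r0) (ltW (lt_trans r1 s1)).
rewrite ler_piMr ?(ltW s1)//; apply: le_trans (hB 0 _) => //.
by rewrite lexx ler01.
Qed.

(** [expR_MVT] is applied to the real and imaginary parts of [exp (t z) - t z] for [0 <= t <= 1].
    Each second derivative is at most [(|x^2 - y^2| + 2 |x y|) e^N <= 2 N^2 e^N], and the two parts
    together give the factor 4. *)
Lemma cexp_taylor z : normc (cexp z - 1 - z) <= 4 * normc z ^+ 2 * expR (normc z).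
Proof.
case: z => x y; set N : R := normc (Complex x y).
have N2 : N ^+ 2 = x ^+ 2 + y ^+ 2.
  by rewrite /N /= sqr_sqrtr ?addr_ge0 ?sqr_ge0.
have Nx : x <= N by apply: le_trans (ler_norm x) (normc_Re (Complex x y)).
have N0 : 0 <= N by exact: normc_ge0.
have bnd (t u v : R) : 0 <= t <= 1 -> `|u| <= 1 -> `|v| <= 1 ->
   `|(x ^+ 2 - y ^+ 2) * (expR (t * x) * u) + 2 * x * y * (expR (t * x) * v)|
     <= 2 * N ^+ 2 * expR N.
  move=> /andP[t0 t1] u1 v1.
  have e1 : expR (t * x) <= expR N.
    rewrite ler_expR; apply: le_trans (ler_wpM2l t0 Nx) _.
    by rewrite ler_piMl.
  have e0 : 0 <= expR (t * x) := expR_ge0 _.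
  rewrite mulrCA [X in _ + X]mulrCA -mulrDr normrM (ger0_norm e0) mulrC.
  apply: ler_pM => //.
  rewrite N2; apply: le_trans (ler_normD _ _) _.
  rewrite !normrM.
  apply: le_trans (lerD (ler_wpM2l (normr_ge0 _) u1) (ler_wpM2l _ v1)) _.
    by rewrite !mulr_ge0.
  rewrite !mulr1 (ger0_norm (ler0n _ 2)).
  have h1 : `|x ^+ 2 - y ^+ 2| <= x ^+ 2 + y ^+ 2.
    apply: le_trans (ler_normB _ _) _.
    by rewrite !ger0_norm ?sqr_ge0.
  have : 0 <= (`|x| - `|y|) ^+ 2 by rewrite sqr_ge0.
  rewrite sqrrB !real_normK ?num_real//; move: h1.
  move: (`|x ^+ 2 - y ^+ 2|) => p; rewrite -mulrA.
  by move: (`|x| * `|y|) (x ^+ 2) (y ^+ 2) => q r s; lra.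
have hc (t : R) : `|cos t| <= 1 by rewrite ler_norml cos_geN1 cos_le1.
have hs (t : R) : `|sin t| <= 1 by rewrite ler_norml sin_geN1 sin_le1.
apply: le_trans (normc_ReIm _) _.
have -> : 4 * N ^+ 2 * expR N = 2 * N ^+ 2 * expR N + 2 * N ^+ 2 * expR N by ring.
apply: lerD.
- have := @expR_MVT x (fun t => expR (t * x) * cos (t * y) - t * x)
    (fun t => expR (t * x) * (x * cos (t * y) - y * sin (t * y)) - x)
    (fun t => (x ^+ 2 - y ^+ 2) * (expR (t * x) * cos (t * y))
       + 2 * x * y * (expR (t * x) * (- sin (t * y)))) (2 * N ^+ 2 * expR N).
  rewrite !mul0r !mul1r cos0 sin0 expR0 !mulr1 !mulr0 !subr0 mul1r subrr.
  have -> : Re (cexp (Complex x y) - 1 - Complex x y) = expR x * cos y - x - 1.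
    by rewrite /cexp /=; ring.
  apply=> //.
  + move=> t; apply: is_derive_eq.
    by rewrite /GRing.scale /=; ring.
  + move=> t; apply: is_derive_eq.
    by rewrite /GRing.scale /=; ring.
  + by move=> t t01; apply: bnd => //; rewrite normrN.
- have := @expR_MVT x (fun t => expR (t * x) * sin (t * y) - t * y)
    (fun t => expR (t * x) * (x * sin (t * y) + y * cos (t * y)) - y)
    (fun t => (x ^+ 2 - y ^+ 2) * (expR (t * x) * sin (t * y))
       + 2 * x * y * (expR (t * x) * (cos (t * y)))) (2 * N ^+ 2 * expR N).
  rewrite !mul0r !mul1r cos0 sin0 expR0 !mulr1 !mulr0 !subr0 add0r mul1r subrr.
  have -> : Im (cexp (Complex x y) - 1 - Complex x y) = expR x * sin y - y.
    by rewrite /cexp /=; ring.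
  apply=> //.
  + move=> t; apply: is_derive_eq.
    by rewrite /GRing.scale /=; ring.
  + move=> t; apply: is_derive_eq.
    by rewrite /GRing.scale /=; ring.
  + by move=> t t01; apply: bnd.
Qed.

End ComplexExp.

(** * Unconditional summation *)

#[local] Existing Instance summability.totally_filter.

Section Sums.
Variable R : realType.
Implicit Types (I J : choiceType).

Definition hassum I (f : I -> R[i]) (s : R[i]) : Prop :=
  forall e : R, 0 < e -> exists A : {fset I}, forall B : {fset I},
    (A `<=` B)%fset -> normc (\sum_(i <- B) f i - s) < e.

Definition csum I (f : I -> R[i]) : R[i] :=
  summability.sum (f : I -> R[i]^o).

Lemma hassum_csum I (f : I -> R[i]) s : hassum f s -> csum f = s.
Proof.
move=> hs; rewrite /csum /summability.sum.
apply: (@cvg_lim R[i]^o); first exact: norm_hausdorff.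
apply/cvgrPdist_lt => e e0.
(* In the partial order of [R[i]], [0 < e] forces [e] to be real, so [Re e] serves as the
   tolerance. *)
have [re Ie] : 0 < Re e /\ Im e = 0.
  by move: e0; rewrite ltcE => /andP[/eqP -> ->].
have [A hA] := hs _ re; exists A => // B /= AB.
rewrite distrC /summability.partial_sum -(big_seq_fsetE _ _ predT f)/=.
rewrite ltcE Ie /= eqxx /=.
exact: hA.
Qed.

(** The bound is kept explicit because it also bounds [csum f], and its growth as the mesh shrinks
    matters for the Riemann sums. *)
Definition sums_le I (f : I -> R[i]) (K : R) : Prop :=
  forall A : {fset I}, \sum_(i <- A) normc (f i) <= K.

Definition absum I (f : I -> R[i]) : Prop := exists K : R, sums_le f K.

Lemma hassum_ext I (f g : I -> R[i]) s : f =1 g -> hassum f s -> hassum g s.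
Proof. by move=> /funext ->. Qed.

Lemma hassumD I (f g : I -> R[i]) s t :
  hassum f s -> hassum g t -> hassum (fun i => f i + g i) (s + t).
Proof.
move=> hs ht e e0.
have e20 : 0 < e / 2 by rewrite divr_gt0.
have [A hA] := hs _ e20; have [B hB] := ht _ e20.
exists (A `|` B)%fset => D; rewrite fsubUset => /andP[AD BD].
have := hA _ AD; have := hB _ BD; rewrite big_split /=.
move: (\sum_(_ <- _) f _) (\sum_(_ <- _) g _) => u v h1 h2.
have -> : u + v - (s + t) = (u - s) + (v - t) by ring.
apply: le_lt_trans (normcD _ _) _.
by move: h1 h2; move: (normc (u - s)) (normc _) => x y; lra.
Qed.

Lemma hassumZ I (f : I -> R[i]) s c :
  hassum f s -> hassum (fun i => c * f i) (c * s).
Proof.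
move=> hs e e0.
have c1 : 0 < normc c + 1 by rewrite ltr_wpDl// normc_ge0.
have [A hA] := hs _ (divr_gt0 e0 c1).
exists A => B /hA; rewrite -mulr_sumr -mulrBr normcM.
rewrite ltr_pdivlMr// => h; apply: le_lt_trans h; rewrite mulrC.
by rewrite ler_wpM2l ?normc_ge0// lerDl.
Qed.

Lemma hassum0 I : hassum (fun _ : I => 0) 0.
Proof.
by move=> e e0; exists fset0 => B _; rewrite big1 ?subrr ?normc0.
Qed.

Lemma hassum_bigsum I (T : Type) (r : seq T) (P : pred T)
    (f : T -> I -> R[i]) s :
  (forall t, hassum (f t) (s t)) ->
  hassum (fun i => \sum_(t <- r | P t) f t i) (\sum_(t <- r | P t) s t).
Proof.
move=> h; elim: r => [|t r ih].
  by rewrite big_nil; under eq_fun do rewrite big_nil; exact: hassum0.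
rewrite big_cons; under eq_fun do rewrite big_cons.
by case: ifP => // _; exact: hassumD.
Qed.

Lemma rsum_mono I (f : I -> R) (A B : {fset I}) : (forall i, 0 <= f i) ->
  (A `<=` B)%fset -> \sum_(i <- A) f i <= \sum_(i <- B) f i.
Proof.
move=> f0 AB; rewrite [leRHS](big_fsetID _ (mem A)) /=.
rewrite (_ : \sum_(i <- A) f i = \sum_(i <- [fset x | x in B & x \in A]%fset) f i).
  by rewrite lerDl sumr_ge0.
by apply: eq_fbigl => i; rewrite !inE /= andbC; case: (boolP (i \in A)) => //= /(fsubsetP AB).
Qed.

Lemma hassum_pos I (f : I -> R) K : (forall i, 0 <= f i) ->
  (forall A : {fset I}, \sum_(i <- A) f i <= K) ->
  exists s : R, hassum (fun i => (f i)%:C%C) s%:C%C.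
Proof.
move=> f0 fK.
pose S := [set x | exists A : {fset I}, x = \sum_(i <- A) f i].
have hS : has_sup S.
  split; first by exists (\sum_(i <- (fset0 : {fset I})) f i), fset0.
  by exists K => _ [A ->]; exact: fK.
exists (sup S) => e e0.
have [_ [A ->] hA] := sup_adherent e0 hS.
exists A => B AB.
have h1 : \sum_(i <- B) f i <= sup S by apply: ub_le_sup; [case: hS|exists B].
have h2 := rsum_mono f0 AB.
rewrite -rmorph_sum -rmorphB normc_real ltr_norml.
by apply/andP; split; lra.
Qed.

(** [g] is the difference of the nonnegative families [|f| + g] and [|f|], and each of these
    converges to the supremum of its finite sums. *)
Lemma hassum_Re I (f : I -> R[i]) (g : I -> R) :
  absum f -> (forall i, `|g i| <= normc (f i)) ->
  exists s, hassum (fun i => (g i)%:C%C) s.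
Proof.
move=> [K hK] hg.
have n0 i : 0 <= normc (f i) := normc_ge0 _.
have [s1 h1] := hassum_pos n0 hK.
have [|A|s2 h2] := @hassum_pos _ (fun i => normc (f i) + g i) (K + K).
- by move=> i; have := hg i; rewrite ler_norml => /andP[]; lra.
- rewrite big_split lerD// (le_trans _ (hK A))// ler_sum// => i _.
  exact: le_trans (ler_norm _) (hg i).
exists (s2%:C%C + (-1) * s1%:C%C).
apply: (hassum_ext _ (hassumD h2 (hassumZ (-1) h1))) => i.
by rewrite rmorphD /=; ring.
Qed.

Lemma absum_hassum I (f : I -> R[i]) : absum f -> hassum f (csum f).
Proof.
move=> fa.
have [s hs] := hassum_Re fa (fun i => normc_Re (f i)).
have [t ht] := hassum_Re fa (fun i => normc_Im (f i)).
have h : hassum f (s + 'i%C * t).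
  apply: hassum_ext (hassumD hs (hassumZ 'i%C ht)) => i.
  by rewrite -complexE.
by rewrite (hassum_csum h).
Qed.

Lemma absum_sub I (f : I -> R[i]) (g : I -> R[i]) K : absum g ->
  (forall i, normc (f i) <= K * normc (g i)) -> absum f.
Proof.
move=> [L hL] h; have [K0|K0] := leP 0 K.
  exists (K * L) => A; apply: le_trans (ler_sum _ (fun i _ => h i)) _.
  by rewrite -mulr_sumr ler_wpM2l.
exists 0 => A; apply: sumr_le0 => i _; apply: le_trans (h i) _.
by rewrite mulr_le0_ge0 ?(ltW K0)// normc_ge0.
Qed.

Lemma absum_le I (f g : I -> R[i]) : absum g ->
  (forall i, normc (f i) <= normc (g i)) -> absum f.
Proof. by move=> ag h; apply: (absum_sub (K := 1) ag) => i; rewrite mul1r. Qed.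

Lemma absumD I (f g : I -> R[i]) : absum f -> absum g ->
  absum (fun i => f i + g i).
Proof.
move=> [K hK] [L hL]; exists (K + L) => A.
apply: le_trans (lerD (hK A) (hL A)); rewrite -big_split ler_sum// => i _.
exact: normcD.
Qed.

Lemma absumZ I (f : I -> R[i]) c : absum f -> absum (fun i => c * f i).
Proof. by move=> h; apply: (absum_sub (K := normc c) h) => i; rewrite normcM. Qed.

Lemma sums_le_inj I J (h : J -> I) (f : I -> R[i]) K : injective h ->
  sums_le f K -> sums_le (f \o h) K.
Proof.
move=> hi hK A.
rewrite (_ : \sum_(i <- A) _ = \sum_(i <- [fset h x | x in A]%fset) normc (f i)) //.
by rewrite big_imfset//= => x y _ _; exact: hi.
Qed.

Lemma absum_inj I J (h : J -> I) (f : I -> R[i]) : injective h -> absum f ->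
  absum (f \o h).
Proof. by move=> hi [K hK]; exists K; exact: sums_le_inj. Qed.

Lemma absum_bigsum I (T : Type) (r : seq T) (P : pred T) (f : T -> I -> R[i]) :
  (forall t, absum (f t)) -> absum (fun i => \sum_(t <- r | P t) f t i).
Proof.
move=> h; elim: r => [|t r ih].
  exists 0 => A; rewrite big1// => i _; rewrite big_nil.
  exact: ComplexField.Normc.normc0.
have -> : (fun i => \sum_(u <- t :: r | P u) f u i) =
    (fun i => (if P t then f t i else 0) + \sum_(u <- r | P u) f u i).
  by apply/funext => i; rewrite big_cons; case: ifP; rewrite ?add0r.
apply: absumD => //; case: (P t); [exact: h|exists 0 => A].
by rewrite big1// => i _; exact: ComplexField.Normc.normc0.
Qed.

Lemma hassum_le I (f : I -> R[i]) s t e (A : {fset I}) : hassum f s ->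
  (forall B, (A `<=` B)%fset -> normc (\sum_(i <- B) f i - t) <= e) ->
  normc (s - t) <= e.
Proof.
move=> hs hA; apply/ler_addgt0Pr => d d0.
have [B hB] := hs _ d0.
have := hA (A `|` B)%fset (fsubsetUl _ _).
have := hB (A `|` B)%fset (fsubsetUr _ _).
move: (\sum_(_ <- _) _) => u h1 h2.
have -> : s - t = (u - t) - (u - s) by ring.
apply: le_trans (normcD _ _) _; rewrite normcN.
by move: h1 h2; move: (normc (u - t)) (normc _) => x y; lra.
Qed.

Lemma normc_csum_le I (f : I -> R[i]) K : sums_le f K -> normc (csum f) <= K.
Proof.
move=> h; have /absum_hassum hf : absum f by exists K.
rewrite -[csum f]subr0; apply: (hassum_le (A := fset0) hf) => B _.
by rewrite subr0; apply: le_trans (normc_sum _ _ _) (h B).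
Qed.

(** Given a finite set [A] that works for [f], choose preimages of those points of [A] that are hit.
    The other points of [A] contribute 0, so adding them to the image of [B] does not change the
    sum. *)
Lemma hassum_inj I J (h : J -> I) (f : I -> R[i]) s : injective h ->
  (forall i, (forall j, h j <> i) -> f i = 0) ->
  hassum f s -> hassum (f \o h) s.
Proof.
move=> hi f0 hs e /hs[A hA].
have im (B : {fset J}) :
    \sum_(j <- B) (f \o h) j = \sum_(i <- [fset h x | x in B]%fset) f i.
  by rewrite big_imfset//= => x y _ _; exact: hi.
have hP (i : I) : i \in A -> (exists j, h j == i) \/ f i = 0.
  move=> iA; have [[j /eqP ji]|n] := pselect (exists j, h j == i).
    by left; exists j; apply/eqP.
  by right; apply: f0 => j ji; apply: n; exists j; apply/eqP.
have hQ (i : I) : exists B : {fset J}, forall j, h j = i -> j \in B.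
  have [[j /eqP ji]|n] := pselect (exists j, h j == i).
    by exists [fset j]%fset => k ki; rewrite inE; apply/eqP/hi; rewrite ki.
  by exists fset0 => j ji; case: n; exists j; apply/eqP.
have [F hF] := choice hQ.
exists (\bigcup_(i <- A) F i)%fset => B /fsubsetP AB.
rewrite im.
have -> : \sum_(i <- [fset h x | x in B]%fset) f i =
   \sum_(i <- (A `|` [fset h x | x in B])%fset) f i.
  apply/esym; rewrite fsetUC.
  rewrite (big_fsetID _ (fun i => i \in [fset h x | x in B]%fset))/=.
  rewrite [X in _ + X]big1_fset ?addr0.
    apply: eq_fbigl => i; rewrite !inE /= .
    by case: (i \in [fset h x | x in B]%fset) => //=; rewrite ?andbF.
  move=> i; rewrite !inE /= => /andP[+ nB] _.
  rewrite (negbTE nB)/= => iA.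
  case: (hP i iA) => // -[j /eqP ji]; case/negP: nB; apply/imfsetP.
  exists j => //=; apply: AB; apply/bigfcupP; exists i; first by rewrite iA.
  exact: hF.
by apply: hA; exact: fsubsetUl.
Qed.

Lemma csum_inj I J (h : J -> I) (f : I -> R[i]) : injective h ->
  (forall i, (forall j, h j <> i) -> f i = 0) -> absum f ->
  csum (f \o h) = csum f.
Proof. by move=> hi f0 /absum_hassum /(hassum_inj hi f0)/hassum_csum. Qed.

Lemma csum_bij I J (h : J -> I) (f : I -> R[i]) : bijective h -> absum f ->
  csum (f \o h) = csum f.
Proof.
move=> hb fa; apply: csum_inj => //; first exact: bij_inj.
by case: hb => k hk kh i /(_ (k i)); rewrite kh.
Qed.

Lemma csumZ I (f : I -> R[i]) c : absum f -> csum (fun i => c * f i) = c * csum f.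
Proof. by move=> /absum_hassum /(hassumZ c)/hassum_csum. Qed.

Lemma csumD I (f g : I -> R[i]) : absum f -> absum g ->
  csum (fun i => f i + g i) = csum f + csum g.
Proof.
by move=> /absum_hassum hf /absum_hassum hg; apply: hassum_csum; exact: hassumD.
Qed.

Lemma csum_bigsum I (T : Type) (r : seq T) (P : pred T) (f : T -> I -> R[i]) :
  (forall t, absum (f t)) ->
  csum (fun i => \sum_(t <- r | P t) f t i) = \sum_(t <- r | P t) csum (f t).
Proof.
move=> h; apply: hassum_csum; apply: hassum_bigsum => t.
exact: absum_hassum.
Qed.

Lemma csum_fin (T : finType) (f : T -> R[i]) : csum f = \sum_t f t.
Proof.
apply: hassum_csum => e e0; exists [fset x | x in T]%fset => B hB.
rewrite (_ : \sum_(i <- B) f i = \sum_t f t) ?subrr ?normc0//.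
apply: perm_big; apply: uniq_perm => //; first exact: index_enum_uniq.
move=> t; rewrite mem_index_enum; apply: (fsubsetP hB).
by apply/imfsetP; exists t.
Qed.

Lemma sums_le_fin (T : finType) (f : T -> R[i]) : sums_le f (\sum_t normc (f t)).
Proof.
move=> A; rewrite (_ : \sum_t _ = \sum_(t <- [fset x | x in T]%fset) normc (f t)).
  apply: rsum_mono => [t|]; first exact: normc_ge0.
  by apply/fsubsetP => t _; apply/imfsetP; exists t.
apply: perm_big; apply: uniq_perm; [exact: index_enum_uniq|exact: fset_uniq|].
by move=> t; rewrite mem_index_enum; apply/esym/imfsetP; exists t.
Qed.

Lemma absum_finsupp I (A : {fset I}) (f : I -> R[i]) :
  (forall i, i \notin A -> f i = 0) -> absum f.
Proof.
move=> f0; exists (\sum_(i <- A) normc (f i)) => B.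
rewrite (big_fsetID _ (mem A)) /= [X in _ + X]big1_fset ?addr0; last first.
  by move=> i; rewrite !inE /= => /andP[_ /f0 ->]; rewrite normc0.
apply: rsum_mono => [i|]; first exact: normc_ge0.
by apply/fsubsetP => i; rewrite !inE /= => /andP[].
Qed.

Lemma absum_row I J (f : I * J -> R[i]) i : absum f -> absum (fun j => f (i, j)).
Proof. by apply: (absum_inj (h := fun j => (i, j))) => j k []. Qed.

Lemma sum_fsetM I J (A : {fset I}) (B : {fset J}) (V : nmodType) (f : I * J -> V) :
  \sum_(p <- (A `*` B)%fset) f p = \sum_(i <- A) \sum_(j <- B) f (i, j).
Proof. by rewrite big_imfset2 //= => -[? ?] [? ?] _ _ /= [-> ->]. Qed.

Lemma fset_subM I J (P : {fset I * J}) :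
  (P `<=` [fset p.1 | p in P] `*` [fset p.2 | p in P])%fset.
Proof. by apply/fsubsetP => p pP; rewrite in_fsetM !in_imfset. Qed.

(** Multiplying each row sum by the unimodular [u i] (or by 0 if the row sum is 0) turns the sum of
    the norms into the norm of one sum of rows. The latter is a limit of sums over finite
    rectangles, all bounded by [K]. *)
Lemma absum_outer I J (f : I * J -> R[i]) : absum f ->
  absum (fun i => csum (fun j => f (i, j))).
Proof.
move=> fa; case: (fa) => K hK; exists K => A.
pose u i := (`|csum (fun j => f (i, j))| / csum (fun j => f (i, j))).
have -> : \sum_(i <- A) normc (csum (fun j => f (i, j)))
   = normc (\sum_(i <- A) u i * csum (fun j => f (i, j))).
  rewrite -[RHS]ger0_norm ?normc_ge0//.
  have -> : \sum_(i <- A) u i * csum (fun j => f (i, j)) =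
            (\sum_(i <- A) normc (csum (fun j => f (i, j))))%:C%C.
    rewrite rmorph_sum; apply: eq_bigr => i _; rewrite /u.
    have [->|n0] := eqVneq (csum (fun j => f (i, j))) 0.
      by rewrite mulr0 normc0.
    by rewrite divfK.
  by rewrite normc_real normr_id ger0_norm// sumr_ge0// => i _; exact: normc_ge0.
have u1 i : normc (u i) <= 1.
  rewrite /u normcM ComplexField.Normc.normcV normc_def normc_real.
  rewrite ger0_norm ?normc_ge0//.
  have [->|n0] := eqVneq (csum (fun j => f (i, j))) 0; first by rewrite normc0 mul0r.
  by rewrite mulfV// normc_eq0.
rewrite -[X in normc X]subr0.
have hs : hassum (fun j => \sum_(i <- A) u i * f (i, j))
   (\sum_(i <- A) u i * csum (fun j => f (i, j))).
  apply: hassum_bigsum => i; apply: hassumZ; apply: absum_hassum.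
  exact: absum_row.
apply: (hassum_le (A := fset0) hs) => B _; rewrite subr0.
apply: le_trans (hK (A `*` B)%fset); rewrite sum_fsetM exchange_big /=.
apply: le_trans (normc_sum _ _ _) _; apply: ler_sum => j _.
apply: le_trans (normc_sum _ _ _) _; apply: ler_sum => i _.
by rewrite normcM ler_piMl ?normc_ge0.
Qed.

(** If [A] contains the first projection of [P], the sum of the rows in [A] is the limit over column
    sets [B] of the sums over [A * B]. As soon as [B] contains the second projection, the rectangle
    contains [P], so its sum is within [e / 2] of the total. *)
Lemma csum_fubini I J (f : I * J -> R[i]) : absum f ->
  csum f = csum (fun i => csum (fun j => f (i, j))).
Proof.
move=> fa; apply/esym/hassum_csum => e e0.
have e20 : 0 < e / 2 by rewrite divr_gt0.
have [P hP] := absum_hassum fa e20.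
exists [fset p.1 | p in P]%fset => A PA.
suff : normc (\sum_(i <- A) csum (fun j => f (i, j)) - csum f) <= e / 2.
  by move=> h; apply: le_lt_trans h _; rewrite gtr_pMr// invf_lt1// ltr1n.
have hs : hassum (fun j => \sum_(i <- A) f (i, j))
   (\sum_(i <- A) csum (fun j => f (i, j))).
  by apply: hassum_bigsum => i; apply: absum_hassum; exact: absum_row.
apply: (hassum_le (A := [fset p.2 | p in P]%fset) hs) => B PB.
rewrite exchange_big -sum_fsetM; apply/ltW/hP.
apply: fsubset_trans (fset_subM P) _; apply/fsubsetP => p.
rewrite !in_fsetM => /andP[p1 p2].
by rewrite (fsubsetP PA)//= (fsubsetP PB).
Qed.

Lemma sums_le_prod I J (f : I -> R[i]) (g : J -> R[i]) K L :
  sums_le f K -> sums_le g L -> sums_le (fun p : I * J => f p.1 * g p.2) (K * L).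
Proof.
move=> hK hL A.
have f0 i : 0 <= normc (f i) := normc_ge0 _.
have g0 i : 0 <= normc (g i) := normc_ge0 _.
apply: le_trans (rsum_mono (fun p => normc_ge0 _) (fset_subM A)) _.
rewrite sum_fsetM /=.
under eq_bigr do under eq_bigr do rewrite normcM.
by rewrite -big_distrlr /= ler_pM//; exact: sumr_ge0.
Qed.

Lemma absum_prod I J (f : I -> R[i]) (g : J -> R[i]) : absum f -> absum g ->
  absum (fun p : I * J => f p.1 * g p.2).
Proof. by move=> [K hK] [L hL]; exists (K * L); exact: sums_le_prod. Qed.

Lemma csum_prod I J (f : I -> R[i]) (g : J -> R[i]) : absum f -> absum g ->
  csum (fun p : I * J => f p.1 * g p.2) = csum f * csum g.
Proof.
move=> fa ga; rewrite csum_fubini/=; last exact: absum_prod.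
under eq_fun do rewrite csumZ// mulrC.
by rewrite csumZ// mulrC.
Qed.

Lemma absum_tail I (f : I -> R[i]) (e : R) : absum f -> 0 < e ->
  exists A : {fset I}, forall B : {fset I},
    (forall i, i \in B -> i \notin A) -> \sum_(i <- B) normc (f i) < e.
Proof.
move=> [K hK] e0.
have n0 i : 0 <= normc (f i) := normc_ge0 _.
have [s hs] := hassum_pos n0 hK.
have e20 : 0 < e / 2 by rewrite divr_gt0.
have [A hA] := hs _ e20; exists A => B AB.
have h1 := hA A (fsubset_refl _); have := hA (A `|` B)%fset (fsubsetUl _ _).
rewrite (big_fsetID _ (mem A)) /=.
have -> : [fset x in A `|` B | x \in A]%fset = A.
  by apply/fsetP => i; rewrite !inE /=; case: (i \in A) => //=; rewrite andbF.
have -> : [fset x in A `|` B | x \notin A]%fset = B.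
  apply/fsetP => i; rewrite !inE /=.
  by have := AB i; case: (i \in B); case: (i \in A) => //= /(_ isT).
move: h1; rewrite -!rmorph_sum -rmorphD -!rmorphB !normc_real /= !ltr_norml.
move=> /andP[h1 h2] /andP[h3 h4].
by move: h1 h2 h3 h4; move: (\sum_(_ <- A) _) (\sum_(_ <- B) _) => x y; lra.
Qed.

Definition seqlim (u : nat -> R[i]) (l : R[i]) :=
  forall e : R, 0 < e -> exists N, forall n, (N <= n)%N -> normc (u n - l) <= e.

Lemma seqlim0D u v : seqlim u 0 -> seqlim v 0 -> seqlim (fun n => u n + v n) 0.
Proof.
move=> hu hv e e0; have e20 : 0 < e / 2 by rewrite divr_gt0.
have [N hN] := hu _ e20; have [M hM] := hv _ e20.
exists (maxn N M) => n; rewrite geq_max => /andP[/hN h1 /hM h2].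
move: h1 h2; rewrite !subr0 => h1 h2; apply: le_trans (normcD _ _) _.
by move: h1 h2; move: (normc _) (normc _) => x y; lra.
Qed.

Lemma seqlim_sum0 I (r : seq I) (u : I -> nat -> R[i]) :
  (forall i, seqlim (u i) 0) -> seqlim (fun n => \sum_(i <- r) u i n) 0.
Proof.
move=> h; elim: r => [|i r ih].
  by move=> e e0; exists 0%N => n _; rewrite big_nil subrr normc0 ltW.
move=> e /(seqlim0D (h i) ih)[N hN]; exists N => n /hN.
by rewrite big_cons.
Qed.

Lemma csum_split I (f : I -> R[i]) (A : {fset I}) : absum f ->
  csum f = \sum_(i <- A) f i + csum (fun i => if i \in A then 0 else f i).
Proof.
move=> fa.
have ga : absum (fun i => if i \in A then 0 else f i).
  by apply: (absum_le fa) => i; case: ifP; rewrite ?normc0 ?normc_ge0.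
apply: hassum_csum => e /(absum_hassum ga)[B hB].
exists (A `|` B)%fset => C; rewrite fsubUset => /andP[AC BC].
move: (hB C BC); congr (normc _ < _); rewrite opprD addrA; congr (_ - _).
rewrite (big_fsetID _ (fun i => i \in A))/=.
rewrite [in X in _ = X](big_fsetID _ (fun i => i \in A))/=.
rewrite big1_fset ?add0r; last by move=> i; rewrite !inE/= => /andP[_ ->].
rewrite [X in X + _]addrC -[LHS]addr0 -addrA; congr (_ + _).
  by apply: eq_fbigr => i; rewrite !inE/= => /andP[_ /negbTE ->].
apply/esym/eqP; rewrite subr_eq0; apply/eqP; apply: eq_fbigl => i.
by rewrite !inE /= andbC; case: (boolP (i \in A)) => //= /(fsubsetP AC).
Qed.

(** Dominated convergence for series: outside a finite set the dominating family contributes less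
    than [e / 2], and on that set only finitely many limits are involved. *)
Lemma csum_tannery I (a : nat -> I -> R[i]) (b : I -> R[i]) :
  absum b -> (forall n i, normc (a n i) <= normc (b i)) ->
  (forall i, seqlim (a ^~ i) 0) -> seqlim (fun n => csum (a n)) 0.
Proof.
move=> ba ab al e e0; have e20 : 0 < e / 2 by rewrite divr_gt0.
have [A hA] := absum_tail ba e20.
have [N hN] := seqlim_sum0 A al e20.
exists N => n /hN; rewrite !subr0 (@csum_split _ _ A); last exact: absum_le ba (ab n).
set s := csum _ => h.
have hs : normc s <= e / 2.
  apply: normc_csum_le => B.
  have : \sum_(i <- [fset i in B | i \notin A]%fset) normc (b i) < e / 2.
    by apply: hA => i; rewrite !inE/= => /andP[].
  move=> /ltW; apply: le_trans.
  rewrite (big_fsetID _ (fun i => i \in A))/=.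
  rewrite big1_fset ?add0r; last first.
    by move=> i; rewrite !inE/= => /andP[_ ->]; rewrite normc0.
  rewrite big_seq [leRHS]big_seq; apply: ler_sum => i.
  by rewrite !inE/= => /andP[_ /negbTE ->].
apply: le_trans (normcD _ _) _; move: h hs.
by move: (normc _) (normc _) => x y; lra.
Qed.

Lemma sums_le_nat (f : nat -> R[i]) K :
  (forall n, \sum_(i < n) normc (f i) <= K) -> sums_le f K.
Proof.
move=> h A.
have [n hn] : exists n, forall i, i \in A -> (i < n)%N.
  by exists (\max_(i <- A) i).+1 => i iA; rewrite ltnS; exact: leq_bigmax_seq.
apply: le_trans (h n).
rewrite -(big_mkord predT (fun i => normc (f i))).
have -> : \sum_(0 <= i < n) normc (f i) =
    \sum_(i <- [fset x | x in iota 0 n]%fset) normc (f i).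
  apply: perm_big; apply: uniq_perm; [exact: iota_uniq|exact: fset_uniq|].
  by move=> x; rewrite !inE mem_index_iota mem_iota.
apply: rsum_mono => [i|]; first exact: normc_ge0.
apply/fsubsetP => i iA; by rewrite !inE mem_iota hn.
Qed.

(* [int] embeds in [bool * nat] by the sign and the absolute value. *)
Lemma sums_le_int (f : nat -> R[i]) K : sums_le f K ->
  sums_le (fun n : int => f (absz n)) (2 * K).
Proof.
move=> fK.
have h1 : sums_le (fun _ : bool => 1 : R[i]) 2.
  have := @sums_le_fin bool (fun _ => 1).
  by rewrite big_bool ComplexField.Normc.normc1.
have inj : injective (fun n : int => (n < 0, absz n)).
  by move=> [n|n] [m|m] //= [] => [->|->].
have := sums_le_inj inj (sums_le_prod h1 fK).
by congr sums_le; apply/funext => n /=; rewrite mul1r.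
Qed.

End Sums.

(** * Generators of the symplectic group *)

Lemma absz_modz_lt (m d : int) : d != 0 -> (absz (m %% d)%Z < absz d)%N.
Proof. by move=> d0; rewrite -ltz_nat gez0_abs ?modz_ge0// ltz_mod. Qed.

Section MatrixEntries.
Variables (V : pzRingType) (m n : nat).
Implicit Types A B : 'M[V]_(m, n).

Lemma mxE_add A B i j : (A + B) i j = A i j + B i j. Proof. by rewrite mxE. Qed.
Lemma mxE_opp A i j : (- A) i j = - A i j. Proof. by rewrite mxE. Qed.
Lemma mxE_scale c A i j : (c *: A) i j = c * A i j. Proof. by rewrite mxE. Qed.

End MatrixEntries.

Section SpGenerators.
Variable g : nat.
Implicit Types (M N : 'M[int]_(g + g)) (A B C D a b : 'M[int]_g) (i j k : 'I_g).

Definition sp_shear b : 'M[int]_(g + g) := block_mx 1%:M b 0 1%:M.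
Definition sp_levi a : 'M[int]_(g + g) := block_mx a 0 0 (invmx a)^T.
(** The matrix with rows [(0, -1)] and [(1, 0)] in the plane of the [i]-th coordinate pair, and the
    identity elsewhere. For [g = 1] it acts by [tau -> - 1 / tau]. *)
Definition sp_inv i : 'M[int]_(g + g) :=
  block_mx (1%:M - delta_mx i i) (- delta_mx i i)
           (delta_mx i i) (1%:M - delta_mx i i).

Lemma Sp2gZP A B C D : Sp2gZ (block_mx A B C D) <->
  [/\ A^T *m C = C^T *m A, A^T *m D - C^T *m B = 1%:M & B^T *m D = D^T *m B].
Proof.
rewrite /Sp2gZ /symplectic_form /= tr_block_mx !mulmx_block.
rewrite !mulmx0 !mulmx1 !mulmxN !mulmx1 !add0r !addr0 !mulNmx.
split.
  move=> /eq_block_mx[h1 h2 h3 h4]; split.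
  - by apply/eqP; rewrite -subr_eq0 addrC; apply/eqP.
  - by rewrite addrC.
  - by apply/eqP; rewrite -subr_eq0 addrC; apply/eqP.
move=> [h1 h2 h3]; congr block_mx.
- by rewrite h1 addNr.
- by rewrite addrC.
- have := congr1 trmx h2.
  rewrite linearB /= !trmx_mul !trmxK trmx1 => <-.
  by rewrite opprB addrC.
- by rewrite h3 addNr.
Qed.

Lemma Sp2gZ_mul M N : Sp2gZ M -> Sp2gZ N -> Sp2gZ (M *m N).
Proof.
rewrite /Sp2gZ /= => hM hN.
transitivity (N^T *m (M^T *m symplectic_form g *m M) *m N).
  by rewrite trmx_mul !mulmxA.
by rewrite hM.
Qed.

Lemma Sp2gZ_shear b : b^T = b -> Sp2gZ (sp_shear b).
Proof.
move=> hb; apply/Sp2gZP.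
by rewrite !trmx1 !trmx0 !mulmx0 !mul0mx !mulmx1 !mul1mx subr0 hb.
Qed.

Lemma Sp2gZ_levi a : a \in unitmx -> Sp2gZ (sp_levi a).
Proof.
move=> ua; apply/Sp2gZP.
by rewrite !trmx0 !mulmx0 !mul0mx subr0 -trmx_mul mulVmx// trmx1.
Qed.

Lemma mul_delta_diag i : delta_mx i i *m delta_mx i i = delta_mx i i :> 'M[int]_g.
Proof. by rewrite mul_delta_mx. Qed.

Lemma Sp2gZ_inv i : Sp2gZ (sp_inv i).
Proof.
apply/Sp2gZP; rewrite !(linearN, linearB) /= trmx1 trmx_delta.
rewrite !(mulmxBl, mulmxBr, mul1mx, mulmx1, mulmxN, mulNmx) !mul_delta_diag.
by split=> //; rewrite ?subrr ?subr0 ?opprK ?oppr0 ?addr0 ?add0r ?addrK ?subrK.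
Qed.

Lemma sp_shearK b M : sp_shear (- b) *m (sp_shear b *m M) = M.
Proof.
rewrite mulmxA /sp_shear mulmx_block !mul1mx !mulmx1 !mul0mx !mulmx0 !addr0.
by rewrite subrr add0r -scalar_mx_block mul1mx.
Qed.

Lemma sp_leviK a M : a \in unitmx ->
  sp_levi (invmx a) *m (sp_levi a *m M) = M.
Proof.
move=> ua; rewrite mulmxA /sp_levi mulmx_block !mul0mx !mulmx0 !addr0 !add0r.
by rewrite -trmx_mul mulVmx ?mulmxV ?unitmx_inv// trmx1
  -scalar_mx_block mul1mx.
Qed.

Lemma refl_unit i : (1%:M - 2 *: delta_mx i i : 'M[int]_g) \in unitmx.
Proof.
suff h : (1%:M - 2 *: delta_mx i i : 'M[int]_g) *m (1%:M - 2 *: delta_mx i i) = 1%:M.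
  by case: (mulmx1_unit h).
rewrite mulmxBl mul1mx mulmxBr mulmx1 -scalemxAl -scalemxAr mul_delta_diag.
rewrite (_ : 2 *: (2 *: _) = 2 *: delta_mx i i + 2 *: delta_mx i i); last first.
  by rewrite scalerA -scalerDl.
by rewrite opprB addrK subrK.
Qed.

(** The square of an inversion is the sign change of one coordinate, hence of the form [sp_levi].
    This makes the inverse of [sp_inv i] a product of generators. *)
Lemma sp_inv2 i : sp_inv i *m sp_inv i = sp_levi (1%:M - 2 *: delta_mx i i).
Proof.
have h : invmx (1%:M - 2 *: delta_mx i i : 'M[int]_g) = 1%:M - 2 *: delta_mx i i.
  have u := refl_unit i.
  apply: (can_inj (mulKmx u)); rewrite mulmxV// mulmxBl mul1mx mulmxBr mulmx1.
  rewrite -scalemxAl -scalemxAr mul_delta_diag.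
  rewrite (_ : 2 *: (2 *: _) = 2 *: delta_mx i i + 2 *: delta_mx i i); last first.
  by rewrite scalerA -scalerDl.
  by rewrite opprB addrK subrK.
have ht : (1%:M - 2 *: delta_mx i i : 'M[int]_g)^T = 1%:M - 2 *: delta_mx i i.
  by apply/matrixP => k l; rewrite !mxE eq_sym andbC.
rewrite /sp_levi h ht /sp_inv mulmx_block.
rewrite !(mulmxBl, mulmxBr, mul1mx, mulmx1, mulmxN, mulNmx) !mul_delta_diag.
rewrite !subrr ?subr0 ?oppr0 ?addr0 ?add0r ?addrN ?addNr ?sub0r.
have -> : 2 *: delta_mx i i = delta_mx i i + delta_mx i i :> 'M[int]_g.
  by rewrite -[X in X + X]scale1r -scalerDl.
by rewrite [- delta_mx i i + _]addrC opprD !addrA.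
Qed.

Section Induction.
Variable P : 'M[int]_(g + g) -> Prop.
Hypothesis P_shear : forall b, b^T = b -> P (sp_shear b).
Hypothesis P_levi : forall a, a \in unitmx -> P (sp_levi a).
Hypothesis P_inv : forall i, P (sp_inv i).
Hypothesis P_mul : forall M N, P M -> P N -> P (M *m N).

Let P_shear_l b M : b^T = b -> P (sp_shear b *m M) -> P M.
Proof.
move=> hb hM; rewrite -(sp_shearK b M); apply: P_mul => //.
by apply: P_shear; rewrite linearN /= hb.
Qed.

Let P_levi_l a M : a \in unitmx -> P (sp_levi a *m M) -> P M.
Proof.
move=> ua hM; rewrite -(sp_leviK M ua); apply: P_mul => //.
by apply: P_levi; rewrite unitmx_inv.
Qed.

Let P_inv_l i M : P (sp_inv i *m M) -> P M.
Proof.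
move=> hM; apply: (P_levi_l (refl_unit i)); rewrite -sp_inv2 -mulmxA.
exact: P_mul.
Qed.

(** Invariant of the column elimination. Only the left half of the matrix is tracked; what is needed
    about [B] and [D] follows from the symplectic relations. *)
Definition std_cols (k : nat) A C := forall (l i : 'I_g), (l < k)%N ->
  A i l = (i == l)%:R /\ C i l = 0.

Lemma mul_deltaE i j A k l : (delta_mx i j *m A) k l = (k == i)%:R * A j l.
Proof.
rewrite mxE (bigD1 j) //= big1 ?addr0 => [|m mj]; rewrite mxE ?eqxx ?andbT//.
by rewrite (negbTE mj) andbF mul0r.
Qed.

Lemma mul_levi_block a A B C D : sp_levi a *m block_mx A B C D =
  block_mx (a *m A) (a *m B) ((invmx a)^T *m C) ((invmx a)^T *m D).
Proof. by rewrite mulmx_block !mul0mx !addr0 !add0r. Qed.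

Lemma mul_shear_block b A B C D : sp_shear b *m block_mx A B C D =
  block_mx (A + b *m C) (B + b *m D) C D.
Proof. by rewrite mulmx_block !mul0mx !mul1mx !add0r. Qed.

Lemma mul_inv_block i A B C D : sp_inv i *m block_mx A B C D =
  block_mx ((1%:M - delta_mx i i) *m A + - delta_mx i i *m C)
           ((1%:M - delta_mx i i) *m B + - delta_mx i i *m D)
           (delta_mx i i *m A + (1%:M - delta_mx i i) *m C)
           (delta_mx i i *m B + (1%:M - delta_mx i i) *m D).
Proof. by rewrite mulmx_block. Qed.

(** Entry [(j, k)] of [A^T C = C^T A], where column [j] is already standard. Consequently a nonzero
    entry in column [k] of [C] lies in row [k] or below, and operating on its row leaves the
    finished columns alone. *)
Lemma std_cols_C0 (k j : 'I_g) A B C D : Sp2gZ (block_mx A B C D) ->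
  std_cols k A C -> (j < k)%N -> C j k = 0.
Proof.
move=> /Sp2gZP[h _ _] sc jk; have := congr1 (fun M : 'M[int]_g => M j k) h.
rewrite !mxE (bigD1 j) //= big1 ?addr0 => [|l lj].
  rewrite mxE; have [-> _] := sc j j jk; rewrite eqxx mul1r => ->.
  by apply: big1 => l _; rewrite mxE; have [_ ->] := sc j l jk; rewrite mul0r.
by rewrite mxE; have [-> _] := sc j l jk; rewrite (negbTE lj) mul0r.
Qed.

(** In [A^T D - C^T B = 1] the rows [l < k] give [D l k = 0]. The diagonal entry at [k] then
    collapses to [A k k * D k k = 1] over the integers. *)
Lemma std_cols_unit (k : 'I_g) A B C D : Sp2gZ (block_mx A B C D) ->
  std_cols k A C -> (forall i, C i k = 0) ->
  (forall i : 'I_g, (k < i)%N -> A i k = 0) -> A k k * A k k = 1.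
Proof.
move=> /Sp2gZP[_ h _] sc C0 A0.
have D0 (l : 'I_g) : (l < k)%N -> D l k = 0.
  move=> lk; have := congr1 (fun M : 'M[int]_g => M l k) h.
  rewrite !mxE (bigD1 l) //= (_ : \sum_j C^T l j * B j k = 0); last first.
    by apply: big1 => m _; rewrite mxE; have [_ ->] := sc l m lk; rewrite mul0r.
  rewrite [X in _ + X - _]big1 => [|m ml]; last first.
    by rewrite mxE; have [-> _] := sc l m lk; rewrite (negbTE ml) mul0r.
  rewrite mxE; have [-> _] := sc l l lk; rewrite eqxx mul1r addr0 subr0 => ->.
  by case: eqP lk => // ->; rewrite ltnn.
have := congr1 (fun M : 'M[int]_g => M k k) h; rewrite !mxE eqxx.
rewrite (_ : \sum_j C^T k j * B j k = 0); last first.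
  by apply: big1 => m _; rewrite mxE C0 mul0r.
rewrite subr0 (bigD1 k) //= big1 ?addr0 => [|m mk].
  rewrite mxE => h1; have : absz (A k k * D k k) = 1%N by rewrite h1.
  rewrite abszM => /eqP; rewrite muln_eq1 => /andP[/eqP h2 _].
  by rewrite -expr2 -real_normK ?num_real// -abszE h2.
rewrite mxE; have [lt|] := ltnP k m; first by rewrite A0// mul0r.
by rewrite leq_eqVlt (inj_eq val_inj) (negbTE mk)/= => /D0 ->; rewrite mulr0.
Qed.

(** Induction on the number [d] of columns still to be treated. For the column [K], [phase1] empties
    its part in [C], [phase2] empties its part in [A] below the diagonal, and [phase3] makes it
    standard. When all columns are done, [A = 1] and [C = 0] leave a shear. *)
Lemma P_std_cols (d k : nat) A B C D : (d + k = g)%N ->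
  Sp2gZ (block_mx A B C D) -> std_cols k A C -> P (block_mx A B C D).
Proof.
elim: d k A B C D => [|d ihd] k A B C D.
  rewrite add0n => ->{k} /Sp2gZP[h1 h2 h3] sc.
  have A1 : A = 1%:M.
    by apply/matrixP => i j; have [-> _] := sc j i (ltn_ord j); rewrite mxE.
  have C0 : C = 0.
    by apply/matrixP => i j; have [_ ->] := sc j i (ltn_ord j); rewrite mxE.
  move: h2 h3; rewrite A1 C0 trmx1 mul1mx trmx0 mul0mx subr0 => ->.
  by rewrite trmx1 mulmx1 mul1mx => h3; exact: P_shear.
move=> dk; have kg : (k < g)%N by rewrite -dk addSn ltnS leq_addl.
pose K := Ordinal kg; rewrite -[k]/(nat_of_ord K).
have phase3 A' B' C' D' : Sp2gZ (block_mx A' B' C' D') -> std_cols K A' C' ->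
    (forall i, C' i K = 0) -> (forall i : 'I_g, (K < i)%N -> A' i K = 0) ->
    P (block_mx A' B' C' D').
  move=> hS sc C0 A0; have AK := std_cols_unit hS sc C0 A0.
  (* [1 + v r] is the identity with column [K] replaced by that of [A']. Since [r v = e - 1] and
     [e^2 = 1], its inverse is [a = 1 - e v r], so [a A'] has a standard column [K]. *)
  pose e := A' K K; pose v := col K A' - delta_mx K 0.
  pose r : 'rV[int]_g := delta_mx 0 K.
  have rv : r *m v = (e - 1)%:M.
    apply/matrixP => i j; rewrite !ord1 !mxE eqxx (bigD1 K)//= big1.
      by rewrite !mxE !eqxx mul1r addr0 mulr1n.
    by move=> l lK; rewrite !mxE eqxx (negbTE lK) mul0r.
  pose a := 1%:M - e *: (v *m r).
  have aK : a *m (1%:M + v *m r) = 1%:M.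
    rewrite /a mulmxBl mul1mx mulmxDr mulmx1 -!scalemxAl.
    have -> : v *m r *m (v *m r) = (e - 1) *: (v *m r).
      by rewrite -mulmxA [r *m _]mulmxA rv mul_scalar_mx -scalemxAr.
    rewrite scalerA mulrBr mulr1 AK -scalerDl.
    rewrite (_ : e + _ = 1) ?scale1r ?addrK//.
    by rewrite addrC subrK.
  have [ua _] := mulmx1_unit aK.
  apply: (P_levi_l ua); have := Sp2gZ_mul (Sp2gZ_levi ua) hS.
  rewrite mul_levi_block => hS'; apply: (ihd k.+1) => //; first by lia.
  move=> l i; rewrite ltnS => lk; split; last first.
    rewrite mxE big1// => m _.
    move: lk; rewrite leq_eqVlt => /orP[/eqP lK|lk].
      by rewrite (_ : l = K) ?C0 ?mulr0//; apply/val_inj.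
    by have [_ ->] := sc l m lk; rewrite mulr0.
  have aE : (a *m A') i l = A' i l - e * (v i 0 * A' K l).
    rewrite /a mulmxBl mul1mx -scalemxAl -mulmxA mxE_add mxE_opp.
    rewrite mxE_scale [(v *m _) _ _]mxE big_ord1 [(r *m _) _ _]mxE.
    have rE m : r 0 m = (m == K)%:R by rewrite /r mxE eqxx.
    rewrite (bigD1 K)//= big1; first by rewrite rE eqxx mul1r addr0.
    by move=> m mK; rewrite rE (negbTE mK) mul0r.
  rewrite aE; move: lk; rewrite leq_eqVlt => /orP[/eqP lK|lk].
    have -> : l = K by apply/val_inj.
    rewrite mulrCA AK mulr1 !mxE andbT; ring.
  have [-> _] := sc l i lk; have [-> _] := sc l K lk.
  have -> : (K == l) = false by apply/eqP => Kl; move: lk; rewrite -Kl ltnn.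
  by rewrite mulr0 mulr0 subr0.
have phase2 (n : nat) A' B' C' D' : Sp2gZ (block_mx A' B' C' D') ->
    std_cols K A' C' -> (forall i, C' i K = 0) ->
    (\sum_(i < g | (K < i)%N) `|A' i K|%N < n)%N -> P (block_mx A' B' C' D').
  elim: n A' B' C' D' => // n ih A' B' C' D' hS sc C0 hn.
  case: (pickP (fun j : 'I_g => (K < j)%N && (A' j K != 0))); last first.
    move=> h; apply: phase3 => // i Ki; have := h i; rewrite Ki /=.
    by case: eqP.
  move=> j /andP[Kj Aj].
  have jK : (j == K) = false by apply/eqP => jK; move: Kj; rewrite jK ltnn.
  have Kj' : (K == j) = false by rewrite eq_sym.
  (* Row [K] minus [q] times row [j] has the remainder modulo [A' j K] in column [K]; the swap then
     puts it into row [j], where it lowers the measure. *)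
  pose q := (A' K K %/ A' j K)%Z.
  pose a := tperm_mx K j *m (1%:M - q *: delta_mx K j : 'M[int]_g).
  have ua : a \in unitmx.
    rewrite unitmx_mul unitmx_perm /=.
    have h : (1%:M - q *: delta_mx K j : 'M[int]_g) *m
       (1%:M + q *: delta_mx K j) = 1%:M.
      rewrite mulmxBl mul1mx mulmxDr mulmx1 -scalemxAl -scalemxAr.
      by rewrite mul_delta_mx_0 ?jK// !scaler0 addr0 addrK.
    by case: (mulmx1_unit h).
  have aE i l : (a *m A') i l = A' (tperm K j i) l
      - (tperm K j i == K)%:R * (q * A' j l).
    rewrite /a -mulmxA -xrowE mxE mulmxBl mul1mx -scalemxAl mxE_add mxE_opp.
    by rewrite mxE_scale mul_deltaE mulrCA.
  apply: (P_levi_l ua); have := Sp2gZ_mul (Sp2gZ_levi ua) hS.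
  rewrite mul_levi_block => hS'; apply: ih => //.
  - move=> l i lk; split; last first.
      by rewrite mxE big1// => m _; have [_ ->] := sc l m lk; rewrite mulr0.
    rewrite aE; have [-> _] := sc l (tperm K j i) lk; have [-> _] := sc l j lk.
    have -> : (j == l) = false.
      by apply/eqP => jl; move: lk; rewrite -jl => /(ltn_trans Kj); rewrite ltnn.
    rewrite !mulr0 subr0; congr (_%:R).
    have Kl : (K == l) = false by apply/eqP => Kl; move: lk; rewrite -Kl ltnn.
    have jl : (j == l) = false.
      by apply/eqP => jl; move: lk; rewrite -jl => /(ltn_trans Kj); rewrite ltnn.
    by case: tpermP => [->|->|//]; rewrite Kl jl.
  - by move=> i; rewrite mxE big1// => m _; rewrite C0 mulr0.
  rewrite ltnS in hn; apply: leq_trans hn.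
  rewrite (bigD1 j) //= [X in (_ < X)%N](bigD1 j) //= -addSn leq_add//.
    rewrite aE tpermR eqxx mul1r.
    exact: absz_modz_lt.
  apply: leq_sum => i /andP[Ki ij].
  have iK : (i == K) = false by apply/eqP => iK; move: Ki; rewrite iK ltnn.
  have ti : tperm K j i = i.
    by apply: tpermD; [rewrite eq_sym iK|rewrite eq_sym].
  by rewrite aE ti iK mul0r subr0.
have phase1 (n : nat) A' B' C' D' : Sp2gZ (block_mx A' B' C' D') ->
    std_cols K A' C' ->
    (\sum_(i < g) `|C' i K|%N < n)%N -> P (block_mx A' B' C' D').
  elim: n A' B' C' D' => // n ih A' B' C' D' hS sc hn.
  case: (pickP (fun j : 'I_g => C' j K != 0)); last first.
    move=> h; apply: (phase2 _.+1 _ _ _ _ hS sc _ (ltnSn _)) => i.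
    by have := h i; case: eqP.
  move=> j Cj.
  have jK : (K <= j)%N.
    rewrite leqNgt; apply/negP => /(std_cols_C0 hS sc) h.
    by move: Cj; rewrite h eqxx.
  (* The shear replaces [A' j K] by its remainder modulo [C' j K], and the inversion in coordinate
     [j] moves this remainder into [C], where it lowers the measure. *)
  pose q := (A' j K %/ C' j K)%Z.
  apply: (@P_shear_l (- q *: delta_mx j j)).
    by apply/matrixP => k1 k2; rewrite !mxE andbC.
  apply: (@P_inv_l j).
  have : Sp2gZ (sp_inv j *m (sp_shear (- q *: delta_mx j j) *m block_mx A' B' C' D')).
    apply: Sp2gZ_mul (Sp2gZ_inv j) (Sp2gZ_mul (Sp2gZ_shear _) hS).
    by apply/matrixP => k1 k2; rewrite !mxE andbC.
  rewrite mul_shear_block mul_inv_block => hS'.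
  set A0 := A' + _ *m C' in hS' *.
  have A0E i l : A0 i l = A' i l - (i == j)%:R * (q * C' j l).
    by rewrite /A0 -scalemxAl mxE_add mxE_scale mul_deltaE mulNr mulrCA.
  clearbody A0; apply: ih => //.
    move=> l i lk; rewrite mulmxBl mul1mx mulNmx.
    rewrite mulmxBl mul1mx !mxE_add !mxE_opp !mul_deltaE A0E.
    have [hA hC] := sc l i lk; have [hAj hCj] := sc l j lk.
    rewrite hA hC hCj.
    have jl0 : (j == l) = false.
      by apply/eqP => jl; move: lk; rewrite -jl ltnNge jK.
    by rewrite A0E hAj hCj jl0 /= !(mulr0, subr0, oppr0, addr0).
  rewrite ltnS in hn; apply: leq_trans hn.
  rewrite (bigD1 j) //= [X in (_ < X)%N](bigD1 j) //= -addSn leq_add//.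
    rewrite mulmxBl mul1mx !mxE_add !mxE_opp !mul_deltaE A0E !eqxx.
    rewrite !mul1r subrr addr0; exact: absz_modz_lt.
  apply: leq_sum => i ij.
  rewrite mulmxBl mul1mx !mxE_add !mxE_opp !mul_deltaE A0E (negbTE ij).
  by rewrite !mul0r subr0 add0r.
move=> hS sc; exact: (phase1 _.+1 A B C D hS sc (ltnSn _)).
Qed.

Lemma Sp2gZ_ind M : Sp2gZ M -> P M.
Proof.
rewrite -[M]submxK => hM; apply: (@P_std_cols g 0) => //.
by rewrite addn0.
Qed.

End Induction.

End SpGenerators.

(** * The Fubini-Study form in homogeneous coordinates *)

Section FubiniStudyFormula.
Variables (R : realType) (N : nat).
Implicit Types (X Y Z V W v : 'rV[R[i]]_N).

Definition sqn Z : R := \sum_a (Re (Z 0 a) ^+ 2 + Im (Z 0 a) ^+ 2).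
Definition rdot Z v : R :=
  \sum_a (Re (Z 0 a) * Re (v 0 a) + Im (Z 0 a) * Im (v 0 a)).

Lemma sqn_line Z v (t : R) : sqn (Z + t%:C%C *: v) =
  sqn Z + t * (2 * rdot Z v) + t ^+ 2 * sqn v.
Proof.
rewrite /sqn /rdot mulr_sumr !mulr_sumr -!big_split /=; apply: eq_bigr => a _.
rewrite !mxE; case: (Z 0 a) (v 0 a) => [x y] [p q] /=; ring.
Qed.

Lemma sqn_gt0 Z : Z != 0 -> 0 < sqn Z.
Proof.
move=> Z0; rewrite lt_def sumr_ge0 ?andbT; last first.
  by move=> a _; rewrite addr_ge0 ?sqr_ge0.
apply: contra Z0; rewrite psumr_eq0; last by move=> a _; rewrite addr_ge0 ?sqr_ge0.
move=> /allP h; apply/eqP/rowP => a; rewrite mxE.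
have := h a (mem_index_enum _); rewrite /= paddr_eq0 ?sqr_ge0// !sqrf_eq0.
by case: (Z 0 a) => x y /= /andP[/eqP -> /eqP ->].
Qed.

Lemma quad_derive (a b c : R) :
  is_derive (0 : R) (1 : R) (fun t : R => a + t * b + t ^+ 2 * c) b.
Proof. by apply: is_derive_eq; rewrite /GRing.scale /=; ring. Qed.

Lemma quad_gt0_near (a b c : R) : 0 < a ->
  \forall t \near (0 : R), 0 < a + t * b + t ^+ 2 * c.
Proof.
move=> a0; have cv : (fun t : R => a + t * b + t ^+ 2 * c) @ (0 : R) --> a.
  have /derivable1_diffP/differentiable_continuous :
    derivable (fun t : R => a + t * b + t ^+ 2 * c) 0 1.
    exact: @ex_derive _ _ _ _ _ _ _ (quad_derive a b c).
  by rewrite /prop_for /continuous_at /= mul0r expr0n /= mul0r !addr0.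
exact: (cvgr_gt a cv).
Qed.

Lemma derive1_ln_quad (a b c : R) : 0 < a ->
  derive1 (fun t : R => ln (a + t * b + t ^+ 2 * c)) 0 = b / a.
Proof.
move=> a0; rewrite derive1E.
have h := quad_derive a b c.
have hl : is_derive ((fun t : R => a + t * b + t ^+ 2 * c) 0) (1 : R) (@ln R) a^-1.
  rewrite /= mul0r expr0n /= mul0r !addr0; exact: is_derive1_ln.
have := @is_derive1_comp R (@ln R) (fun t : R => a + t * b + t ^+ 2 * c) 0 _ _ hl h.
by move=> [_]; rewrite /comp => ->; rewrite mulrC.
Qed.

Lemma derive1_quot_quad (r s a b c : R) : 0 < a ->
  derive1 (fun t : R => (r + t * s) / (a + t * b + t ^+ 2 * c)) 0
    = s / a - r * b / a ^+ 2.
Proof.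
move=> a0; rewrite derive1E.
have [qd qv] := quad_derive a b c.
have q0 : (fun t : R => a + t * b + t ^+ 2 * c) 0 = a.
  by rewrite /= mul0r expr0n /= mul0r !addr0.
have hi : is_derive (0 : R) (1 : R) (fun t : R => (a + t * b + t ^+ 2 * c)^-1)
    (- a ^- 2 * b).
  apply: DeriveDef.
    by apply: derivableV => //; rewrite q0 gt_eqF.
  by rewrite deriveV ?qv ?q0 // gt_eqF.
have hr : is_derive (0 : R) (1 : R) (fun t : R => r + t * s) s.
  by apply: is_derive_eq; rewrite /GRing.scale /=; ring.
have [_ ->] := is_deriveM hr hi.
rewrite q0 mul0r addr0 /GRing.scale /=.
by field; rewrite gt_eqF.
Qed.

Lemma rdot_delta Z b : rdot Z (delta_mx 0 b) = Re (Z 0 b).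
Proof.
rewrite /rdot (bigD1 b)//= big1 => [|a ab].
  by rewrite mxE !eqxx /=; ring.
by rewrite mxE (negbTE ab) andbF /=; ring.
Qed.

Lemma rdot_idelta Z b : rdot Z ('i%C *: delta_mx 0 b) = Im (Z 0 b).
Proof.
rewrite /rdot (bigD1 b)//= big1 => [|a ab].
  by rewrite !mxE !eqxx mulr1 /=; ring.
by rewrite !mxE (negbTE ab) andbF mulr0 /=; ring.
Qed.

Lemma real_derive_log Z v : Z != 0 ->
  real_derive (@log_sqnorm R N) Z v = (2 * rdot Z v / sqn Z)%:C%C.
Proof.
move=> Z0; rewrite /real_derive; congr Complex; last first.
  by rewrite /log_sqnorm /= derive1_cst.
rewrite -(derive1_ln_quad _ (sqn v) (sqn_gt0 Z0)).
by congr (derive1 _ 0); apply/funext => t; rewrite -sqn_line.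
Qed.

Lemma complex_half (z : R[i]) : z / 2 = Complex (Re z / 2) (Im z / 2).
Proof.
have -> : (2 : R[i]) = (2 : R)%:C%C by rewrite rmorph_nat.
by case: z => x y; rewrite -fmorphV /=; simpc.
Qed.

Lemma wirtinger_bar_log b Z : Z != 0 ->
  wirtinger_bar b (@log_sqnorm R N) Z =
  Complex (Re (Z 0 b) / sqn Z) (Im (Z 0 b) / sqn Z).
Proof.
move=> Z0; rewrite /wirtinger_bar !real_derive_log// rdot_delta rdot_idelta.
have n0 : sqn Z != 0 by rewrite gt_eqF ?sqn_gt0.
by rewrite complex_half /=; congr Complex; field.
Qed.

Lemma real_derive_wirtinger_bar b Z v : Z != 0 ->
  real_derive (wirtinger_bar b (@log_sqnorm R N)) Z v =
  Complex (Re (v 0 b) / sqn Z - Re (Z 0 b) * (2 * rdot Z v) / sqn Z ^+ 2)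
          (Im (v 0 b) / sqn Z - Im (Z 0 b) * (2 * rdot Z v) / sqn Z ^+ 2).
Proof.
move=> Z0; have n0 := sqn_gt0 Z0.
(* The closed formula for the first derivative holds away from the origin, so it may be
   differentiated only once the line is known to avoid the origin for small [t]. *)
have nz : \forall t \near (0 : R), Z + t%:C%C *: v != 0.
  have := quad_gt0_near (2 * rdot Z v) (sqn v) n0.
  apply: filterS => t; rewrite -sqn_line => h; apply/eqP => h0; move: h.
  rewrite h0 /sqn big1 ?ltxx// => a _; rewrite mxE /=; ring.
rewrite /real_derive; congr Complex.
  rewrite -(derive1_quot_quad _ _ _ (sqn v) n0) !derive1E.
  apply: near_eq_derive; move: nz; apply: filterS => t h.
  rewrite wirtinger_bar_log// sqn_line !mxE /=; congr (_ / _).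
  by case: (Z 0 b) (v 0 b) => [x y] [p q] /=; ring.
rewrite -(derive1_quot_quad _ _ _ (sqn v) n0) !derive1E.
apply: near_eq_derive; move: nz; apply: filterS => t h.
rewrite wirtinger_bar_log// sqn_line !mxE /=; congr (_ / _).
by case: (Z 0 b) (v 0 b) => [x y] [p q] /=; ring.
Qed.

Lemma wirtinger_wirtinger_bar a b Z : Z != 0 ->
  wirtinger a (wirtinger_bar b (@log_sqnorm R N)) Z =
  (a == b)%:R / (sqn Z)%:C%C
    - ((Z 0 a)^*)%C * Z 0 b / (sqn Z)%:C%C ^+ 2.
Proof.
move=> Z0; have n0 : sqn Z != 0 by rewrite gt_eqF ?sqn_gt0.
rewrite /wirtinger !real_derive_wirtinger_bar// rdot_delta rdot_idelta.
rewrite complex_half -rmorphXn -!fmorphV /= !mxE !eqxx /= [b == a]eq_sym.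
have -> : ((a == b)%:R : R[i]) = ((a == b)%:R : R)%:C%C by rewrite rmorph_nat.
case: (Z 0 a) (Z 0 b) => [x y] [p q] /=.
by case: (a == b) => /=; simpc; congr Complex; field.
Qed.

Definition cdot X Y : R[i] := \sum_a X 0 a * ((Y 0 a)^*)%C.

Definition fs_herm Z V W : R[i] :=
  cdot V W / cdot Z Z - cdot V Z * cdot Z W / cdot Z Z ^+ 2.

Lemma cdot_sqn Z : cdot Z Z = (sqn Z)%:C%C.
Proof.
rewrite /cdot /sqn rmorph_sum; apply: eq_bigr => a _.
by case: (Z 0 a) => x y; rewrite /= ; simpc; congr Complex; ring.
Qed.

Lemma fubini_studyE Z V W : Z != 0 ->
  fubini_study Z V W = 'i%C / 2 * (fs_herm Z V W - fs_herm Z W V).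
Proof.
move=> Z0; rewrite /fubini_study; congr (_ * _); rewrite /ddbar.
have n0 : (sqn Z)%:C%C != 0 by rewrite fmorph_eq0 gt_eqF ?sqn_gt0.
have term X Y : \sum_a \sum_b wirtinger a (wirtinger_bar b (@log_sqnorm R N)) Z
     * (X 0 a * ((Y 0 b)^*)%C) = fs_herm Z X Y.
  rewrite /fs_herm cdot_sqn.
  under eq_bigr do under eq_bigr do rewrite wirtinger_wirtinger_bar// mulrBl.
  under eq_bigr do rewrite big_split /=.
  rewrite big_split /=; congr (_ + _).
    rewrite /cdot mulr_suml; apply: eq_bigr => a _.
    rewrite (bigD1 a)//= big1 ?addr0 ?eqxx => [|b ba].
      by rewrite mul1r mulrC.
    by rewrite eq_sym (negbTE ba) !mul0r.
  under eq_bigr do rewrite sumrN.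
  rewrite sumrN; congr (- _).
  rewrite /cdot big_distrlr /= mulr_suml; apply: eq_bigr => a _.
  rewrite mulr_suml; apply: eq_bigr => b _; ring.
rewrite -!term -sumrB; apply: eq_bigr => a _; rewrite -sumrB.
by apply: eq_bigr => b _; rewrite mulrBr.
Qed.

Lemma cdotDl X Y Z : cdot (X + Y) Z = cdot X Z + cdot Y Z.
Proof. by rewrite -big_split; apply: eq_bigr => a _; rewrite mxE mulrDl. Qed.

Lemma cdotZl c X Z : cdot (c *: X) Z = c * cdot X Z.
Proof. by rewrite mulr_sumr; apply: eq_bigr => a _; rewrite mxE mulrA. Qed.

Lemma cdotDr X Y Z : cdot Z (X + Y) = cdot Z X + cdot Z Y.
Proof. by rewrite -big_split; apply: eq_bigr => a _; rewrite mxE rmorphD mulrDr. Qed.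

Lemma cdotZr c X Z : cdot Z (c *: X) = (c^*)%C * cdot Z X.
Proof. by rewrite mulr_sumr; apply: eq_bigr => a _; rewrite mxE rmorphM mulrCA. Qed.

Lemma cdotE X Y : cdot X Y = (X *m (map_mx conjc Y)^T) 0 0.
Proof. by rewrite mxE; apply: eq_bigr => a _; rewrite !mxE. Qed.

Definition unitary (U : 'M[R[i]]_N) := U *m (map_mx conjc U)^T = 1%:M.

Lemma cdot_unitary U X Y : unitary U -> cdot (X *m U) (Y *m U) = cdot X Y.
Proof.
move=> hU; rewrite !cdotE map_mxM trmx_mul mulmxA -(mulmxA X) hU mulmx1 //.
Qed.

(** [fs_herm Z] vanishes when either argument is a multiple of [Z], so [s] and [t] drop out. The
    factors [c] and its conjugate cancel between numerators and denominators. *)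
Lemma fubini_study_invariant U (c s t : R[i]) Z V W : unitary U ->
  c != 0 -> Z != 0 ->
  fubini_study (c *: (Z *m U)) ((s *: Z + c *: V) *m U) ((t *: Z + c *: W) *m U)
    = fubini_study Z V W.
Proof.
move=> hU c0 Z0.
have n0 : cdot Z Z != 0 by rewrite cdot_sqn fmorph_eq0 gt_eqF ?sqn_gt0.
have cc0 : (c^*)%C != 0 by rewrite fmorph_eq0.
have cZ0 : c *: (Z *m U) != 0.
  apply/eqP => h; move: n0; rewrite -(cdot_unitary _ _ hU).
  have : cdot (c *: (Z *m U)) (Z *m U) = 0 by rewrite h /cdot big1// => a _; rewrite mxE mul0r.
  by rewrite cdotZl => /eqP; rewrite mulf_eq0 (negbTE c0) => /eqP ->; rewrite eqxx.
rewrite !fubini_studyE//; congr (_ * _).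
have inv X Y x y : fs_herm (c *: (Z *m U)) ((x *: Z + c *: X) *m U) ((y *: Z + c *: Y) *m U)
   = fs_herm Z X Y.
  rewrite /fs_herm !scalemxAl !cdot_unitary//.
  rewrite !(cdotDl, cdotDr, cdotZl, cdotZr).
  by field; rewrite n0 c0 cc0.
by rewrite !inv.
Qed.

End FubiniStudyFormula.

(** * Convergence and Taylor expansion of theta constants *)

Section GaussianSums.
Variable R : realType.
Implicit Types (x y h d : R).

Lemma geometric_le (q : R) n : 0 <= q < 1 -> \sum_(i < n) q ^+ i <= (1 - q)^-1.
Proof.
move=> /andP[q0 q1]; have q1' : 0 < 1 - q by rewrite subr_gt0.
rewrite -[leRHS]mul1r ler_pdivlMr// mulrC.
have -> : (1 - q) * \sum_(i < n) q ^+ i = 1 - q ^+ n.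
  by rewrite -[RHS]opprB subrX1 -mulNr opprB.
by rewrite lerBlDr lerDl exprn_ge0.
Qed.

Lemma expR_opp_le h : 0 < h -> (1 - expR (- h))^-1 <= (1 + h) / h.
Proof.
move=> h0; have h1 : 0 < 1 + h by lra.
have e1 : expR (- h) <= (1 + h)^-1.
  by rewrite expRN lef_pV2 ?posrE ?expR_gt0// expR_ge1Dx.
have : h / (1 + h) <= 1 - expR (- h).
  apply: le_trans (lerB (lexx 1) e1).
  rewrite -[X in X - _](@mulfV _ (1 + h)) ?gt_eqF// -[X in _ - X]mul1r -mulrBl.
  by rewrite addrAC subrr add0r.
move=> e2; have p : 0 < h / (1 + h) by rewrite divr_gt0.
rewrite -[leRHS]invrK invf_div lef_pV2 ?posrE// (lt_le_trans p e2)//.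
Qed.

(** Two geometric series, one for each sign, with [1 - e^(-h) >= h / (1 + h)]. The dependence on [h]
    is explicit because [h] will be a mesh tending to 0, where the bound grows only like [1 / h]. *)
Lemma sums_le_expR_int h : 0 < h ->
  sums_le (fun n : int => (expR (- (h * (absz n)%:R)))%:C%C) (2 * ((1 + h) / h)).
Proof.
move=> h0; apply: (@sums_le_int R (fun n => (expR (- (h * n%:R)))%:C%C)).
apply: sums_le_nat => n; apply: le_trans (expR_opp_le h0).
have := @geometric_le (expR (- h)) n; rewrite expR_ge0 expR_lt1 oppr_lt0 h0 => /(_ isT).
apply: le_trans; rewrite le_eqVlt; apply/orP; left; apply/eqP.
apply: eq_bigr => i _; rewrite normc_real ger0_norm ?expR_ge0//.
by rewrite -mulNr expRM_natr.
Qed.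

Definition nsq g (x : 'cV[R]_g) : R := \sum_i x i 0 ^+ 2.

Lemma nsq_ge0 g (x : 'cV[R]_g) : 0 <= nsq x.
Proof. by apply: sumr_ge0 => i _; exact: sqr_ge0. Qed.

Lemma absum_prod_expR g d : 0 < d ->
  absum (fun m : 'cV[int]_g => (\prod_i expR (- (d * (absz (m i 0%R))%:R)))%:C%C).
Proof.
move=> d0; elim: g => [|g ih].
  exists 1 => A.
  have h : (A `<=` [fset 0])%fset.
    by apply/fsubsetP => m _; rewrite inE; apply/eqP/matrixP => -[].
  apply: le_trans (rsum_mono (fun _ => normc_ge0 _) h) _.
  by rewrite big_seq_fset1 big_ord0 normc_real normr1.
pose f (n : int) : R[i] := (expR (- (d * (absz n)%:R)))%:C%C.
have fa : absum f by eexists; exact: sums_le_expR_int.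
pose k (m : 'cV[int]_g.+1) := (m ord0 0%R, \col_i m (lift ord0 i) 0%R).
have ki : injective k.
  move=> m n [h1 /matrixP h2]; apply/matrixP => i j; rewrite !ord1.
  case: (unliftP ord0 i) => [l ->|-> //].
  by have := h2 l 0; rewrite !mxE.
have := absum_inj ki (absum_prod fa ih).
congr absum; apply/funext => m /=; rewrite /f -rmorphM big_ord_recl.
by congr (_ * _)%:C%C; apply: eq_bigr => i _; rewrite mxE.
Qed.

(* [(n + u)^2 >= |n + u| - 1 >= |n| - |u| - 1]. *)
Lemma absum_gauss g d (u : 'cV[R]_g) : 0 < d ->
  absum (fun m : 'cV[int]_g => (expR (- (d * nsq (map_mx intr m + u))))%:C%C).
Proof.
move=> d0; apply: (absum_sub (K := \prod_i expR (d * (`|u i 0| + 1))) (absum_prod_expR g d0)).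
move=> m; rewrite !normc_real ger0_norm ?expR_ge0// ger0_norm; last first.
  by apply: prodr_ge0 => i _; exact: expR_ge0.
rewrite -big_split /= /nsq mulr_sumr -sumrN expR_sum.
apply: ler_prod => i _; rewrite expR_ge0 /= -expRD ler_expR !mxE.
rewrite -!mulrN -mulrDr ler_pM2l//.
set n := m i 0; set v := u i 0.
have -> : (absz n)%:R = `|n%:~R| :> R by rewrite -intr_norm -abszE.
have h1 : `|n%:~R : R| <= `|n%:~R + v| + `|v|.
  by rewrite -[X in `|X| <= _](addrK v) ler_normB.
have h2 : `|n%:~R + v| ^+ 2 = (n%:~R + v) ^+ 2 by rewrite real_normK ?num_real.
have aux (p q r s : R) : q <= p + r -> p ^+ 2 = s -> - s <= r + 1 - q.
  by move=> h3 <-; have := sqr_ge0 (p - 1); nra.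
by rewrite mulrN -expr2; exact: (aux _ _ _ _ h1 h2).
Qed.

(** The square of [s <= (2 / c) e^(c s / 2)]. *)
Lemma sqr_expR_le (c s : R) : 0 < c -> 0 <= s ->
  s ^+ 2 * expR (- (c * s)) <= 4 / c ^+ 2.
Proof.
move=> c0 s0.
have h : s <= 2 / c * expR (c * s / 2).
  have := expR_ge1Dx (c * s / 2) => h1.
  rewrite mulrAC ler_pdivlMr//; nra.
have h2 : s ^+ 2 <= (2 / c * expR (c * s / 2)) ^+ 2 by rewrite ler_sqr ?nnegrE// (le_trans s0 h).
apply: le_trans (ler_wpM2r (expR_ge0 _) h2) _.
rewrite exprMn -expRM_natr divfK ?pnatr_eq0// -mulrA -expRD subrr expR0 mulr1.
by rewrite expr_div_n -natrX.
Qed.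

End GaussianSums.

(** * Quadratic forms at real points and coercivity of [Im tau] *)

Section QuadraticForm.
Variables (R : realType) (g : nat).
Implicit Types (A B H tau : 'M[R[i]]_g) (x : 'cV[R]_g) (d : R).

(** This norm is submultiplicative, unlike the largest entry norm, and it bounds quadratic forms:
    [|qf A x| <= mxsum_norm A * nsq x]. *)
Definition mxsum_norm m n (A : 'M[R[i]]_(m, n)) : R := \sum_i \sum_j normc (A i j).

Lemma mxsum_norm_ge0 m n (A : 'M[R[i]]_(m, n)) : 0 <= mxsum_norm A.
Proof. by do 2![apply: sumr_ge0 => ? _]; exact: normc_ge0. Qed.

Lemma mxsum_norm_entry m n (A : 'M[R[i]]_(m, n)) i j : normc (A i j) <= mxsum_norm A.
Proof.
rewrite /mxsum_norm (bigD1 i)//= (bigD1 j)//= -addrA lerDl addr_ge0//.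
  by apply: sumr_ge0 => ? _; exact: normc_ge0.
by do 2![apply: sumr_ge0 => ? _]; exact: normc_ge0.
Qed.

Lemma mxsum_normD m n (A B : 'M[R[i]]_(m, n)) :
  mxsum_norm (A + B) <= mxsum_norm A + mxsum_norm B.
Proof.
rewrite -big_split; apply: ler_sum => i _; rewrite -big_split.
by apply: ler_sum => j _; rewrite mxE; exact: normcD.
Qed.

Lemma mxsum_normZ m n c (A : 'M[R[i]]_(m, n)) :
  mxsum_norm (c *: A) = normc c * mxsum_norm A.
Proof.
rewrite mulr_sumr; apply: eq_bigr => i _; rewrite mulr_sumr.
by apply: eq_bigr => j _; rewrite mxE normcM.
Qed.

Lemma mxsum_normM m n p (A : 'M[R[i]]_(m, n)) (B : 'M[R[i]]_(n, p)) :
  mxsum_norm (A *m B) <= mxsum_norm A * mxsum_norm B.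
Proof.
rewrite mulr_suml; apply: ler_sum => i _; rewrite mulr_suml.
apply: le_trans (_ : \sum_k \sum_j normc (A i j) * normc (B j k) <= _).
  apply: ler_sum => k _; rewrite mxE; apply: le_trans (normc_sum _ _ _) _.
  by apply: ler_sum => j _; rewrite normcM.
rewrite exchange_big; apply: ler_sum => j _ /=; rewrite -mulr_sumr.
apply: ler_wpM2l; first exact: normc_ge0.
rewrite [leRHS](bigD1 j)//= lerDl.
by do 2![apply: sumr_ge0 => ? _]; exact: normc_ge0.
Qed.

(** The argument is real because theta terms evaluate the form only at points [m + u]; thus
    [Im (qf A x)] is the form of [Im A]. *)
Definition qf A x : R[i] := \sum_i \sum_j (x i 0 * x j 0)%:C%C * A i j.

Lemma qfE A x :
  ((map_mx (real_complex R) x)^T *m A *m map_mx (real_complex R) x) 0 0 = qf A x.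
Proof.
rewrite mxE /qf exchange_big /=; apply: eq_bigr => j _; rewrite mxE mulr_suml.
by apply: eq_bigr => i _; rewrite !mxE rmorphM mulrAC.
Qed.

Lemma qf_linear c A B x : qf (c *: A + B) x = c * qf A x + qf B x.
Proof.
rewrite mulr_sumr -big_split; apply: eq_bigr => i _.
rewrite mulr_sumr -big_split; apply: eq_bigr => j _.
by rewrite !mxE mulrDr mulrCA.
Qed.

Lemma qfD A B x : qf (A + B) x = qf A x + qf B x.
Proof. by have := qf_linear 1 A B x; rewrite scale1r mul1r. Qed.

Lemma normc_qf A x : normc (qf A x) <= mxsum_norm A * nsq x.
Proof.
rewrite mulr_suml; apply: le_trans (normc_sum _ _ _) _; apply: ler_sum => i _.
rewrite mulr_suml; apply: le_trans (normc_sum _ _ _) _; apply: ler_sum => j _.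
rewrite normcM mulrC normc_real; apply: ler_wpM2l; first exact: normc_ge0.
have hi k : x k 0 ^+ 2 <= nsq x.
  rewrite /nsq (bigD1 k)//= lerDl; apply: sumr_ge0 => l _; exact: sqr_ge0.
have := hi i; have := hi j; have := sqr_ge0 (`|x i 0| - `|x j 0|).
rewrite sqrrB !real_normK ?num_real// normrM.
by move: (`|_| * `|_|) (_ ^+ 2) (_ ^+ 2) => p q r; lra.
Qed.

Lemma Im_qf A x : Im (qf A x) = (x^T *m map_mx (@complex.Im R) A *m x) 0 0.
Proof.
rewrite mxE /qf exchange_big /= raddf_sum; apply: eq_bigr => j _.
rewrite mxE mulr_suml raddf_sum; apply: eq_bigr => i _; rewrite !mxE.
by case: (A i j) => a b /=; ring.
Qed.

Definition im_coercive d tau := forall x, d * nsq x <= Im (qf tau x).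

Lemma im_coercive_near d tau H : im_coercive d tau -> mxsum_norm H <= d / 2 ->
  im_coercive (d / 2) (tau + H).
Proof.
move=> dt Hd x; rewrite qfD raddfD /=.
have h1 := dt x; have h2 := le_trans (normc_Im _) (normc_qf H x).
have := ler_wpM2r (nsq_ge0 x) Hd => h3.
move: h2; rewrite ler_norml => /andP[h2 _].
by move: h1 h2 h3; move: (Im _) (Im _) (nsq x) (mxsum_norm H * _) => p q r s; lra.
Qed.

(** The form of [Im tau] attains its minimum on the compact unit sphere, where it is positive, and
    homogeneity carries the bound to all [x]. *)
Lemma siegel_coercive tau : siegel_half_space tau -> exists2 d, 0 < d & im_coercive d tau.
Proof.
move=> [_ ht].
pose S := [set v : 'rV[R]_g | nsq v^T = 1].
pose f (v : 'rV[R]_g) : R := \sum_i \sum_j v 0 i * v 0 j * Im (tau i j).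
have fE v : f v = Im (qf tau v^T).
  rewrite /f /qf raddf_sum; apply: eq_bigr => i _; rewrite raddf_sum.
  by apply: eq_bigr => j _; rewrite !mxE; case: (tau i j) => a b /=; ring.
have sumc (h : 'I_g -> 'rV[R]_g -> R) : (forall i, continuous (h i)) ->
    continuous (fun v => \sum_i h i v).
  by move=> hc; apply: continuous_big => //; exact: add_continuous.
have fc : continuous f.
  apply: (sumc) => i; apply: (sumc) => j v.
  apply: (@cvgM R _ (nbhs v) _ (fun v => v 0 i * v 0 j) (fun=> Im (tau i j))).
    apply: (@cvgM R _ (nbhs v) _ (fun v => v 0 i) (fun v => v 0 j));
      exact: coord_continuous.
  exact: cvg_cst.
have nc : continuous (fun v : 'rV[R]_g => nsq v^T).
  apply: (sumc) => i v.
  rewrite (_ : (fun x : 'rV[R]_g => _) = (fun x : 'rV[R]_g => x 0 i * x 0 i)).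
    apply: (@cvgM R _ (nbhs v) _ (fun v => v 0 i) (fun v => v 0 i));
      exact: coord_continuous.
  by apply/funext => w; rewrite mxE expr2.
have scale x : nsq x != 0 -> exists2 c : R, 0 < c & exists2 v, S v & x = c *: v^T.
  move=> n0; have np : 0 < nsq x by rewrite lt_def n0 nsq_ge0.
  exists (Num.sqrt (nsq x)); first by rewrite sqrtr_gt0.
  exists ((Num.sqrt (nsq x))^-1 *: x^T); last first.
    by rewrite linearZ /= trmxK scalerA mulfV ?scale1r// gt_eqF// sqrtr_gt0.
  rewrite /S /= linearZ /= trmxK {1}/nsq.
  under eq_bigr do rewrite mxE exprMn exprVn sqr_sqrtr ?nsq_ge0//.
  by rewrite -mulr_sumr mulVf.
have qf0 x : nsq x = 0 -> qf tau x = 0.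
  move=> n0; apply/eqP; rewrite -normc_eq0 eq_le normc_ge0 andbT.
  by apply: le_trans (normc_qf _ _) _; rewrite n0 mulr0.
have qfZ c x : qf tau (c *: x) = (c ^+ 2)%:C%C * qf tau x.
  rewrite mulr_sumr; apply: eq_bigr => i _; rewrite mulr_sumr.
  by apply: eq_bigr => j _; rewrite !mxE [RHS]mulrA -rmorphM; congr (_%:C%C * _); ring.
have nZ c x : nsq (c *: x) = c ^+ 2 * nsq x.
  by rewrite mulr_sumr; apply: eq_bigr => i _; rewrite mxE exprMn.
(* If the sphere is empty, [scale] forces [nsq x = 0] for all [x], and any [d] works. *)
have [S0|S0] := pselect (S !=set0); last first.
  exists 1 => // x; have [n0|n0] := eqVneq (nsq x) 0; first by rewrite qf0 // n0 mulr0.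
  by have [c _ [v vS _]] := scale _ n0; case: S0; exists v.
have Sb : bounded_set S.
  exists 1; split; first exact: num_real.
  move=> M M1 v vS /=; rewrite (_ : `|v| = mx_norm v)// mx_normrE; apply/bigmax_leP.
  split; first by apply: le_trans (ltW M1).
  move=> [i j] _ /=; rewrite ord1; apply: le_trans (ltW M1).
  rewrite -(@ler_pXn2r _ 2) ?nnegrE// expr1n real_normK ?num_real//.
  rewrite -[X in _ <= X](vS : nsq v^T = 1) /nsq (bigD1 j)//= mxE lerDl.
  by apply: sumr_ge0 => l _; exact: sqr_ge0.
have Sc : closed S.
  have -> : S = (fun v : 'rV[R]_g => nsq v^T) @^-1` [set x | x = 1] by [].
  by apply: preimage_closed => // v _; exact: nc.
have [v vS vmin] := EVT_min_rV S0 (bounded_closed_compact Sb Sc) (continuous_subspaceT fc).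
exists (f v).
  rewrite fE Im_qf; apply: ht; apply/eqP => v0; move: vS => /set_mem; rewrite /S /= v0 /nsq.
  rewrite big1 => [/eqP|i _]; first by rewrite eq_sym oner_eq0.
  by rewrite mxE expr0n.
move=> x; have [n0|n0] := eqVneq (nsq x) 0; first by rewrite qf0 // n0 mulr0.
have [c c0 [w wS ->]] := scale _ n0.
rewrite qfZ nZ (wS : nsq w^T = 1) mulr1 mulrC.
have -> : Im ((c ^+ 2)%:C%C * qf tau w^T) = c ^+ 2 * f w.
  by rewrite fE; case: (qf _ _) => a b /=; ring.
by rewrite ler_pM2l ?exprn_gt0//; apply: vmin; exact: mem_set.
Qed.

End QuadraticForm.

(** * Theta constants as absolutely convergent series, and their derivatives *)

Section ThetaTerm.
Variables (R : realType) (g : nat).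
Implicit Types (A B H tau : 'M[R[i]]_g) (x u : 'cV[R]_g) (d : R).

Definition thterm tau u (m : 'cV[int]_g) : R[i] :=
  cexp (twopii R * qf tau (map_mx intr m + u)).

Definition half_real (e : 'cV['I_2]_g) : 'cV[R]_g := \col_i ((e i 0 : nat)%:R / 2).

Definition thnull tau (e : 'cV['I_2]_g) : R[i] := csum (thterm tau (half_real e)).

Lemma theta_nullE tau k : theta_null tau 0 k = thnull tau (enum_val k).
Proof.
rewrite mxE; set e := enum_val k; rewrite /theta /thnull /csum.
apply: (congr1 (fun f : 'cV[int]_g -> R[i]^o => summability.sum f : R[i])).
apply/funext => m.
rewrite mulmx0 [X in _ + _ * X]mxE mulr0 addr0 -/(twopii R); congr (cexp (_ * _)).
rewrite -qfE; have -> : map_mx (real_complex R) (map_mx intr m + half_real e)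
   = map_mx intr m + half_char R e; last by [].
apply/matrixP => i j; rewrite !mxE rmorphD rmorph_int; congr (_ + _).
by rewrite fmorph_div !rmorph_nat.
Qed.

Lemma Re_twopii (z : R[i]) : Re (twopii R * z) = - (2 * pi * Im z).
Proof. by rewrite twopiiE; case: z => a b /=; ring. Qed.

Lemma normc_twopii : normc (twopii R) = 2 * pi.
Proof.
rewrite twopiiE /= expr0n add0r sqrtr_sqr ger0_norm// mulr_ge0// ltW//.
exact: pi_gt0.
Qed.

Lemma normc_thterm d tau u m : im_coercive d tau ->
  normc (thterm tau u m) <= expR (- (2 * pi * d * nsq (map_mx intr m + u))).
Proof.
move=> h; rewrite normc_cexp ler_expR Re_twopii lerN2 -mulrA ler_wpM2l//.
by rewrite mulr_ge0// ltW// pi_gt0.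
Qed.

Lemma absum_thterm d tau u : 0 < d -> im_coercive d tau -> absum (thterm tau u).
Proof.
move=> d0 h; have c0 : 0 < 2 * pi * d by rewrite !mulr_gt0// pi_gt0.
apply: (absum_le (absum_gauss u c0)) => m.
by rewrite normc_real ger0_norm ?expR_ge0//; exact: normc_thterm.
Qed.

Lemma thtermD tau H u m :
  thterm (tau + H) u m = thterm tau u m * cexp (twopii R * qf H (map_mx intr m + u)).
Proof. by rewrite /thterm qfD mulrDr cexpD. Qed.

(** The derivative of the term in the direction [H]: its exponent is linear in [tau]. *)
Definition dthterm tau u H m : R[i] :=
  twopii R * qf H (map_mx intr m + u) * thterm tau u m.

Definition dtheta tau u H : R[i] := csum (dthterm tau u H).

(** With [c = 2 pi d] and [s = |m + u|^2] a term is at most [e^(-c s)]. Half of this exponent is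
    kept as the summable family [G]. For the first order term the other half absorbs the factor [s]
    (constant [K1]). For the remainder one quarter absorbs [s^2] (constant [K2]) and one quarter
    absorbs [e^|z|], where [|z| <= c s / 4] is what [mxsum_norm H <= d / 4] ensures. *)
Lemma dthterm_bound d tau u : 0 < d -> im_coercive d tau ->
  exists2 K : R, 0 <= K & exists2 G : 'cV[int]_g -> R[i], absum G &
    forall H m, normc (dthterm tau u H m) <= K * mxsum_norm H * normc (G m) /\
    (mxsum_norm H <= d / 4 ->
      normc (thterm (tau + H) u m - thterm tau u m - dthterm tau u H m)
       <= K * mxsum_norm H ^+ 2 * normc (G m)).
Proof.
move=> d0 h; set c := 2 * pi * d; have p0 : 0 < pi :> R := pi_gt0 R.
have c0 : 0 < c by rewrite !mulr_gt0.
pose G m : R[i] := (expR (- (c / 2 * nsq (map_mx intr m + u))))%:C%C.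
pose K1 : R := 2 * pi * (2 / c); pose K2 : R := 4 * (2 * pi) ^+ 2 * (4 / (c / 4) ^+ 2).
have K10 : 0 <= K1 by rewrite !mulr_ge0// ?invr_ge0 ltW.
have K20 : 0 <= K2 by rewrite !mulr_ge0 ?exprn_ge0// ?invr_ge0 ?exprn_ge0 ?divr_ge0 ?mulr_ge0// ltW.
exists (K1 + K2); first exact: addr_ge0.
exists G; first by apply: absum_gauss; rewrite divr_gt0.
move=> H m; set x := map_mx intr m + u; set N := mxsum_norm H.
have N0 : 0 <= N := mxsum_norm_ge0 H.
have s0 := nsq_ge0 x; set s := nsq x in s0 *.
have hx : normc (twopii R * qf H x) <= 2 * pi * N * s.
  rewrite normcM normc_twopii -mulrA ler_wpM2l ?mulr_ge0 ?(ltW p0)//.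
  exact: normc_qf.
have ha : normc (thterm tau u m) <= expR (- (c * s)) by exact: normc_thterm.
have Gs : normc (G m) = expR (- (c / 2 * s)).
  by rewrite normc_real ger0_norm ?expR_ge0.
split.
  rewrite normcM; apply: le_trans (ler_pM (normc_ge0 _) (normc_ge0 _) hx ha) _.
  have e1 : s * expR (- (c * s)) <= 2 / c * expR (- (c / 2 * s)).
    have -> : - (c * s) = - (c / 2 * s) + - (c / 2 * s) by field.
    rewrite expRD mulrA ler_wpM2r ?expR_ge0// expRN ler_pdivrMr ?expR_gt0//.
    rewrite [leRHS]mulrAC ler_pdivlMr//.
    have h1 := expR_ge1Dx (c / 2 * s).
    suff : c / 2 * s <= expR (c / 2 * s) by move: (expR _) => E; lra.
    by apply: le_trans h1; rewrite lerDr.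
  rewrite Gs; apply: le_trans (_ : K1 * N * expR (- (c / 2 * s)) <= _).
    rewrite (_ : 2 * pi * N * s * _ = 2 * pi * N * (s * expR (- (c * s)))); last by ring.
    rewrite (_ : K1 * N * _ = 2 * pi * N * (2 / c * expR (- (c / 2 * s)))); last first.
      by rewrite /K1; ring.
    by rewrite ler_wpM2l// !mulr_ge0// ltW.
  by rewrite ler_wpM2r ?expR_ge0// ler_wpM2r// lerDl.
move=> Nd; rewrite thtermD -/x.
set z := twopii R * qf H x in hx *.
have -> : thterm tau u m * cexp z - thterm tau u m - dthterm tau u H m
   = thterm tau u m * (cexp z - 1 - z).
  by rewrite /dthterm -/x -/z; ring.
rewrite normcM.
have zs : normc z <= c / 4 * s.
  apply: le_trans hx _; rewrite ler_wpM2r//.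
  by rewrite /c -[leRHS]mulrA ler_wpM2l// mulr_ge0// ltW.
have h3 : normc (cexp z - 1 - z) <= 4 * (2 * pi * N * s) ^+ 2 * expR (c / 4 * s).
  apply: le_trans (cexp_taylor z) _; apply: ler_pM.
  - by rewrite mulr_ge0// sqr_ge0.
  - exact: expR_ge0.
  - by rewrite ler_wpM2l// ler_sqr ?nnegrE ?normc_ge0// (le_trans (normc_ge0 _) hx).
  - by rewrite ler_expR.
apply: le_trans (ler_pM (normc_ge0 _) (normc_ge0 _) ha h3) _.
have e2 := @sqr_expR_le R (c / 4) s (divr_gt0 c0 (ltr0n _ 4)) s0.
have -> : expR (- (c * s)) * (4 * (2 * pi * N * s) ^+ 2 * expR (c / 4 * s))
   = 4 * (2 * pi) ^+ 2 * N ^+ 2 * (s ^+ 2 * expR (- (c / 4 * s))) * expR (- (c / 2 * s)).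
  rewrite mulrCA -expRD (_ : - (c * s) + _ = - (c / 4 * s) + - (c / 2 * s)); last by field.
  by rewrite expRD; ring.
rewrite Gs ler_wpM2r ?expR_ge0//.
apply: le_trans (ler_wpM2l _ e2) _.
  by rewrite !mulr_ge0 ?sqr_ge0 ?(ltW p0).
rewrite [leLHS](_ : _ = K2 * N ^+ 2); last by rewrite /K2; move: (4 / _) => q; ring.
by rewrite ler_wpM2r ?sqr_ge0// lerDr.
Qed.

Lemma dtheta_linear d tau u c A B : 0 < d -> im_coercive d tau ->
  dtheta tau u (c *: A + B) = c * dtheta tau u A + dtheta tau u B.
Proof.
move=> d0 h; have [K K0 [G Ga hG]] := dthterm_bound u d0 h.
have da H : absum (dthterm tau u H).
  by apply: (absum_sub (K := K * mxsum_norm H) Ga) => m; case: (hG H m).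
rewrite /dtheta -csumZ// -csumD//; last exact: absumZ.
by congr csum; apply/funext => m; rewrite /dthterm qf_linear; ring.
Qed.

(** The termwise bounds are summed. They are uniform in [H], which permits increments that vary
    along a curve. *)
Lemma theta_taylor d tau u : 0 < d -> im_coercive d tau ->
  exists2 K : R, 0 <= K &
    (forall H, normc (dtheta tau u H) <= K * mxsum_norm H) /\
    (forall H, mxsum_norm H <= d / 4 ->
      normc (csum (thterm (tau + H) u) - csum (thterm tau u) - dtheta tau u H)
       <= K * mxsum_norm H ^+ 2).
Proof.
move=> d0 h; have [K K0 [G Ga hG]] := dthterm_bound u d0 h.
have [L hL] := Ga.
have L0 : 0 <= L by have := hL fset0; rewrite big_seq_fset0.
have da H : absum (dthterm tau u H).
  by apply: (absum_sub (K := K * mxsum_norm H) Ga) => m; case: (hG H m).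
exists (K * L); first exact: mulr_ge0.
split=> [H|H Hd].
  apply: normc_csum_le => A.
  apply: le_trans (ler_sum _ (fun m _ => (hG H m).1)) _.
  rewrite -mulr_sumr [leRHS]mulrAC; apply: ler_wpM2l; first by rewrite mulr_ge0// mxsum_norm_ge0.
  exact: hL.
have ta : absum (thterm tau u) := absum_thterm u d0 h.
have ta' : absum (thterm (tau + H) u).
  have Hd2 : mxsum_norm H <= d / 2 by apply: le_trans Hd _; lra.
  by apply: (absum_thterm u _ (im_coercive_near h Hd2)); rewrite divr_gt0.
have -> : csum (thterm (tau + H) u) - csum (thterm tau u) - dtheta tau u H =
  csum (fun m => thterm (tau + H) u m - thterm tau u m - dthterm tau u H m).
  rewrite -mulN1r -[X in _ - X]mul1r -mulNr -!csumZ// -csumD//; last exact: absumZ.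
  rewrite -csumD; [|by apply: absumD => //; exact: absumZ|exact: absumZ].
  by congr csum; apply/funext => m; ring.
apply: normc_csum_le => A.
apply: le_trans (ler_sum _ (fun m _ => (hG H m).2 Hd)) _.
rewrite -mulr_sumr [leRHS]mulrAC; apply: ler_wpM2l; last exact: hL.
by rewrite mulr_ge0// sqr_ge0.
Qed.

End ThetaTerm.

(** * Poisson summation for the Gaussian *)

Section RootsOfUnity.
Variable R : realType.

Lemma cexp_real_twopii (x : R) :
  cexp (twopii R * x%:C%C) = Complex (cos (2 * pi * x)) (sin (2 * pi * x)).
Proof.
rewrite twopiiE; have -> : (Complex 0 (2 * pi) : R[i]) * x%:C%C = Complex 0 (2 * pi * x).
  by simpc.
by rewrite /cexp /= expR0 !mul1r.
Qed.

Lemma cos_double (x : R) : cos (x + x) = 1 - 2 * sin x ^+ 2.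
Proof. by rewrite cosD -!expr2 cos2sin2; ring. Qed.

Lemma cexp_twopii_neq1 (x : R) : 0 < x < 1 -> cexp (twopii R * x%:C%C) != 1.
Proof.
move=> /andP[x0 x1]; apply/eqP; rewrite cexp_real_twopii => -[h _].
have hx : 2 * pi * x = pi * x + pi * x by ring.
have : 0 < sin (pi * x :> R).
  by apply: sin_gt0_pi; rewrite mulr_gt0 ?pi_gt0//= gtr_pMr ?pi_gt0.
move: h; rewrite hx cos_double; move: (sin _) => s; nra.
Qed.

Lemma cexp_div_neq1 (j : int) (n : nat) : (0 < n)%N -> ~~ (n%:Z %| j)%Z ->
  cexp (twopii R * (j%:~R / n%:R)) != 1.
Proof.
move=> n0 nj; have n0' : n%:Z != 0 by lia.
have nR : (n%:R : R[i]) != 0 by rewrite pnatr_eq0 -lt0n.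
rewrite {1}(divz_eq j n%:Z) rmorphD rmorphM /= -pmulrn mulrDl mulfK//.
rewrite mulrDr cexpD cexp_int mul1r.
set r := (j %% n%:Z)%Z.
have r0 : 0 <= r by apply: modz_ge0.
have rn : r < n%:Z by rewrite ltz_pmod// ltz_nat.
have r1 : r != 0 by apply: contra nj => /eqP h; apply/dvdz_mod0P.
have -> : (r%:~R / n%:R : R[i]) = (r%:~R / n%:R : R)%:C%C.
  by rewrite fmorph_div rmorph_int rmorph_nat.
have nR' : 0 < (n%:R : R) by rewrite ltr0n.
apply: cexp_twopii_neq1; apply/andP; split.
  by rewrite divr_gt0// ltr0z lt_def r1 r0.
by rewrite ltr_pdivrMr// mul1r pmulrn ltr_int.
Qed.

Lemma root_sum0 (z : R[i]) (n : nat) : z != 1 -> z ^+ n = 1 ->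
  \sum_(l < n) z ^+ l = 0.
Proof.
move=> z1 zn; have := subrX1 z n; rewrite zn subrr => /esym/eqP.
by rewrite mulf_eq0 subr_eq0 (negbTE z1) => /eqP.
Qed.

(** A weak form of Jordan's inequality. With [x = pi s / 2 <= pi / 4] one has [cos >= 1 / 2] on
    [[0, x]], so [sin x >= x / 2] and [sin (2 x) = 2 sin x cos x >= x / 2 >= s / 2]. *)
Lemma sin_pi_ge (s : R) : 0 <= s <= 1 / 2 -> s / 2 <= sin (pi * s).
Proof.
move=> /andP[s0 s1].
have p0 : 0 < pi :> R := pi_gt0 R.
have p2 : 2 <= pi :> R := pi_ge2 R.
have [->|sn0] := eqVneq s 0; first by rewrite mul0r mulr0 sin0.
have sp : 0 < s by rewrite lt_def sn0.
pose x := pi * s / 2.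
have x0 : 0 < x by rewrite divr_gt0// mulr_gt0.
have x4 : x <= pi / 4 by rewrite /x; nra.
have c4 : 1 / 2 <= cos (pi / 4 : R).
  have : cos (pi / 4 : R) ^+ 2 = 1 / 2.
    have := cos_pihalf R; rewrite (_ : pi / 2 = pi / 4 + pi / 4); last by field.
    by rewrite cos_double cos2sin2; move: (sin _ ^+ 2) => q; lra.
  have : 0 < cos (pi / 4 : R) by apply: cos_gt0_pihalf; apply/andP; split; lra.
  by move: (cos _) => c; nra.
have cx y : 0 <= y <= x -> 1 / 2 <= cos y.
  move=> /andP[y0 yx]; apply: le_trans c4 _.
  have yp : y <= pi / 4 := le_trans yx x4.
  by rewrite leNgt ltr_cos ?in_itv /= -?leNgt//; apply/andP; split; lra.
have sx : x / 2 <= sin x.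
  have [c hc] := @MVT R sin cos 0 x x0 (fun z _ => @is_derive_sin R z)
    (continuous_subspaceT (@continuous_sin R)).
  move: hc; rewrite in_itv /= => /andP[c0 cx'].
  rewrite sin0 !subr0 => ->.
  have := cx c; rewrite (ltW c0) (ltW cx') => /(_ isT) h.
  by have := ler_wpM2r (ltW x0) h; lra.
have -> : pi * s = x + x by rewrite /x; field.
rewrite sinD; have := cx x; rewrite (ltW x0) lexx => /(_ isT) h.
have h2 : 0 <= x / 2 by rewrite divr_ge0 // ltW.
have := ler_pM h2 (_ : 0 <= 1 / 2) sx h; rewrite divr_ge0// => /(_ isT).
have : s <= x by rewrite /x; nra.
rewrite [cos x * _]mulrC; move: (sin x * cos x) => q; lra.
Qed.

End RootsOfUnity.

(** * Uniform estimates for a complex Gaussian in one variable *)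

Section OneDimGaussian.
Variables (R : realType) (b : R[i]).
Hypothesis b_neg : Re b < 0.

Definition gss (y : R[i]) : R[i] := cexp (b * y ^+ 2).

(** Trades a Gaussian with a linear perturbation for the simpler decay [e^(-r)]. *)
Lemma complete_square (rho c r : R) : 0 < rho ->
  c * r - rho * r ^+ 2 <= (c + 1) ^+ 2 / (4 * rho) - r.
Proof.
move=> r0; have h : 0 <= rho * (r - (c + 1) / (2 * rho)) ^+ 2.
  by rewrite mulr_ge0 ?sqr_ge0// ltW.
have -> : (c + 1) ^+ 2 / (4 * rho) - r =
  c * r - rho * r ^+ 2 + rho * (r - (c + 1) / (2 * rho)) ^+ 2.
  by field; rewrite gt_eqF.
by rewrite lerDl.
Qed.

(** Write [gss (y + a h) = gss y * exp z]; then [|z| <= X h] with [X] linear in [|r|]. The remainder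
    costs [e^(3 X)]: [X^2 <= e^(2 X)] and [e^|z| <= e^X]. The constants [c0] and [c1] collect [3 X]
    and the linear part of the exponent of [gss y], and [complete_square] leaves [e^(-|r|)]. In
    [4 + B A^2] the 4 comes from [cexp_taylor], the rest from the quadratic part [b (a h)^2] of
    [z]. *)
Lemma gss_bound (W A : R) : 0 <= W -> 0 <= A ->
  exists2 K : R, 0 <= K & forall (x a : R[i]) (r h : R),
    normc x <= W -> normc a <= A -> 0 <= h <= 1 ->
    normc (gss (x + r%:C%C)) <= K * expR (- `|r|) /\
    normc (gss (x + r%:C%C + a * h%:C%C) - gss (x + r%:C%C)
       - 2 * b * (x + r%:C%C) * (a * h%:C%C) * gss (x + r%:C%C))
     <= K * h ^+ 2 * expR (- `|r|).
Proof.
move=> W0 A0; set B := normc b; set rho := - Re b.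
have rho0 : 0 < rho by rewrite oppr_gt0.
have B0 : 0 <= B := normc_ge0 b.
pose c0 := 3 * (B * (2 * W * A + A ^+ 2)) + B * W ^+ 2.
pose c1 := 6 * B * A + 2 * B * W.
pose E := expR (c0 + (c1 + 1) ^+ 2 / (4 * rho)).
have E0 : 0 <= E := expR_ge0 _.
have K0 : 0 <= 4 + B * A ^+ 2 by rewrite addr_ge0 ?mulr_ge0 ?sqr_ge0.
exists ((4 + B * A ^+ 2) * E); first by rewrite mulr_ge0.
move=> x a r h xW aA /andP[h0 h1].
set y := x + r%:C%C; set s := `|r|.
have s0 : 0 <= s := normr_ge0 r.
have y0 : normc y <= W + s.
  by apply: le_trans (normcD _ _) _; rewrite normc_real lerD.
pose X := B * (2 * (W + s) * A + A ^+ 2).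
have X0 : 0 <= X by rewrite mulr_ge0// addr_ge0 ?sqr_ge0// !mulr_ge0// addr_ge0.
have gy : normc (gss y) <= expR (B * (2 * s * W + W ^+ 2) - rho * s ^+ 2).
  rewrite normc_cexp ler_expR.
  have -> : b * y ^+ 2 = b * (r ^+ 2)%:C%C + b * (2 * r%:C%C * x + x ^+ 2).
    by rewrite rmorphXn /y /=; ring.
  rewrite raddfD /= addrC; apply: lerD.
    apply: le_trans (ler_norm _) _; apply: le_trans (normc_Re _) _.
    rewrite normcM ler_wpM2l//; apply: le_trans (normcD _ _) _.
    rewrite expr2 !normcM normc_real -/s.
    have -> : normc 2 = 2 :> R.
      by rewrite (_ : 2 = (2 : R)%:C%C) ?normc_real ?ger0_norm// rmorph_nat.
    apply: lerD; first by rewrite ler_wpM2l// mulr_ge0.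
    by rewrite expr2 ler_pM// normc_ge0.
  rewrite /s real_normK ?num_real// /rho mulNr opprK.
  by case: (b) => u v /=; rewrite mulr0 subr0.
have fin Y : 0 <= Y -> Y <= 3 * X ->
   expR (Y + (B * (2 * s * W + W ^+ 2) - rho * s ^+ 2)) <= E * expR (- s).
  move=> Y0 YX; rewrite -expRD ler_expR.
  have := complete_square c1 s rho0.
  have X3 : 3 * X = c1 * s + c0 - B * (2 * s * W + W ^+ 2).
    by rewrite /X /c1 /c0; ring.
  rewrite X3 in YX.
  by move: YX; move: (_ / (4 * rho)) (rho * _) (B * _) (c1 * s) => q1 q2 q3 q4; lra.
split.
  apply: le_trans gy _; have := fin 0 (lexx 0); rewrite add0r => /(_ _) h2.
  apply: le_trans (h2 _) _; first by rewrite mulr_ge0.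
  rewrite ler_wpM2r ?expR_ge0// ler_peMl// (le_trans (_ : 1 <= 4))// ?ler1n//.
  by rewrite lerDl mulr_ge0 ?sqr_ge0.
pose z := b * (2 * y * (a * h%:C%C) + (a * h%:C%C) ^+ 2).
have -> : gss (y + a * h%:C%C) = gss y * cexp z.
  by rewrite /gss -cexpD; congr cexp; rewrite /z; ring.
have -> : gss y * cexp z - gss y - 2 * b * y * (a * h%:C%C) * gss y =
   gss y * ((cexp z - 1 - z) + b * (a * h%:C%C) ^+ 2).
  by rewrite /z; ring.
have n2 : normc 2 = 2 :> R.
  by rewrite (_ : 2 = (2 : R)%:C%C) ?normc_real ?ger0_norm// rmorph_nat.
have nah : normc (a * h%:C%C) <= A * h.
  by rewrite normcM normc_real (ger0_norm h0) ler_wpM2r.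
have nah2 : normc ((a * h%:C%C) ^+ 2) <= A ^+ 2 * h ^+ 2.
  by rewrite -exprMn !expr2 normcM ler_pM// normc_ge0.
have h2h : h ^+ 2 <= h by rewrite expr2 ler_piMl.
have nz : normc z <= X * h.
  rewrite /z normcM /X -[leRHS]mulrA ler_wpM2l// [leRHS]mulrDl; apply: le_trans (normcD _ _) _.
  apply: lerD.
    rewrite !normcM n2 -!mulrA ler_wpM2l// ler_pM ?normc_ge0//.
      by rewrite mulr_ge0 ?normc_ge0.
    by rewrite -normcM.
  by apply: le_trans nah2 _; rewrite ler_wpM2l ?sqr_ge0.
have nzX : normc z <= X by apply: le_trans nz _; rewrite ler_piMr.
have nt : normc (cexp z - 1 - z + b * (a * h%:C%C) ^+ 2) <=
    (4 + B * A ^+ 2) * h ^+ 2 * expR (3 * X).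
  apply: le_trans (normcD _ _) _; rewrite 2!mulrDl; apply: lerD.
    apply: le_trans (cexp_taylor z) _.
    have -> : 3 * X = X + (X + X) by ring.
    rewrite !expRD -[leLHS]mulrA -[leRHS]mulrA ler_wpM2l//.
    have XE : X <= expR X by have := expR_ge1Dx X; lra.
    have z2 : normc z ^+ 2 <= (X * h) ^+ 2.
      by rewrite ler_sqr ?nnegrE ?normc_ge0// mulr_ge0.
    have zE : expR (normc z) <= expR X by rewrite ler_expR.
    rewrite [leRHS](_ : _ = (h ^+ 2 * (expR X * expR X)) * expR X); last by ring.
    apply: ler_pM => //; rewrite ?sqr_ge0 ?expR_ge0//.
    apply: le_trans z2 _; rewrite exprMn mulrC ler_wpM2l ?sqr_ge0//.
    by rewrite expr2 ler_pM.
  rewrite normcM -/B -[leRHS]mulrA -[leRHS]mulrA ler_wpM2l//; apply: le_trans nah2 _.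
  rewrite ler_wpM2l ?sqr_ge0// ler_peMr ?sqr_ge0//.
  by have := expR_ge1Dx (3 * X); lra.
rewrite normcM; apply: le_trans (ler_pM (normc_ge0 _) (normc_ge0 _) gy nt) _.
rewrite mulrCA -[leRHS]mulrA [leRHS]mulrAC -[leRHS]mulrA.
have hh := fin (3 * X) (mulr_ge0 (ler0n _ 3) X0) (lexx _).
have := ler_wpM2l (mulr_ge0 K0 (sqr_ge0 h)) hh.
rewrite expRD; congr (_ <= _).
  by rewrite mulrC mulrA [LHS]mulrC; ring.
by ring.
Qed.

End OneDimGaussian.

(** * Riemann sums of the Gaussian on shifted lattices *)

Section RiemannSums.
Variables (R : realType) (b : R[i]).
Hypothesis b_neg : Re b < 0.

Lemma sums_le_mesh (f : int -> R[i]) (K h : R) : 0 <= K -> 0 < h <= 1 ->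
  (forall j, normc (f j) <= K * expR (- `|j%:~R * h|)) -> sums_le f (4 * K / h).
Proof.
move=> K0 /andP[h0 h1] hf A; apply: le_trans (ler_sum _ (fun j _ => hf j)) _.
rewrite -mulr_sumr; have := sums_le_expR_int h0 A.
rewrite (eq_bigr (fun j : int => expR (- `|j%:~R * h|))); last first.
  move=> j _; rewrite normc_real ger0_norm ?expR_ge0//; congr (expR (- _)).
  by rewrite normrM (gtr0_norm h0) mulrC -intr_norm -abszE.
move=> h2; apply: le_trans (ler_wpM2l K0 h2) _.
rewrite (_ : 4 * K / h = K * (2 * (2 / h))); last by field; rewrite gt_eqF.
by rewrite ler_wpM2l// ler_wpM2l// ler_pM2r ?invr_gt0// -[2]/(1 + 1) lerD2l.
Qed.

Definition mesh (N : nat) : R := N.+1%:R^-1.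

Lemma mesh_gt0 N : 0 < mesh N. Proof. by rewrite invr_gt0. Qed.
Lemma mesh_le1 N : mesh N <= 1. Proof. by rewrite invf_le1// ler1n. Qed.
Lemma mesh_itv N : 0 < mesh N <= 1. Proof. by rewrite mesh_gt0 mesh_le1. Qed.

Definition gnode N (w : R[i]) (j : int) : R[i] := gss b (w + (j%:~R * mesh N)%:C%C).

Definition riemann N (w : R[i]) : R[i] := (mesh N)%:C%C * csum (gnode N w).

Lemma gnodeS N w j : gnode N (w + (mesh N)%:C%C) j = gnode N w (j + 1).
Proof.
rewrite /gnode rmorphD /= mulrDl mul1r [in RHS]rmorphD /=; congr gss.
by rewrite addrAC -addrA.
Qed.

Lemma absum_gnode N w : absum (gnode N w).
Proof.
have [K K0 hK] := gss_bound b_neg (normc_ge0 w) (lexx 0).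
exists (4 * K / mesh N); apply: sums_le_mesh (mesh_itv N) _ => // j.
have [] // := hK w 0 (j%:~R * mesh N) 0 (lexx _) _ _.
  by rewrite normc0.
by rewrite lexx ler01.
Qed.

Lemma addz1_bij : bijective (fun j : int => j + 1).
Proof. by exists (fun j => j - 1) => j; rewrite ?addrK ?subrK. Qed.

Lemma normc_riemann_le W : 0 <= W -> exists2 K : R, 0 <= K &
  forall N w, normc w <= W -> normc (riemann N w) <= K.
Proof.
move=> W0; have [K K0 hK] := gss_bound b_neg W0 (lexx 0).
exists (4 * K); first by rewrite mulr_ge0.
move=> N w wW; rewrite normcM normc_real (gtr0_norm (mesh_gt0 N)) mulrC.
rewrite -ler_pdivlMr ?mesh_gt0//; apply: normc_csum_le.
apply: sums_le_mesh (mesh_itv N) _ => // j.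
have [] // := hK w 0 (j%:~R * mesh N) 0 wW _ _.
  by rewrite normc0.
by rewrite lexx ler01.
Qed.

(* The first order term of [gss (y + a h) - gss y] is [a] times that of
   [gss (y + h) - gss y], and the latter sums to zero over the mesh. *)
Lemma riemann_step W A : 0 <= W -> 0 <= A -> exists2 K : R, 0 <= K &
  forall N w a, normc w <= W -> normc a <= A ->
    normc (riemann N (w + a * (mesh N)%:C%C) - riemann N w) <= K * mesh N ^+ 2.
Proof.
move=> W0 A0; have A1 : 0 <= A + 1 by rewrite addr_ge0.
have [K K0 hK] := gss_bound b_neg W0 A1.
have AK0 : 0 <= K + A * K by rewrite addr_ge0 ?mulr_ge0.
exists (4 * (K + A * K)); first by rewrite mulr_ge0.
move=> N w a wW aA; set h := mesh N.
have h0 : 0 < h := mesh_gt0 N.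
have -> : riemann N (w + a * h%:C%C) - riemann N w = h%:C%C *
   csum (fun j => gnode N (w + a * h%:C%C) j - gnode N w j
     - a * (gnode N (w + h%:C%C) j - gnode N w j)).
  have sh : csum (gnode N (w + h%:C%C)) = csum (gnode N w).
    rewrite -(csum_bij addz1_bij (absum_gnode N w)).
    by congr csum; apply/funext => j; rewrite gnodeS.
  rewrite /riemann -mulrBr; congr (_ * _).
  pose F1 := gnode N (w + a * h%:C%C); pose F2 := gnode N w.
  pose F3 := gnode N (w + h%:C%C).
  rewrite (_ : (fun j => _) = (fun j => F1 j + ((- 1 + a) * F2 j + (- a) * F3 j))).
    have a2 c : absum (fun j => c * F2 j) by apply: absumZ; exact: absum_gnode.
    have a3 c : absum (fun j => c * F3 j) by apply: absumZ; exact: absum_gnode.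
    have a1 : absum F1 by exact: absum_gnode.
    rewrite csumD//; last exact: absumD.
    rewrite csumD// !csumZ; [|exact: absum_gnode|exact: absum_gnode].
    by rewrite sh -/F1 -/F2; ring.
  by apply/funext => j; rewrite -/F1 -/F2 -/F3; ring.
rewrite normcM normc_real (gtr0_norm h0) mulrC -ler_pdivlMr//.
rewrite (_ : _ / h = 4 * ((K + A * K) * h ^+ 2) / h); last by ring.
apply: normc_csum_le; apply: sums_le_mesh (mesh_itv N) _; first by rewrite mulr_ge0 ?sqr_ge0.
move=> j; rewrite -/h; set r := j%:~R * h; set y := w + r%:C%C.
have h01 : 0 <= h <= 1 by rewrite (ltW h0) mesh_le1.
have a1 : normc a <= A + 1 by rewrite (le_trans aA)// lerDl.
have n1 : normc 1 <= A + 1 by rewrite ComplexField.Normc.normc1 lerDr.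
have [_ e1] := hK w a r h wW a1 h01; have [_ e2] := hK w 1 r h wW n1 h01.
have -> : gnode N (w + a * h%:C%C) j - gnode N w j - a * (gnode N (w + h%:C%C) j - gnode N w j)
 = (gss b (y + a * h%:C%C) - gss b y - 2 * b * y * (a * h%:C%C) * gss b y)
   - a * (gss b (y + 1 * h%:C%C) - gss b y - 2 * b * y * (1 * h%:C%C) * gss b y).
  have -> : gnode N (w + a * h%:C%C) j = gss b (y + a * h%:C%C).
    by rewrite /gnode -/h -/r /y; congr gss; ring.
  have -> : gnode N (w + h%:C%C) j = gss b (y + 1 * h%:C%C).
    by rewrite /gnode -/h -/r /y mul1r; congr gss; ring.
  by rewrite -[gnode N w j]/(gss b y); ring.
apply: le_trans (normcD _ _) _; rewrite normcN normcM.
rewrite [leRHS](_ : _ = K * h ^+ 2 * expR (- `|r|)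
   + A * (K * h ^+ 2 * expR (- `|r|))); last by ring.
by apply: lerD => //; apply: ler_pM => //; exact: normc_ge0.
Qed.

(** Plays the role of a contour shift: [w] is reached from 0 in [N + 1] steps of size [w * mesh],
    each changing the sum by at most [K mesh^2], hence by at most [K mesh] in total. *)
Lemma riemann_shift w : seqlim (fun N => riemann N w - riemann N 0) 0.
Proof.
have [K K0 hK] := riemann_step (normc_ge0 w) (normc_ge0 w).
have st N : normc (riemann N w - riemann N 0) <= K * mesh N.
  set h := mesh N; have hN : N.+1%:R * h = 1 by rewrite mulfV ?pnatr_eq0.
  have pt (l : nat) : (l <= N.+1)%N ->
    normc (riemann N (w * (l%:R * h)%:C%C) - riemann N 0) <= l%:R * (K * h ^+ 2).
    elim: l => [|l ih] lN; first by rewrite !mul0r mulr0 subrr normc0.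
    have -> : riemann N (w * (l.+1%:R * h)%:C%C) - riemann N 0 =
      (riemann N (w * (l%:R * h)%:C%C + w * h%:C%C) - riemann N (w * (l%:R * h)%:C%C))
      + (riemann N (w * (l%:R * h)%:C%C) - riemann N 0).
      rewrite addrA subrK; congr (riemann N _ - _).
      by rewrite -mulrDr -rmorphD /= -[in LHS]addn1 natrD mulrDl mul1r.
    apply: le_trans (normcD _ _) _; rewrite -[l.+1]add1n natrD mulrDl mul1r.
    apply: lerD; last by apply: ih; exact: ltnW.
    apply: hK => //; rewrite normcM normc_real ger0_norm ?mulr_ge0//; last first.
      by rewrite ltW// mesh_gt0.
    rewrite ler_piMr ?normc_ge0//.
    by rewrite /h /mesh ler_pdivrMr ?ltr0n// mul1r ler_nat ltnW.
  have := pt N.+1 (leqnn _); rewrite hN mulr1.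
  by rewrite expr2 mulrCA (mulrA _ h h) hN mul1r.
move=> e e0; exists (Num.truncn (K / e)) => N hN; rewrite subr0.
apply: le_trans (st N) _.
rewrite ler_pdivrMr ?ltr0n//.
have := truncnS_gt (K / e); rewrite ltr_pdivrMr// => /ltW /le_trans; apply.
by rewrite mulrC ler_wpM2l ?(ltW e0)// ler_nat ltnS.
Qed.

End RiemannSums.

(** * The Poisson formula for [exp (- 2 pi i y^2 / t)] *)

Section Poisson.
Variables (R : realType) (t : R[i]).
Hypothesis t_pos : 0 < Im t.

Let b : R[i] := - twopii R / t.

Let t_neq0 : t != 0.
Proof. by apply/eqP => t0; move: t_pos; rewrite t0 ltxx. Qed.

Lemma Re_gss_coef_lt0 : Re (- twopii R / t) < 0.
Proof.
rewrite twopiiE; case: t t_pos => x y /= y0.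
have n0 : 0 < x ^+ 2 + y ^+ 2 by rewrite ltr_wpDl ?sqr_ge0// exprn_gt0.
rewrite oppr0 mul0r sub0r mulrN mulNr opprK oppr_lt0 //.
by rewrite mulr_gt0 ?divr_gt0// mulr_gt0// pi_gt0.
Qed.

Let b_neg : Re b < 0 := Re_gss_coef_lt0.

(** Up to a constant factor, the Fourier transform of [exp (- 2 pi i y^2 / t)] at [k], times the
    character [exp (2 pi i k x)]. *)
Definition poisson_term (x : R[i]) (k : int) : R[i] :=
  cexp (twopii R * (k%:~R * x + t * k%:~R ^+ 2 / 4)).

Definition phase (r : R) : R[i] := cexp (twopii R * r%:C%C).

Lemma phaseD r s : phase (r + s) = phase r * phase s.
Proof. by rewrite /phase rmorphD mulrDr cexpD. Qed.

Lemma normc_phase r : normc (phase r) = 1.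
Proof. by rewrite normc_cexp Re_twopii /= mulr0 oppr0 expR0. Qed.

Lemma phase_int (k : int) : phase k%:~R = 1.
Proof. by rewrite /phase rmorph_int cexp_int. Qed.

Lemma phaseMn r n : phase r ^+ n = phase (r * n%:R).
Proof.
by rewrite /phase -cexpMn rmorphM rmorph_nat mulrA mulr_natr.
Qed.

Definition dft N x (k : int) : R[i] :=
  (mesh R N)%:C%C *
    csum (fun j => gnode b N x j * phase (- (j%:~R * (k%:~R * mesh R N)))).

Lemma absum_dft N x (s : R) :
  absum (fun j => gnode b N x j * phase (- (j%:~R * s))).
Proof.
apply: (absum_le (absum_gnode b_neg N x)) => j.
by rewrite normcM normc_phase mulr1.
Qed.

(* Completing the square. *)
Lemma dft_riemann N x k :
  dft N x k = poisson_term x k * riemann b N (x + t * k%:~R / 2).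
Proof.
rewrite /dft /riemann mulrCA; congr (_ * _).
rewrite -csumZ; last exact: absum_gnode.
congr csum; apply/funext => j; rewrite /gnode /gss /phase -!cexpD; congr cexp.
rewrite rmorphN !rmorphM !rmorph_int /b /=; set h := (mesh R N)%:C%C.
by field.
Qed.

(** Fourier inversion on the integers modulo [N + 1 = 2 M + 1]. Summing over a full set of residues
    kills the nodes [j] not divisible by [N + 1], by a geometric series of roots of unity; the
    remaining nodes are the integer translates of [x]. The odd modulus makes the window of
    frequencies [-M, ..., M] symmetric. *)
Lemma dft_sum M x :
  \sum_(l < M.*2.+1) dft M.*2 x (l%:Z - M%:Z) = csum (fun n : int => gss b (x + n%:~R)).
Proof.
set N := M.*2; set h := mesh R N.
have hN : N.+1%:R * h = 1 by rewrite mulfV ?pnatr_eq0.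
rewrite /dft -mulr_sumr -csum_bigsum; last by move=> l; exact: absum_dft.
rewrite -csumZ; last first.
  have := absum_gnode b_neg N x => ga.
  apply: (absum_sub (K := N.+1%:R) ga) => j.
  apply: le_trans (normc_sum _ _ _) _.
  under eq_bigr do rewrite normcM normc_phase mulr1.
  by rewrite sumr_const card_ord mulr_natl.
pose mulN (n : int) := n * N.+1%:Z.
have mi : injective mulN by apply: mulIf.
pose F (j : int) := if (N.+1%:Z %| j)%Z then gnode b N x j else 0.
transitivity (csum F); last first.
  have Fa : absum F.
    apply: (absum_le (absum_gnode b_neg N x)) => j; rewrite /F.
    by case: ifP; rewrite ?normc0 ?normc_ge0.
  rewrite -(csum_inj mi _ Fa); last first.
    by move=> j nj; rewrite /F; case: ifP => // /dvdzP[n jn]; case: (nj n).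
  congr csum; apply/funext => n; rewrite /= /F /mulN dvdz_mull ?dvdzz//.
  by rewrite /gnode intrM -mulrA hN mulr1 rmorph_int.
congr csum; apply/funext => j; rewrite -mulr_sumr /F mulrCA.
case: ifPn => jN.
  have /dvdzP[n ->] := jN.
  rewrite (eq_bigr (fun=> 1)) => [|l _].
    rewrite sumr_const card_ord -/N.
    by rewrite -(rmorph_nat (real_complex R)) -rmorphM [h * _]mulrC hN rmorph1 mulr1.
  rewrite -/h (_ : - _ = (- (n * (l%:Z - M%:Z)))%:~R) ?phase_int//.
  have hZ : (N.+1%:Z)%:~R * h = 1 by [].
  by rewrite !mulrNz !intrM [_ * h]mulrC -mulrA (mulrA _ h) hZ mul1r.
have q1 : phase (- (j%:~R * h)) != 1.
  have : ~~ (N.+1%:Z %| - j)%Z by rewrite rpredN.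
  move=> /(cexp_div_neq1 R (ltn0Sn N)); congr (cexp (_ * _) != 1).
  by rewrite -mulNr -rmorphN rmorphM rmorph_int /h /mesh fmorphV rmorph_nat.
have qn : phase (- (j%:~R * h)) ^+ N.+1 = 1.
  by rewrite phaseMn mulNr -mulrA [h * _]mulrC hN mulr1 -mulrNz phase_int.
rewrite (eq_bigr (fun l : 'I_N.+1 => phase (j%:~R * (M%:R * h)) *
    phase (- (j%:~R * h)) ^+ l)) => [|l _].
  by rewrite -mulr_sumr root_sum0// !mulr0.
rewrite phaseMn -phaseD; congr phase; rewrite -/h.
have -> : ((l%:Z - M%:Z)%:~R : R) = l%:R - M%:R by rewrite rmorphB.
ring.
Qed.

(** The left factor equals [- 4 sin (pi s)^2], and [sin_pi_ge] bounds it away from 0. *)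
Lemma phase_second_diff (s : R) : `|s| <= 1 / 2 ->
  s ^+ 2 <= normc (phase s + phase (- s) - 2).
Proof.
move=> hs.
have -> : phase s + phase (- s) - 2 = (- (4 * sin (pi * s) ^+ 2))%:C%C.
  rewrite /phase !cexp_real_twopii mulrN cosN sinN.
  have -> : (2 : R[i]) = (2 : R)%:C%C by rewrite rmorph_nat.
  rewrite -[2 * pi * s]/(2 * pi * s) (_ : 2 * pi * s = pi * s + pi * s); last by ring.
  by rewrite cos_double; simpc; congr Complex; ring.
rewrite normc_real normrN (ger0_norm (mulr_ge0 (ler0n _ 4) (sqr_ge0 _))).
have h : `|s| / 2 <= sin (pi * `|s|) by apply: sin_pi_ge; rewrite normr_ge0 hs.
have -> : sin (pi * s) ^+ 2 = sin (pi * `|s|) ^+ 2.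
  by case: (ger0P s) => // _; rewrite mulrN sinN sqrrN.
have -> : s ^+ 2 = `|s| ^+ 2 by rewrite real_normK ?num_real.
have aux (u v : R) : 0 <= v -> v / 2 <= u -> v ^+ 2 <= 4 * u ^+ 2 by move=> *; nra.
exact: aux (normr_ge0 s) h.
Qed.

(* Summing by parts twice turns the second difference of the Gaussian, of size
   [mesh ^ 2], into the decay of the coefficients. *)
Lemma dft_bound x : exists2 K : R, 0 <= K & forall N (k : int), k != 0 ->
  `|k%:~R * mesh R N| <= 1 / 2 -> normc (dft N x k) <= K / (k%:~R ^+ 2).
Proof.
have [K K0 hK] := gss_bound b_neg (normc_ge0 x) ler01.
exists (8 * K); first by rewrite mulr_ge0.
move=> N k k0 hs; set h := mesh R N; set s := k%:~R * h.
have h0 : 0 < h := mesh_gt0 R N.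
pose f j := gnode b N x j * phase (- (j%:~R * s)).
have fa : absum f by exact: absum_dft.
set S := csum f.
have pb : bijective (fun j : int => j - 1).
  by exists (fun j => j + 1) => j; rewrite ?addrK ?subrK.
have fp j : f (j + 1) = phase (- s) * (gnode b N x (j + 1) * phase (- (j%:~R * s))).
  have e : - ((j + 1)%:~R * s) = - s + - (j%:~R * s).
    by rewrite intrD mulrDl mul1r opprD addrC.
  by rewrite /f e phaseD mulrCA.
have fm j : f (j - 1) = phase s * (gnode b N x (j - 1) * phase (- (j%:~R * s))).
  have e : - ((j - 1)%:~R * s) = s + - (j%:~R * s).
    by rewrite intrB mulrBl mul1r opprB.
  by rewrite /f e phaseD mulrCA.
have ps : phase s * phase (- s) = 1.
  by rewrite -phaseD subrr -[0]/(0%:~R) phase_int.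
pose D j := phase s * f (j + 1) + phase (- s) * f (j - 1) - 2 * f j.
have SD : (phase s + phase (- s) - 2) * S = csum D.
  have a1 : absum (fun j => f (j + 1)) by exact: (absum_inj (bij_inj addz1_bij) fa).
  have a2 : absum (fun j => f (j - 1)) by exact: (absum_inj (bij_inj pb) fa).
  have -> : D = (fun j => phase s * f (j + 1) + (phase (- s) * f (j - 1) + (-2) * f j)).
    by apply/funext => j; rewrite /D; ring.
  rewrite csumD; [|exact: absumZ|by apply: absumD; exact: absumZ].
  rewrite csumD; [|exact: absumZ|exact: absumZ]; rewrite !csumZ//.
  rewrite (csum_bij (h := fun j => j + 1) addz1_bij fa).
  by rewrite (csum_bij (h := fun j => j - 1) pb fa) -/S; ring.
have Db : normc (csum D) <= 8 * K * h.
  rewrite (_ : 8 * K * h = 4 * (2 * K * h ^+ 2) / h); last by field; rewrite gt_eqF.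
  apply: normc_csum_le; apply: sums_le_mesh (mesh_itv R N) _.
    by rewrite (mulr_ge0 _ (sqr_ge0 _))// mulr_ge0.
  move=> j; set r := j%:~R * h; set y := x + r%:C%C.
  have -> : D j = phase (- (j%:~R * s)) *
      ((gss b (y + 1 * h%:C%C) - gss b y - 2 * b * y * (1 * h%:C%C) * gss b y) +
       (gss b (y + (-1) * h%:C%C) - gss b y - 2 * b * y * ((-1) * h%:C%C) * gss b y)).
    have -> : gss b (y + 1 * h%:C%C) = gnode b N x (j + 1).
      by rewrite mul1r -gnodeS /gnode -/h -/r /y addrAC.
    have -> : gss b (y + (-1) * h%:C%C) = gnode b N x (j - 1).
      have e : (j - 1)%:~R * h = r - h by rewrite intrB mulrBl mul1r.
      by rewrite mulN1r /gnode -/h e rmorphB addrA.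
    rewrite /D fp fm mulrA ps mul1r [X in _ + X - _]mulrA [phase (- s) * _]mulrC ps mul1r.
    by rewrite /f -[gnode b N x j]/(gss b y); ring.
  have n1 : normc (1 : R[i]) <= 1 by rewrite ComplexField.Normc.normc1.
  have n2 : normc (-1 : R[i]) <= 1 by rewrite normcN ComplexField.Normc.normc1.
  have h01 : 0 <= h <= 1 by rewrite ltW// mesh_le1.
  have [_ e1] := hK x 1 r h (lexx _) n1 h01.
  have [_ e2] := hK x (-1) r h (lexx _) n2 h01.
  rewrite normcM normc_phase mul1r; apply: le_trans (normcD _ _) _.
  rewrite [leRHS](_ : _ = K * h ^+ 2 * expR (- `|r|) + K * h ^+ 2 * expR (- `|r|)).
    exact: lerD.
  by ring.
have hs2 := phase_second_diff hs.
have k20 : 0 < (k%:~R : R) ^+ 2 by rewrite exprn_even_gt0//= intr_eq0.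
rewrite /dft -/h -/s -/f -/S normcM normc_real (gtr0_norm h0).
rewrite ler_pdivlMr//.
have : s ^+ 2 * normc S <= 8 * K * h.
  apply: le_trans Db; rewrite -SD normcM ler_wpM2r//; exact: normc_ge0.
rewrite /s exprMn => hh.
rewrite -(ler_pM2r h0); apply: le_trans hh; rewrite le_eqVlt; apply/orP; left.
by apply/eqP; ring.
Qed.

Lemma absum_poisson x : absum (poisson_term x).
Proof.
pose c := 2 * pi * `|Im x|; pose rho := pi * Im t / 2.
have p0 : 0 < pi :> R := pi_gt0 R.
have rho0 : 0 < rho by rewrite divr_gt0// mulr_gt0.
pose K := expR ((c + 1) ^+ 2 / (4 * rho)).
exists (4 * K / 1); apply: sums_le_mesh; [exact: expR_ge0|by rewrite ltr01 lexx|].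
move=> k; rewrite normc_cexp mulr1 -expRD ler_expR Re_twopii.
apply: le_trans (complete_square c `|k%:~R| rho0).
rewrite real_normK ?num_real//.
have -> : Im (k%:~R * x + t * k%:~R ^+ 2 / 4) = k%:~R * Im x + Im t * k%:~R ^+ 2 / 4.
  rewrite -(rmorph_int (real_complex R)) /=.
  have -> : (4 : R[i])^-1 = (4^-1 : R)%:C%C by rewrite fmorphV rmorph_nat.
  by rewrite -rmorphXn /=; case: (x) (t) => [x1 x2] [t1 t2] /=; ring.
rewrite (_ : - _ = - (2 * pi * (k%:~R * Im x)) - rho * k%:~R ^+ 2); last first.
  by rewrite /rho; field.
rewrite lerD2r /c -[leRHS]mulrA -[in leRHS]normrM -mulrN ler_wpM2l ?mulr_ge0 ?(ltW p0)//.
by apply: le_trans (ler_norm _) _; rewrite normrN [k%:~R * _]mulrC.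
Qed.

(** Extension by 0 beyond the window, so that all [M] share the index set needed for dominated
    convergence. Inside it [|k| * mesh <= 1 / 2], as [dft_bound] requires. *)
Definition dft_window M x (k : int) : R[i] :=
  if (absz k <= M)%N then dft M.*2 x k else 0.

Let shift_ord M (l : 'I_M.*2.+1) : int := l%:Z - M%:Z.

Let shift_ordP M k : (absz k <= M)%N -> exists l, @shift_ord M l = k.
Proof.
move=> kM; have lt : (absz (k + M%:Z)%R < M.*2.+1)%N by lia.
by exists (Ordinal lt); rewrite /shift_ord /=; lia.
Qed.

Lemma absum_dft_window M x : absum (dft_window M x).
Proof.
apply: (@absum_finsupp R _ [fset @shift_ord M l | l in 'I_M.*2.+1]%fset) => k nk.
rewrite /dft_window; case: ifP => // /shift_ordP[l lk].
by case/negP: nk; apply/imfsetP; exists l.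
Qed.

Lemma csum_dft_window M x :
  csum (dft_window M x) = csum (fun n : int => gss b (x + n%:~R)).
Proof.
rewrite -(dft_sum M) -csum_fin.
have hi : injective (@shift_ord M) by move=> l m /addIr [] /val_inj.
rewrite -(csum_inj hi _ (absum_dft_window M x)).
  congr csum; apply/funext => l /=; rewrite /dft_window.
  have -> // : (absz (shift_ord l) <= M)%N.
  by have := ltn_ord l; rewrite /shift_ord; lia.
move=> k nk; rewrite /dft_window; case: ifP => // /shift_ordP[l lk].
by case: (nk l).
Qed.

(** Dominated convergence. By [dft_riemann] the term at a fixed [k] is eventually [poisson_term x k]
    times the difference of the Riemann sums at [x + t k / 2] and 0, which tends to 0 by
    [riemann_shift]. *)
Lemma poisson_lim x : seqlim (fun M => csum (fun n : int => gss b (x + n%:~R))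
  - riemann b M.*2 0 * csum (poisson_term x)) 0.
Proof.
have pa := absum_poisson x.
pose a M k := dft_window M x k + (- riemann b M.*2 0) * poisson_term x k.
have -> : (fun M => csum (fun n : int => gss b (x + n%:~R))
  - riemann b M.*2 0 * csum (poisson_term x)) = (fun M => csum (a M)).
  apply/funext => M; rewrite -(csum_dft_window M) /a csumD; last exact: absumZ.
    by rewrite csumZ// mulNr.
  exact: absum_dft_window.
have [K K0 hK] := dft_bound x.
have [K1 K10 hK1] := normc_riemann_le b_neg (normc_ge0 x).
have [K2 K20 hK2] := normc_riemann_le b_neg (lexx 0).
(* A telescoping series of sum at most 1 stands in for the sum of [1 / k^2]. *)
pose w (n : nat) : R[i] := ((n.+1%:R * n.+2%:R)^-1)%:C%C.
have wle : sums_le w 1.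
  apply: sums_le_nat => n.
  have -> : \sum_(i < n) normc (w i) = 1 - n.+1%:R^-1.
    elim: n => [|n ih]; first by rewrite big_ord0 invr1 subrr.
    rewrite big_ord_recr ih /w normc_real ger0_norm ?invr_ge0 ?mulr_ge0//.
    have n0 : 0 <= n%:R :> R by [].
    by rewrite /= -[n.+2]addn1 natrD -[n.+1]addn1 natrD; field; lra.
  by rewrite lerBlDr lerDl invr_ge0.
(* The 6 comes from [(n + 1) (n + 2) <= 6 n^2] for [n >= 1]; the term [2 K1] covers [k = 0], where
   the denominator is 2. *)
pose Bd (k : int) : R[i] := ((6 * K + 2 * K1) / ((absz k).+1%:R * (absz k).+2%:R)
    + K2 * normc (poisson_term x k))%:C%C.
have KK : 0 <= 6 * K + 2 * K1 by rewrite addr_ge0 ?mulr_ge0.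
have Ba : absum Bd.
  have wz : absum (fun k : int => w (absz k)).
    by exists (2 * 1); exact: sums_le_int.
  have : absum (fun k : int => (6 * K + 2 * K1)%:C%C * w (absz k)
      + K2%:C%C * (normc (poisson_term x k))%:C%C).
    apply: absumD; apply: absumZ => //; apply: (absum_le pa) => k.
    by rewrite normc_real ger0_norm ?normc_ge0.
  by congr absum; apply/funext => k; rewrite /Bd /w -!rmorphM -rmorphD.
apply: (csum_tannery Ba).
  move=> M k; rewrite /Bd normc_real ger0_norm; last first.
    by rewrite addr_ge0 ?mulr_ge0 ?normc_ge0// divr_ge0 ?mulr_ge0.
  apply: le_trans (normcD _ _) _; apply: lerD; last first.
    rewrite normcM normcN ler_wpM2r ?normc_ge0//; apply: hK2.
    by rewrite normc0.
  rewrite /dft_window; case: ifP => [kM|_]; last by rewrite normc0 divr_ge0 ?mulr_ge0.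
  have [->|k0] := eqVneq k 0.
    have p0 : poisson_term x 0 = 1.
      by rewrite /poisson_term mulr0z mul0r expr0n /= mulr0 mul0r addr0 mulr0 cexp0.
    rewrite dft_riemann p0 mul1r mulr0z mulr0 mul0r addr0.
    apply: le_trans (hK1 _ _ (lexx _)) _.
    by rewrite mul1r ler_pdivlMr// mulrC lerDr mulr_ge0.
  have kb : `|k%:~R * mesh R M.*2| <= 1 / 2.
    rewrite normrM (gtr0_norm (mesh_gt0 R _)) -intr_norm -abszE /mesh.
    rewrite ler_pdivrMr ?ltr0n// mulrAC ler_pdivlMr// mul1r.
    by rewrite -[_ * 2]natrM ler_nat; lia.
  apply: le_trans (hK _ _ k0 kb) _.
  set n := absz k; have n1 : (1 <= n)%N by rewrite /n; lia.
  have -> : (k%:~R : R) ^+ 2 = n%:R ^+ 2.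
    by rewrite -[LHS]real_normK ?num_real// -intr_norm -abszE.
  have n1R : 1 <= (n%:R : R) by rewrite ler1n.
  apply: le_trans (_ : 6 * K / (n.+1%:R * n.+2%:R) <= _); last first.
    by rewrite ler_wpM2r ?invr_ge0 ?mulr_ge0// lerDl mulr_ge0.
  rewrite -mulrA mulrCA ler_wpM2l// ler_pdivlMr ?mulr_gt0//.
  rewrite mulrC ler_pdivrMr ?exprn_gt0 ?(lt_le_trans ltr01)//.
  by rewrite -[n.+2]addn2 -[n.+1]addn1 !natrD; nra.
move=> k e e0; set p := poisson_term x k.
have p1 : 0 < normc p + 1 by rewrite ltr_wpDl ?normc_ge0.
have [N hN] := riemann_shift b_neg (x + t * k%:~R / 2) (divr_gt0 e0 p1).
exists (maxn N (absz k)) => M; rewrite geq_max => /andP[NM kM]; rewrite subr0.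
have -> : a M k = p * (riemann b M.*2 (x + t * k%:~R / 2) - riemann b M.*2 0 - 0).
  by rewrite /a /dft_window kM dft_riemann -/p; ring.
have h : (N <= M.*2)%N by rewrite (leq_trans NM)// -addnn leq_addr.
rewrite normcM; apply: le_trans (ler_wpM2l (normc_ge0 _) (hN _ h)) _.
by rewrite mulrCA ler_piMr ?ltW// ltr_pdivrMr// mul1r ltrDl.
Qed.

(** Let [F] and [T] be the two sides without [c]. Since [F - c_M T] tends to 0 at every point with
    the same numbers [c_M], cross multiplication gives [F x * T x0 = F x0 * T x]. So [c] is the
    quotient at a point where [T] does not vanish; if there is none, [F] vanishes as well. *)
Lemma poisson_summation : exists c : R[i], forall x,
  csum (fun n : int => gss b (x + n%:~R)) = c * csum (poisson_term x).
Proof.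
set F := fun x => csum (fun n : int => gss b (x + n%:~R)).
pose T x := csum (poisson_term x).
have [[x0 Tx0]|T0] := pselect (exists x0, T x0 != 0); last first.
  exists 0 => x; rewrite mul0r; apply: normc_lt_small => e e0.
  have [N hN] := poisson_lim x e0; have := hN N (leqnn N).
  have -> : csum (poisson_term x) = 0.
    by apply/eqP/negPn/negP => h; apply: T0; exists x.
  by rewrite mulr0 !subr0.
exists (F x0 / T x0) => x; apply: (mulIf Tx0); rewrite mulrAC divfK//.
apply/subr0_eq/normc_lt_small => e e0.
have s0 : 0 < normc (T x0) + normc (T x) + 1.
  by rewrite ltr_wpDl// addr_ge0 ?normc_ge0.
have e1 := divr_gt0 e0 s0.
have [N hN] := poisson_lim x e1; have [N0 hN0] := poisson_lim x0 e1.
have := hN _ (leq_maxl N N0); have := hN0 _ (leq_maxr N N0).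
rewrite !subr0 -/(F x) -/(F x0) -/(T x) -/(T x0).
set c := riemann _ _ _ => h1 h2.
have -> : F x * T x0 - F x0 * T x = (F x - c * T x) * T x0 - (F x0 - c * T x0) * T x.
  by ring.
apply: le_trans (normcD _ _) _; rewrite normcN !normcM.
apply: le_trans (lerD (ler_wpM2r (normc_ge0 _) h2) (ler_wpM2r (normc_ge0 _) h1)) _.
by rewrite -mulrDr mulrAC ler_pdivrMr// ler_wpM2l ?(ltW e0)// lerDl.
Qed.

End Poisson.

(** * The action on the Siegel half space *)

Section SiegelAction.
Variables (R : realType) (g : nat).
Implicit Types (M N : 'M[int]_(g + g)) (tau : 'M[R[i]]_g).

Definition cmx m n (A : 'M[int]_(m, n)) : 'M[R[i]]_(m, n) := map_mx intr A.

Definition num_mx M tau := cmx (ulsubmx M) *m tau + cmx (ursubmx M).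
Definition den_mx M tau := cmx (dlsubmx M) *m tau + cmx (drsubmx M).

Lemma siegel_actionE M tau : siegel_action M tau = num_mx M tau *m invmx (den_mx M tau).
Proof. by []. Qed.

(** The symplectic relations as an identity between two points. Taking [s = tau] gives symmetry of
    the image; the complex conjugate of [tau] gives invertibility of the denominator and positivity;
    another point of the half space gives the difference of two images. *)
Lemma sp_key M s tau : Sp2gZ M -> s^T = s ->
  (den_mx M s)^T *m num_mx M tau - (num_mx M s)^T *m den_mx M tau = tau - s.
Proof.
rewrite -{1}[M]submxK => /Sp2gZP[h1 h2 h3] hs.
have c1 := congr1 (@cmx _ _) h1; have c2 := congr1 (@cmx _ _) h2.
have c3 := congr1 (@cmx _ _) h3; have c4 := congr1 (@trmx _ _ _) c2.
move: c1 c2 c3 c4; rewrite /num_mx /den_mx /cmx !map_mxB !map_mxM -!map_trmx map_mx1.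
set a := map_mx _ (ulsubmx M); set b := map_mx _ (ursubmx M).
set c := map_mx _ (dlsubmx M); set d := map_mx _ (drsubmx M).
move=> c1 c2 c3; rewrite linearB /= !trmx_mul !trmxK trmx1 => c4.
have e1 : s *m c^T *m (a *m tau) = s *m a^T *m (c *m tau).
  by rewrite !mulmxA -(mulmxA s) -c1 !mulmxA.
have e2 : s *m c^T *m b = s *m a^T *m d - s.
  by rewrite -[X in _ - X]mulmx1 -c2 mulmxBr !mulmxA opprB addrCA subrr addr0.
have e3 : d^T *m (a *m tau) = b^T *m (c *m tau) + tau.
  by rewrite -[X in _ + X]mul1mx -c4 mulmxBl !mulmxA addrCA subrr addr0.
rewrite !raddfD /= !trmx_mul hs !mulmxDl ?mulmxDr e1 e2 e3 -c3.
move: (s *m a^T *m (c *m tau)) (s *m a^T *m d) (b^T *m (c *m tau)) (b^T *m d).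
by move=> x y z w; apply/matrixP => i j; rewrite !mxE; ring.
Qed.

Definition herm (Y : 'M[R]_g) (v : 'cV[R[i]]_g) : R[i] :=
  ((map_mx conjc v)^T *m map_mx (real_complex R) Y *m v) 0 0.

Lemma Re_herm_gt0 tau v : siegel_half_space tau -> v != 0 ->
  0 < Re (herm (map_mx (@complex.Im R) tau) v).
Proof.
move=> [_ hY] v0; set Y := map_mx _ tau in hY *.
have -> : Re (herm Y v) = ((map_mx (@complex.Re R) v)^T *m Y *m map_mx (@complex.Re R) v) 0 0
   + ((map_mx (@complex.Im R) v)^T *m Y *m map_mx (@complex.Im R) v) 0 0.
  rewrite /herm !mxE raddf_sum -big_split /=; apply: eq_bigr => i _.
  rewrite !mxE !mulr_suml raddf_sum -big_split /=; apply: eq_bigr => j _.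
  rewrite !mxE; case: (v i 0) (v j 0) => [x y] [z w] /=; ring.
have ge0 (x : 'cV[R]_g) : 0 <= (x^T *m Y *m x) 0 0.
  by have [->|/hY/ltW//] := eqVneq x 0; rewrite mulmx0 mxE.
have [r0|r0] := eqVneq (map_mx (@complex.Re R) v) 0; last first.
  by apply: ltr_wpDr => //; exact: hY.
have [i0|i0] := eqVneq (map_mx (@complex.Im R) v) 0; last first.
  by apply: ltr_wpDl => //; exact: hY.
case/eqP: v0; apply/matrixP => k l; have := congr1 (fun A : 'cV[R]_g => A k l) r0.
have := congr1 (fun A : 'cV[R]_g => A k l) i0.
by rewrite !mxE; case: (v k l) => x y /= -> ->.
Qed.

Definition cjmx m n (A : 'M[R[i]]_(m, n)) := map_mx conjc A.

Lemma sub_cjmx tau :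
  tau - cjmx tau = (2 * 'i%C) *: map_mx (real_complex R) (map_mx (@complex.Im R) tau).
Proof.
apply/matrixP => i j; rewrite !mxE; case: (tau i j) => x y.
rewrite (_ : (2 : R[i]) = (2 : R)%:C%C) ?rmorph_nat//.
by rewrite /=; simpc; rewrite mulrDl mul1r.
Qed.

Lemma cjmx_cmx m n (A : 'M[int]_(m, n)) : cjmx (cmx A) = cmx A.
Proof. by apply/matrixP => i j; rewrite !mxE rmorph_int. Qed.

Lemma cjmx_num M tau : cjmx (num_mx M tau) = num_mx M (cjmx tau).
Proof.
by rewrite /num_mx {1}/cjmx map_mxD map_mxM; congr (_ *m _ + _); exact: cjmx_cmx.
Qed.

Lemma cjmx_den M tau : cjmx (den_mx M tau) = den_mx M (cjmx tau).
Proof.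
by rewrite /den_mx {1}/cjmx map_mxD map_mxM; congr (_ *m _ + _); exact: cjmx_cmx.
Qed.

(** If [v] is in the kernel of the denominator, [sp_key] at the conjugate of [tau], evaluated
    between [v] and its conjugate, makes the Hermitian form of [Im tau] vanish at [v]. *)
Lemma den_unit M tau : Sp2gZ M -> siegel_half_space tau -> den_mx M tau \in unitmx.
Proof.
move=> hM ht; rewrite -unitmx_tr unitmxE unitfE; apply/negP => /det0P[w w0 hw].
have [ts _] := ht.
pose v := w^T; have v0 : v != 0.
  by apply: contra w0 => /eqP h; rewrite -[w]trmxK -/v h trmx0.
have qv : den_mx M tau *m v = 0 by rewrite -[LHS]trmxK trmx_mul trmxK hw trmx0.
have qv' : (cjmx v)^T *m (den_mx M (cjmx tau))^T = 0.
  by rewrite -trmx_mul -cjmx_den /cjmx -map_mxM qv map_mx0 trmx0.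
have ts' : (cjmx tau)^T = cjmx tau by rewrite /cjmx map_trmx ts.
have := sp_key tau hM ts'; move=> /(congr1 (fun A => (cjmx v)^T *m A *m v)).
rewrite mulmxBr mulmxBl !mulmxA qv' !mul0mx -!mulmxA qv !mulmx0 subrr sub_cjmx.
rewrite -scalemxAl -scalemxAr => /(congr1 (fun A : 'M[R[i]]_1 => A 0 0)).
rewrite mulmxA [X in _ = X]mxE mxE -/(herm _ _) => /esym/eqP.
rewrite !mulf_eq0 pnatr_eq0 /= => /orP[|/eqP h].
  by rewrite eq_complex /= oner_eq0 andbF.
by have := Re_herm_gt0 ht v0; rewrite h ltxx.
Qed.

Lemma siegel_action_sym M tau : Sp2gZ M -> siegel_half_space tau ->
  (siegel_action M tau)^T = siegel_action M tau.
Proof.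
move=> hM ht; have [ts _] := ht; have := den_unit hM ht => u.
have := sp_key tau hM ts; rewrite subrr => /subr0_eq h.
rewrite siegel_actionE trmx_mul trmx_inv.
have u' : (den_mx M tau)^T \in unitmx by rewrite unitmx_tr.
by apply: (can_inj (mulKmx u')); rewrite mulKVmx// mulmxA h -mulmxA mulmxV ?mulmx1.
Qed.

Lemma divmxB (p q r w : 'M[R[i]]_g) : q \in unitmx -> r \in unitmx ->
  p *m invmx q - invmx r *m w = invmx r *m (r *m p - w *m q) *m invmx q.
Proof.
move=> uq ur; rewrite mulmxBr mulmxBl !mulmxA mulVmx// mul1mx.
by rewrite -[in RHS](mulmxA _ q) mulmxV// mulmx1.
Qed.

(** [sp_key] divided by both denominators. The formula is exact, so the derivative of the action
    only requires continuity of the inverse of the denominator. *)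
Lemma siegel_actionB M s tau : Sp2gZ M -> siegel_half_space s ->
  den_mx M tau \in unitmx ->
  siegel_action M tau - siegel_action M s
    = (invmx (den_mx M s))^T *m (tau - s) *m invmx (den_mx M tau).
Proof.
move=> hM hs ut; have [ss _] := hs; have us := den_unit hM hs.
have us' : (den_mx M s)^T \in unitmx by rewrite unitmx_tr.
rewrite -(sp_key tau hM ss) -(siegel_action_sym hM hs) !siegel_actionE.
by rewrite trmx_mul !trmx_inv divmxB.
Qed.

(** [sp_key] at the conjugate of [tau] expresses the form of the imaginary part of the image at [X]
    as the Hermitian form of [Im tau] at [v = (den_mx M tau)^-1 X]. *)
Lemma siegel_action_half_space M tau : Sp2gZ M -> siegel_half_space tau ->
  siegel_half_space (siegel_action M tau).
Proof.
move=> hM ht; split; first exact: siegel_action_sym.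
have [ts _] := ht; have u := den_unit hM ht.
have u' : den_mx M (cjmx tau) \in unitmx by rewrite -cjmx_den map_unitmx.
move=> x x0; pose X := map_mx (real_complex R) x; pose v := invmx (den_mx M tau) *m X.
have X0 : X != 0 by rewrite map_mx_eq0.
have v0 : v != 0.
  by apply: contra X0 => /eqP h; rewrite -[X](mulKVmx u) -/v h mulmx0.
have XX : (cjmx X)^T = X^T.
  by apply/matrixP => i j; rewrite !mxE /= oppr0.
have cv : (cjmx v)^T = X^T *m (invmx (den_mx M (cjmx tau)))^T.
  by rewrite -XX -trmx_mul /v /cjmx map_mxM map_invmx -/(cjmx (den_mx M tau)) cjmx_den.
have ts' : (cjmx tau)^T = cjmx tau by rewrite /cjmx map_trmx ts.
set s := siegel_action M tau.
have cs : cjmx s = (invmx (den_mx M (cjmx tau)))^T *m (num_mx M (cjmx tau))^T.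
  have e : cjmx (num_mx M tau) *m invmx (cjmx (den_mx M tau)) = cjmx s.
    by rewrite /s siegel_actionE /cjmx map_mxM map_invmx.
  rewrite -trmx_mul -cjmx_den -cjmx_num e.
  by rewrite /cjmx map_trmx siegel_action_sym.
have key : (cjmx X)^T *m (s - cjmx s) *m X = (cjmx v)^T *m (tau - cjmx tau) *m v.
  have ut' : (den_mx M (cjmx tau))^T \in unitmx by rewrite unitmx_tr.
  rewrite XX cv -(sp_key tau hM ts') cs /s siegel_actionE /v trmx_inv divmxB//.
  by move: (invmx _) (_ - _) (invmx _) => r d q; rewrite !mulmxA.
move: key; rewrite !sub_cjmx -!scalemxAr -!scalemxAl.
move=> /(congr1 (fun A : 'M[R[i]]_1 => A 0 0)); rewrite !mxE_scale.
have n0 : (2 * 'i%C : R[i]) != 0.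
  by rewrite mulf_neq0 ?pnatr_eq0// eq_complex /= oner_eq0 andbF.
move=> /(mulfI n0); rewrite -/(herm _ v) => key.
have := Re_herm_gt0 ht v0; rewrite -key XX.
have -> : X^T = map_mx (real_complex R) x^T by rewrite map_trmx.
by rewrite -!map_mxM mxE.
Qed.

Lemma siegel_action_mul M N tau : Sp2gZ M -> Sp2gZ N -> siegel_half_space tau ->
  siegel_action (M *m N) tau = siegel_action M (siegel_action N tau).
Proof.
move=> hM hN ht; have u := den_unit hN ht.
have uM := den_unit hM (siegel_action_half_space hN ht).
have e (a b : 'M[int]_g) : cmx a *m num_mx N tau + cmx b *m den_mx N tau =
    (cmx a *m siegel_action N tau + cmx b) *m den_mx N tau.
  by rewrite mulmxDl siegel_actionE -!mulmxA mulVmx// mulmx1.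
have n1 : num_mx (M *m N) tau = num_mx M (siegel_action N tau) *m den_mx N tau.
  rewrite {2}/num_mx -e /num_mx /den_mx /cmx -[M in LHS]submxK -[N in LHS]submxK mulmx_block.
  rewrite block_mxKul block_mxKur !map_mxD !map_mxM !mulmxDr !mulmxDl !mulmxA.
  by rewrite addrACA.
have d1 : den_mx (M *m N) tau = den_mx M (siegel_action N tau) *m den_mx N tau.
  rewrite {2}/den_mx -e /num_mx /den_mx /cmx -[M in LHS]submxK -[N in LHS]submxK mulmx_block.
  rewrite block_mxKdl block_mxKdr !map_mxD !map_mxM !mulmxDr !mulmxDl !mulmxA.
  by rewrite addrACA.
have u2 := den_unit (Sp2gZ_mul hM hN) ht.
apply: (can_inj (mulmxK u2)); rewrite [X in X *m _ = _]siegel_actionE mulmxKV//.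
by rewrite n1 d1 mulmxA [in RHS]siegel_actionE mulmxKV.
Qed.

End SiegelAction.

(** * Modularity of the theta constants *)

Lemma sum_enum_val (T : finType) (V : nmodType) (F : T -> V) :
  \sum_(k < #|{: T}|) F (enum_val k) = \sum_t F t.
Proof.
by rewrite [RHS](reindex (@enum_val T predT))//; exact: onW_bij (@enum_val_bij T).
Qed.

Section ThetaModular.
Variables (R : realType) (g : nat).
Implicit Types (M N : 'M[int]_(g + g)) (tau : 'M[R[i]]_g) (e f : 'cV['I_2]_g).
Local Notation E := 'cV['I_2]_g.

(** [U] is chosen before [tau] and [c] after it. Membership in the group is included so that the
    property passes to products, where the second factor must first move [tau] within the half
    space. *)
Definition theta_modular M := Sp2gZ M /\
  exists U : 'M[R[i]]_#|{: E}|, unitary U /\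
    forall tau, siegel_half_space tau ->
      exists c, theta_null (siegel_action M tau) = c *: (theta_null tau *m U).

Lemma unitary_mul n (U V : 'M[R[i]]_n) : unitary U -> unitary V -> unitary (U *m V).
Proof.
rewrite /unitary => hU hV.
by rewrite map_mxM trmx_mul mulmxA -(mulmxA U) hV mulmx1.
Qed.

Lemma theta_modular_mul M N : theta_modular M -> theta_modular N ->
  theta_modular (M *m N).
Proof.
move=> [hM [U [hU hMU]]] [hN [V [hV hNV]]]; split; first exact: Sp2gZ_mul.
exists (V *m U); split=> [|tau ht]; first exact: unitary_mul.
have [c1 h1] := hMU _ (siegel_action_half_space hN ht).
have [c2 h2] := hNV _ ht; exists (c1 * c2).
by rewrite siegel_action_mul// h1 h2 -scalemxAl scalerA mulmxA.
Qed.

Lemma theta_modularI M (u : E -> E -> R[i]) : Sp2gZ M ->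
  (forall e f, \sum_h u e h * ((u f h)^*)%C = (e == f)%:R) ->
  (forall tau, siegel_half_space tau -> exists c, forall e,
     thnull (siegel_action M tau) e = c * \sum_f thnull tau f * u f e) ->
  theta_modular M.
Proof.
move=> hM hu ht; split=> //.
exists (\matrix_(k, l) u (enum_val k) (enum_val l)); split.
  apply/matrixP => k l; rewrite !mxE.
  have := hu (enum_val k) (enum_val l).
  rewrite (inj_eq enum_val_inj) => <-.
  rewrite -(sum_enum_val (fun h => u (enum_val k) h * ((u (enum_val l) h)^*)%C)).
  by apply: eq_bigr => j _; rewrite !mxE.
move=> tau /ht[c hc]; exists c; apply/rowP => k; rewrite theta_nullE hc.
rewrite !mxE; congr (_ * _).
rewrite -(sum_enum_val (fun f => thnull tau f * u f (enum_val k))).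
by apply: eq_bigr => j _; rewrite theta_nullE mxE.
Qed.

Lemma siegel_action_shear b tau : siegel_action (sp_shear b) tau = tau + cmx R b.
Proof.
rewrite siegel_actionE /num_mx /den_mx /sp_shear block_mxKul block_mxKur.
rewrite block_mxKdl block_mxKdr /cmx map_mx1 map_mx0 mul0mx add0r invmx1.
by rewrite mulmx1 mul1mx.
Qed.

Lemma siegel_action_levi a tau : a \in unitmx ->
  siegel_action (sp_levi a) tau = cmx R a *m tau *m (cmx R a)^T.
Proof.
move=> ua; rewrite siegel_actionE /num_mx /den_mx /sp_levi block_mxKul block_mxKur.
rewrite block_mxKdl block_mxKdr /cmx map_mx0 mul0mx add0r addr0; congr (_ *m _).
have h : map_mx intr a *m map_mx intr (invmx a) = 1%:M :> 'M[R[i]]_g.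
  by rewrite -map_mxM mulmxV// map_mx1.
have [uA uB] := mulmx1_unit h.
rewrite -map_trmx -trmx_inv; congr trmx.
by apply: (can_inj (mulKmx uB)); rewrite mulmxV// (mulmx1C h).
Qed.

Lemma intr_sum (I : Type) (r : seq I) (P : pred I) (F : I -> int) :
  ((\sum_(i <- r | P i) F i)%:~R : R[i]) = \sum_(i <- r | P i) (F i)%:~R.
Proof. by rewrite raddf_sum. Qed.

(** The cross term [m^T b e / 2] occurs twice by the symmetry of [b], hence contributes an
    integer. *)
Lemma qf_shear b (m : 'cV[int]_g) e : b^T = b -> exists k : int,
  qf (cmx R b) (map_mx intr m + half_real R e) = k%:~R + qf (cmx R b) (half_real R e).
Proof.
move=> hb.
exists (\sum_i \sum_j (m i 0 * m j 0 * b i j + m i 0 * (e j 0 : nat)%:Z * b i j)).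
have sym : \sum_i \sum_j (m i 0)%:~R * (e j 0 : nat)%:R * (b i j)%:~R =
   \sum_i \sum_j (m j 0)%:~R * (e i 0 : nat)%:R * (b i j)%:~R :> R[i].
  rewrite exchange_big; apply: eq_bigr => i _; apply: eq_bigr => j _.
  by rewrite -[in b j i]hb mxE.
have n2 : (2 : R[i]) != 0 by rewrite pnatr_eq0.
have -> : qf (cmx R b) (map_mx intr m + half_real R e) =
  (\sum_i \sum_j (m i 0)%:~R * (m j 0)%:~R * (b i j)%:~R
   + (\sum_i \sum_j (m i 0)%:~R * (e j 0 : nat)%:R * (b i j)%:~R) / 2
   + (\sum_i \sum_j (m j 0)%:~R * (e i 0 : nat)%:R * (b i j)%:~R) / 2)
   + qf (cmx R b) (half_real R e).
  rewrite !mulr_suml -!big_split; apply: eq_bigr => i _ /=.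
  rewrite !mulr_suml -!big_split; apply: eq_bigr => j _ /=.
  rewrite !mxE !(rmorphM, rmorphD, rmorph_int) !fmorphV !rmorph_nat /=.
  by field.
rewrite -sym intr_sum; congr (_ + _).
rewrite -addrA -mulrDl -mulr2n -[X in X / 2]mulr_natr mulfK// -big_split /=.
apply: eq_bigr => i _; rewrite intr_sum -big_split; apply: eq_bigr => j _ /=.
by rewrite intrD !intrM.
Qed.

(** The theta constant of characteristic [e / 2] is multiplied by [exp (2 pi i e^T b e / 4)], which
    has norm 1: a diagonal unitary matrix. *)
Lemma theta_modular_shear b : b^T = b -> theta_modular (sp_shear b).
Proof.
move=> hb; pose p e : R[i] := cexp (twopii R * qf (cmx R b) (half_real R e)).
have p1 e : p e * ((p e)^*)%C = 1.
  have : normc (p e) = 1.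
    rewrite normc_cexp Re_twopii (_ : Im _ = 0) ?mulr0 ?oppr0 ?expR0//.
    rewrite /qf raddf_sum big1// => i _; rewrite raddf_sum big1// => j _.
    by rewrite [cmx R b i j]mxE -(rmorph_int (real_complex R)) /=; ring.
  move: (p e) => [x y] /(congr1 (fun z => z ^+ 2)).
  rewrite expr1n sqr_sqrtr ?addr_ge0 ?sqr_ge0// => h; simpc.
  by congr Complex; [rewrite -h|]; ring.
apply: (@theta_modularI _ (fun e f => (e == f)%:R * p e)); first exact: Sp2gZ_shear.
  move=> e f; rewrite (bigD1 e) //= eqxx mul1r big1 ?addr0 => [|h he].
    by rewrite eq_sym; case: eqP => [->|_]; rewrite ?mul1r ?p1// mul0r rmorph0 mulr0.
  by rewrite eq_sym (negbTE he) !mul0r.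
move=> tau ht; exists 1 => e; rewrite mul1r (bigD1 e)//= eqxx mul1r.
rewrite big1 ?addr0 => [|f fe]; last by rewrite (negbTE fe) mul0r mulr0.
have [d d0 hd] := siegel_coercive ht.
rewrite siegel_action_shear /thnull mulrC -csumZ; last exact: (absum_thterm _ d0 hd).
congr csum; apply/funext => m; rewrite thtermD mulrC; congr (_ * _).
have [k ->] := qf_shear m e hb.
by rewrite mulrDr cexpD cexp_int mul1r.
Qed.

Lemma qf_congr (a : 'M[int]_g) tau (x : 'cV[R]_g) :
  qf (cmx R a *m tau *m (cmx R a)^T) x = qf tau ((map_mx intr a)^T *m x).
Proof.
rewrite -!qfE map_mxM trmx_mul -!map_trmx trmxK !mulmxA.
have -> : map_mx (real_complex R) (map_mx intr a) = cmx R a.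
  by apply/matrixP => i j; rewrite !mxE rmorph_int.
by [].
Qed.

Definition mod2 (v : 'cV[int]_g) : E := \col_i inord (absz (v i 0%R %% 2)%Z).

Definition lift2 e : 'cV[int]_g := \col_i (e i 0 : nat)%:Z.

Lemma mod2E v i : ((mod2 v i 0 : nat)%:Z = (v i 0%R %% 2)%Z).
Proof.
rewrite mxE inordK ?gez0_abs ?modz_ge0//.
by rewrite -ltz_nat gez0_abs ?modz_ge0// ltz_pmod.
Qed.

Lemma mod2_div v : exists k : 'cV[int]_g, v = lift2 (mod2 v) + 2 *: k.
Proof.
exists (\col_i (v i 0%R %/ 2)%Z); apply/matrixP => i j; rewrite !ord1.
rewrite mxE_add mxE_scale [lift2 _ _ _]mxE mod2E [(\col__ _) _ _]mxE.
by rewrite {1}(divz_eq (v i 0) 2) mulrC addrC.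
Qed.

Lemma half_realE e : half_real R e = 2^-1 *: map_mx intr (lift2 e).
Proof. by apply/matrixP => i j; rewrite !ord1 !mxE mulrC. Qed.

Definition act2 (a : 'M[int]_g) e : E := mod2 (a^T *m lift2 e).

(** [a^T] is invertible over the integers, so lifts with the same image modulo 2 differ by an even
    vector; their entries are 0 or 1. *)
Lemma act2_inj a : a \in unitmx -> injective (act2 a).
Proof.
move=> ua e f ef.
have [k hk] := mod2_div (a^T *m lift2 e); have [l hl] := mod2_div (a^T *m lift2 f).
have ua' : a^T \in unitmx by rewrite unitmx_tr.
have h : lift2 e - lift2 f = 2 *: (invmx a^T *m (k - l)).
  apply: (can_inj (mulKmx ua')); rewrite mulmxBr hk hl -/(act2 a e) -/(act2 a f) ef.
  by rewrite -scalemxAr mulKVmx// scalerBr opprD addrACA subrr add0r.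
apply/matrixP => i j; rewrite !ord1; apply/ord_inj.
have := congr1 (fun v : 'cV[int]_g => v i 0) h; rewrite mxE_add mxE_opp mxE_scale.
rewrite [lift2 e i 0]mxE [lift2 f i 0]mxE; move: (_ *m _) => w.
have := ltn_ord (e i 0); have := ltn_ord (f i 0).
move: (e i 0 : nat) (f i 0 : nat) (w i 0) => x y z /=; lia.
Qed.

(** The substitution [a^T (m + e / 2) = h m + act2 a e / 2], where [h] is an affine bijection of the
    lattice, permutes the theta constants. *)
Lemma theta_modular_levi a : a \in unitmx -> theta_modular (sp_levi a).
Proof.
move=> ua; have ai := act2_inj ua; have ab := injF_bij ai.
apply: (@theta_modularI _ (fun e f => (e == act2 a f)%:R)); first exact: Sp2gZ_levi.
  move=> e f; case: (ab) => s s1 s2; rewrite (bigD1 (s e)) //= s2 eqxx mul1r.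
  rewrite big1 ?addr0 => [|h he].
    by rewrite eq_sym; case: (_ == _); rewrite ?rmorph0 ?rmorph1.
  case: eqP => [eh|]; last by rewrite mul0r.
  by case/eqP: he; rewrite eh s1.
move=> tau ht; exists 1 => e; rewrite mul1r (bigD1 (act2 a e))//= eqxx mulr1.
rewrite big1 ?addr0 => [|f fe]; last by rewrite (negbTE fe) mulr0.
have [d d0 hd] := siegel_coercive ht.
have [k hk] := mod2_div (a^T *m lift2 e).
have ua' : a^T \in unitmx by rewrite unitmx_tr.
pose h (m : 'cV[int]_g) := a^T *m m + k.
have hb : bijective h.
  exists (fun m => invmx a^T *m (m - k)) => m; rewrite /h ?addrK ?mulKmx//.
  by rewrite mulKVmx// subrK.
have w (m : 'cV[int]_g) : (map_mx intr a)^T *m (map_mx intr m + half_real R e) =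
    map_mx intr (h m) + half_real R (act2 a e).
  rewrite mulmxDr !half_realE -scalemxAr map_trmx -!map_mxM hk -/(act2 a e).
  rewrite /h [map_mx intr (lift2 _ + _)]map_mxD [map_mx intr (_ + k)]map_mxD.
  rewrite map_mxZ scalerDr scalerA mulVf ?pnatr_eq0// scale1r.
  by rewrite addrA addrAC.
rewrite siegel_action_levi// /thnull.
rewrite -[RHS](csum_bij hb (absum_thterm (half_real R (act2 a e)) d0 hd)).
by congr csum; apply/funext => m; rewrite /thterm /= qf_congr w.
Qed.

End ThetaModular.

(** * Inversion in the coordinate [i] *)

Section ThetaInversion.
Variables (R : realType) (g : nat) (i : 'I_g).
Implicit Types (tau : 'M[R[i]]_g) (e f : 'cV['I_2]_g) (x : 'cV[R]_g) (s : R).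

Definition clin tau x : R[i] := \sum_k (x k 0)%:C%C * tau k i.

Lemma siegel_action_inv tau : tau^T = tau -> tau i i != 0 ->
  den_mx (sp_inv i) tau \in unitmx ->
  siegel_action (sp_inv i) tau = \matrix_(k, l) (tau k l
    - (tau i i)^-1 * ((tau k i - (k == i)%:R) * (tau l i - (l == i)%:R))
    - 2 * ((k == i)%:R * (l == i)%:R)).
Proof.
move=> ts t0 u; have tsE k l : tau k l = tau l k by rewrite -[in LHS]ts mxE.
apply: (can_inj (mulmxK u)); rewrite siegel_actionE mulmxKV//.
have denE m l : den_mx (sp_inv i) tau m l =
    (m == i)%:R * (tau i l - (l == i)%:R) + (m == l)%:R.
  rewrite /den_mx /sp_inv block_mxKdl block_mxKdr mxE_add mxE.
  rewrite (bigD1 i)//= big1 ?addr0 => [|k ki]; last first.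
    by rewrite !mxE (negbTE ki) andbF mul0r.
  rewrite !mxE eqxx andbT -mulnb; case: (m == i); case: (l == i); case: (m == l);
    rewrite /= ?mul0r ?mul1r ?subr0 ?sub0r ?subrr ?add0r ?addr0//; ring.
have numE k l : num_mx (sp_inv i) tau k l =
    tau k l - (k == i)%:R * (tau i l + (l == i)%:R).
  rewrite /num_mx /sp_inv block_mxKul block_mxKur mxE_add mxE.
  rewrite (eq_bigr (fun m => (k == m)%:R * tau m l
      - (m == i)%:R * ((k == i)%:R * tau m l))) => [|m _].
    rewrite sumrB (bigD1 k)//= [X in _ - X](bigD1 i)//= !big1 ?addr0 => [|m mi|m mk].
    - by rewrite !eqxx !mul1r !mxE; case: (k == i); case: (l == i); rewrite /=; ring.
    - by rewrite (negbTE mi) mul0r.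
    - by rewrite eq_sym (negbTE mk) mul0r.
  rewrite !mxE; case: (k == i); case: (m == i); case: (k == m) => /=; ring.
apply/matrixP => k l; rewrite numE mxE.
rewrite (eq_bigr _ (fun m _ => congr1 (fun z => _ * z) (denE m l))).
under eq_bigr do rewrite mulrDr.
rewrite big_split /= (bigD1 i)//= [X in _ = _ + X](bigD1 l)//=.
rewrite !big1 ?addr0 => [|m ml|m mi]; last 2 first.
- by rewrite (negbTE ml) mulr0.
- by rewrite (negbTE mi) mul0r mulr0.
rewrite !mxE !eqxx (tsE i l) /=.
by field.
Qed.

Lemma qf_siegel_inv tau x : tau^T = tau -> tau i i != 0 ->
  den_mx (sp_inv i) tau \in unitmx ->
  qf (siegel_action (sp_inv i) tau) x = qf tau x
   - (clin tau x - (x i 0)%:C%C) ^+ 2 / tau i i - 2 * (x i 0)%:C%C ^+ 2.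
Proof.
move=> ts t0 u; rewrite siegel_action_inv//.
have e1 : \sum_k (x k 0)%:C%C * (tau k i - (k == i)%:R) = clin tau x - (x i 0)%:C%C.
  rewrite /clin (bigD1 i)//= [X in _ = X - _](bigD1 i)//= eqxx mulrBr mulr1.
  rewrite addrAC; congr (_ + _ - _); apply: eq_bigr => k ki.
  by rewrite (negbTE ki) subr0.
have e2 : \sum_k (x k 0)%:C%C * (k == i)%:R = (x i 0)%:C%C.
  rewrite (bigD1 i)//= big1 ?addr0 ?eqxx ?mulr1// => k ki.
  by rewrite (negbTE ki) mulr0.
rewrite -e1 -e2 !expr2 !big_distrlr /= mulr_suml mulr_sumr -!sumrB.
apply: eq_bigr => k _; rewrite mulr_suml mulr_sumr -!sumrB; apply: eq_bigr => l _.
by rewrite mxE rmorphM; field.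
Qed.

Lemma qf_line tau x s : tau^T = tau -> x i 0 = 0 ->
  qf tau (x + s *: delta_mx i 0) =
    qf tau x + 2 * s%:C%C * clin tau x + s%:C%C ^+ 2 * tau i i.
Proof.
move=> ts x0; have tsE k l : tau k l = tau l k by rewrite -[in LHS]ts mxE.
have e1 : \sum_k \sum_l (k == i)%:R * ((x l 0)%:C%C * tau k l) = clin tau x.
  rewrite (bigD1 i)//= [X in _ + X]big1 ?addr0 => [|k ki]; last first.
    by rewrite big1// => l _; rewrite (negbTE ki) mul0r.
  by apply: eq_bigr => l _; rewrite eqxx mul1r tsE.
have e2 : \sum_k \sum_l (l == i)%:R * ((x k 0)%:C%C * tau k l) = clin tau x.
  apply: eq_bigr => k _; rewrite (bigD1 i)//= big1 ?addr0 ?eqxx ?mul1r//.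
  by move=> l li; rewrite (negbTE li) mul0r.
have e3 : \sum_k \sum_l (k == i)%:R * ((l == i)%:R * tau k l) = tau i i.
  rewrite (bigD1 i)//= [X in _ + X]big1 ?addr0 => [|k ki]; last first.
    by rewrite big1// => l _; rewrite (negbTE ki) mul0r.
  rewrite (bigD1 i)//= big1 ?addr0 ?eqxx ?mul1r// => l li.
  by rewrite (negbTE li) mul0r mulr0.
have -> : 2 * s%:C%C * clin tau x = s%:C%C * clin tau x + s%:C%C * clin tau x by ring.
rewrite -{1}e1 -e2 -e3 !mulr_sumr addrA -!big_split; apply: eq_bigr => k _ /=.
rewrite !mulr_sumr -!big_split; apply: eq_bigr => l _ /=.
rewrite !mxE !andbT !(rmorphM, rmorphD) !rmorph_nat; ring.
Qed.

Lemma clin_line tau x s :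
  clin tau (x + s *: delta_mx i 0) = clin tau x + s%:C%C * tau i i.
Proof.
rewrite /clin; have -> : s%:C%C * tau i i = \sum_k s%:C%C * (k == i)%:R * tau k i.
  rewrite (bigD1 i)//= big1 ?addr0 ?eqxx ?mulr1// => k ki.
  by rewrite (negbTE ki) mulr0 mul0r.
rewrite -big_split; apply: eq_bigr => k _ /=.
by rewrite !mxE !andbT rmorphD rmorphM rmorph_nat mulrDl.
Qed.

(** Along a line in the direction [i] the transformed form is a perfect square in [s] plus a
    constant: exactly the Gaussian of the Poisson formula with [t = tau i i], centred at
    [clin tau x]. *)
Lemma qf_siegel_inv_line tau x s : tau^T = tau -> tau i i != 0 ->
  den_mx (sp_inv i) tau \in unitmx -> x i 0 = 0 ->
  qf (siegel_action (sp_inv i) tau) (x + s *: delta_mx i 0) =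
    qf tau x - (s%:C%C - clin tau x) ^+ 2 / tau i i.
Proof.
move=> ts t0 u x0; rewrite qf_siegel_inv// qf_line// clin_line.
have -> : (x + s *: delta_mx i 0) i 0 = s by rewrite !mxE x0 !eqxx add0r mulr1.
by field.
Qed.

Definition zero_at := {m : 'cV[int]_g | m i 0%R == 0}.

Definition add_at (p : zero_at * int) : 'cV[int]_g := val p.1 + p.2 *: delta_mx i 0.

Lemma add_at_bij : bijective add_at.
Proof.
have h (m : 'cV[int]_g) : (m - m i 0 *: delta_mx i 0) i 0%R == 0.
  by rewrite mxE_add mxE_opp mxE_scale mxE !eqxx mulr1 subrr.
exists (fun m : 'cV[int]_g =>
  (exist _ (m - m i 0 *: delta_mx i 0) (h m) : zero_at, m i 0)) => [[[m m0] n]|m].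
  have e : add_at (exist _ m m0, n) i 0 = n.
    by rewrite /add_at /= mxE_add mxE_scale (eqP m0) mxE !eqxx add0r mulr1.
  congr pair; last exact: e.
  by apply/val_inj => /=; rewrite e /add_at /= addrK.
by rewrite /add_at /= subrK.
Qed.

Definition upd e (v : 'I_2) : 'cV['I_2]_g := \col_k (if k == i then v else e k 0).

Lemma updE e v : upd e v i 0 = v. Proof. by rewrite mxE eqxx. Qed.

Lemma upd_upd e v w : upd (upd e v) w = upd e w.
Proof. by apply/matrixP => k j; rewrite !mxE; case: eqP. Qed.

Lemma upd_id e : upd e (e i 0) = e.
Proof. by apply/matrixP => k j; rewrite !ord1 mxE; case: eqP => [->|]. Qed.

Definition base_pt e (k : zero_at) : 'cV[R]_g :=
  map_mx intr (val k) + half_real R (upd e ord0).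

Lemma base_pt0 e k : base_pt e k i 0 = 0.
Proof.
by rewrite mxE_add !mxE eqxx mul0r addr0; case: k => m /= /eqP ->; rewrite mulr0z.
Qed.

Lemma base_pt_upd e v k : base_pt (upd e v) k = base_pt e k.
Proof. by rewrite /base_pt upd_upd. Qed.

Definition half_at e : R := (e i 0 : nat)%:R / 2.

Lemma add_at_half e k n : map_mx intr (add_at (k, n)) + half_real R e =
  base_pt e k + (n%:~R + half_at e) *: delta_mx i 0.
Proof.
apply/matrixP => l j; rewrite !ord1 /add_at /base_pt /half_at !mxE_add mxE_scale.
rewrite [map_mx intr (_ + _) _ _]mxE mxE_add mxE_scale intrD intrM !mxE.
rewrite andbT; have [->|li] := eqVneq l i; rewrite /= ?mulr1 ?mulr0 ?mulr0z; ring.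
Qed.

Lemma absum_thterm_add_at d tau e : 0 < d -> im_coercive d tau ->
  absum (fun p : zero_at * int => thterm tau (half_real R e) (add_at p)).
Proof. by move=> d0 h; exact: absum_inj (bij_inj add_at_bij) (absum_thterm _ d0 h). Qed.

Lemma thnull_add_at d tau e : 0 < d -> im_coercive d tau ->
  thnull tau e = csum (fun k : zero_at => csum (fun n : int =>
    thterm tau (half_real R e) (add_at (k, n)))).
Proof.
move=> d0 h; rewrite /thnull -(csum_bij add_at_bij (absum_thterm _ d0 h)).
by rewrite csum_fubini//; exact: absum_thterm_add_at h.
Qed.

(** Splits the frequencies [l] by parity: [l / 2 = - (n + v / 2)], so that [t l^2 / 4] becomes the
    diagonal term of the characteristic [v / 2]. The sign matches the cross term with [clin], which
    enters the Poisson argument negatively. *)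
Definition neg_double (p : 'I_2 * int) : int := - (2 * p.2 + (p.1 : nat)%:Z).

Lemma neg_double_bij : bijective neg_double.
Proof.
have lt2 (l : int) : (absz (- l %% 2)%Z < 2)%N.
  by rewrite -ltz_nat gez0_abs ?modz_ge0// ltz_pmod.
exists (fun l => (Ordinal (lt2 l), (- l %/ 2)%Z)) => [[[v v2] n]|l].
  have e : (- neg_double (Ordinal v2, n) %% 2)%Z = v /\ (- neg_double (Ordinal v2, n) %/ 2)%Z = n.
    by rewrite /neg_double /=; lia.
  case: e => e1 e2; congr pair; last exact: e2.
  by apply/val_inj => /=; rewrite e1.
by rewrite /neg_double /= gez0_abs ?modz_ge0//; lia.
Qed.

Definition sgn2 (v w : 'I_2) : R[i] := (-1) ^+ (v * w)%N.

Lemma cexp_pii : cexp (twopii R / 2) = -1.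
Proof.
have -> : twopii R / 2 = Complex 0 pi.
  rewrite twopiiE; have -> : (2 : R[i]) = (2 : R)%:C%C by rewrite rmorph_nat.
  by rewrite -fmorphV /=; simpc; rewrite mulrAC mulfV ?pnatr_eq0// mul1r.
by rewrite /cexp /= expR0 cospi sinpi !mul1r; simpc.
Qed.

Lemma cexp_half_int n : cexp (twopii R * (n%:R / 2)) = (-1) ^+ n.
Proof. by rewrite -cexp_pii -cexpMn; congr cexp; rewrite -mulr_natr; ring. Qed.

(* The Fourier variable [l] of the Poisson formula is [- (2 n + v)]. *)
Lemma poisson_term_neg_double tau e (v : 'I_2) k n : tau^T = tau ->
  cexp (twopii R * qf tau (base_pt e k)) *
  poisson_term (tau i i) ((half_at e)%:C%C - clin tau (base_pt e k)) (neg_double (v, n))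
  = sgn2 (e i 0) v * thterm tau (half_real R (upd e v)) (add_at (k, n)).
Proof.
move=> ts; rewrite /thterm add_at_half base_pt_upd.
rewrite qf_line// ?base_pt0// /half_at updE.
have e1 : sgn2 (e i 0) v = cexp (twopii R * - (n * (e i 0 : nat)%:Z)%:~R)
   * cexp (- (twopii R * ((e i 0%R * v)%N%:R / 2))).
  rewrite cexpN cexp_half_int -mulrNz cexp_int mul1r.
  by rewrite /sgn2 -exprVn invrN invr1.
rewrite e1 /poisson_term /neg_double -!cexpD; congr cexp.
rewrite mulrNz intrD !intrM natrM !rmorphD !fmorph_div !rmorph_nat rmorph_int /=.
have -> : ((v : nat)%:Z%:~R : R[i]) = (v : nat)%:R by [].
have -> : ((e i 0 : nat)%:Z%:~R : R[i]) = (e i 0 : nat)%:R by [].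
move: (clin _ _) (qf _ _) => z q; set t := tau i i.
by field.
Qed.

(** The lattice sum is taken line by line. The Poisson constant [c] depends only on [tau i i], hence
    is common to all lines and characteristics. The two parity classes of frequencies reassemble,
    over all lines, into the theta constants of [upd e v], because the base points do not depend on
    [v]. *)
Lemma thnull_inv tau : siegel_half_space tau -> exists c, forall e,
  thnull (siegel_action (sp_inv i) tau) e =
    c * \sum_v sgn2 (e i 0) v * thnull tau (upd e v).
Proof.
move=> ht; have [ts _] := ht; have hJ := Sp2gZ_inv i.
have [d d0 hd] := siegel_coercive ht.
have [d' d'0 hd'] := siegel_coercive (siegel_action_half_space hJ ht).
have u := den_unit hJ ht; set s := siegel_action (sp_inv i) tau in hd' *.
pose t := tau i i.
have t_pos : 0 < Im t.
  have := hd (delta_mx i 0); have -> : nsq (delta_mx i 0 : 'cV[R]_g) = 1.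
    rewrite /nsq (bigD1 i)//= big1 => [|k ki]; first by rewrite mxE !eqxx expr1n addr0.
    by rewrite mxE (negbTE ki) expr0n.
  have -> : qf tau (delta_mx i 0) = t.
    have := @qf_line tau 0 1 ts; rewrite mxE add0r scale1r => /(_ erefl) ->.
    have -> : clin tau 0 = 0 by rewrite /clin big1// => k _; rewrite mxE mul0r.
    have -> : qf tau 0 = 0.
      by rewrite /qf big1// => k _; rewrite big1// => l _; rewrite !mxE mul0r mul0r.
    by rewrite mulr0 !add0r expr1n mul1r.
  by rewrite mulr1; apply: lt_le_trans.
have t0 : t != 0 by apply/eqP => h; move: t_pos; rewrite h ltxx.
have [c hc] := poisson_summation t_pos; exists c => e.
pose A k := cexp (twopii R * qf tau (base_pt e k)).
pose y k := (half_at e)%:C%C - clin tau (base_pt e k).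
pose B v k := csum (fun n : int => thterm tau (half_real R (upd e v)) (add_at (k, n))).
have Ba v : absum (B v).
  exact: (absum_outer (absum_thterm_add_at (upd e v) d0 hd)).
have inner k : csum (fun n : int => thterm s (half_real R e) (add_at (k, n)))
   = c * \sum_v sgn2 (e i 0) v * B v k.
  have -> : (fun n : int => thterm s (half_real R e) (add_at (k, n))) =
      (fun n : int => A k * gss (- twopii R / t) (y k + n%:~R)).
    apply/funext => n; rewrite /thterm add_at_half qf_siegel_inv_line ?base_pt0//.
    rewrite /A /gss -cexpD; congr cexp; rewrite -/t /y rmorphD rmorph_int /=.
    by field.
  have tb : Re (- twopii R / t) < 0 := Re_gss_coef_lt0 t_pos.
  have ga : absum (fun n : int => gss (- twopii R / t) (y k + n%:~R)).
    have := absum_gnode tb 0 (y k); congr absum; apply/funext => n.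
    by rewrite /gnode /mesh invr1 mulr1 rmorph_int.
  rewrite csumZ// hc mulrCA; congr (_ * _).
  have pa := absum_poisson t_pos (y k).
  rewrite -(csum_bij neg_double_bij pa).
  rewrite csum_fubini; last exact: (absum_inj (bij_inj neg_double_bij) pa).
  rewrite csum_fin mulr_sumr; apply: eq_bigr => v _.
  have pv : absum (fun n : int => (poisson_term t (y k) \o neg_double) (v, n)).
    apply: (@absum_inj R _ _ (fun n => neg_double (v, n)) _ _ pa).
    by move=> n m /(bij_inj neg_double_bij) [].
  rewrite -csumZ// /B -csumZ; last exact: (absum_row k (absum_thterm_add_at (upd e v) d0 hd)).
  congr csum; apply/funext => n; rewrite /= -poisson_term_neg_double//.
rewrite (thnull_add_at e d'0 hd').
rewrite (_ : (fun k => _) = (fun k => c * \sum_v sgn2 (e i 0) v * B v k)); last exact/funext.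
have sa v : absum (fun k => sgn2 (e i 0) v * B v k) by exact: absumZ.
rewrite csumZ; last exact: absum_bigsum.
congr (_ * _); rewrite csum_bigsum//; apply: eq_bigr => v _.
by rewrite csumZ// (thnull_add_at _ d0 hd).
Qed.

End ThetaInversion.

Section ThetaModularAll.
Variables (R : realType) (g : nat).
Implicit Types (e f : 'cV['I_2]_g).

Lemma sum_upd (i : 'I_g) e (F : 'cV['I_2]_g -> R[i]) :
  \sum_f (upd i f (e i 0) == e)%:R * F f = \sum_v F (upd i e v).
Proof.
rewrite (bigID (fun f => upd i f (e i 0) == e)) /= [X in _ + X]big1 ?addr0.
  rewrite (reindex_onto (upd i e) (fun f => f i 0)) => [|f /eqP <-].
    apply: eq_big => v; rewrite upd_upd upd_id eqxx ?updE ?eqxx// mul1r//.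
  by rewrite upd_upd upd_id.
by move=> f /negbTE ->; rewrite mul0r.
Qed.

Lemma sgn2_sum (a b : 'I_2) : \sum_(v < 2) sgn2 R v a * sgn2 R v b = 2 * (a == b)%:R.
Proof.
rewrite big_ord_recl big_ord1 /sgn2 /= !mul0n !expr0 mul1r !mul1n.
case: a => [[|[|//]] a2]; case: b => [[|[|//]] b2]; rewrite /= ?expr0 ?expr1;
  rewrite -?val_eqE /=; ring.
Qed.

(** The matrix is the 2 by 2 Hadamard matrix in the [i]-th entry of the characteristic and the
    identity in the others. The factor [r = 1 / sqrt 2] makes it unitary and is compensated in
    [c]. *)
Lemma theta_modular_inv (i : 'I_g) : theta_modular R (sp_inv i).
Proof.
have [r [r2 r_real]] : exists r : R[i], r * r = 2^-1 /\ (r^*)%C = r.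
  exists ((Num.sqrt 2)^-1)%:C%C; split; last by rewrite /= oppr0.
  rewrite -rmorphM -invfM -expr2 sqr_sqrtr// fmorphV; congr (_^-1).
  exact: rmorph_nat.
have r0 : r != 0.
  by apply/eqP => h; move: r2; rewrite h mul0r => /esym/eqP; rewrite invr_eq0 pnatr_eq0.
have s_real v w : ((sgn2 R v w)^*)%C = sgn2 R v w by rewrite rmorphXn rmorphN rmorph1.
pose u e f : R[i] := (upd i e (f i 0) == f)%:R * (sgn2 R (f i 0) (e i 0) * r).
apply: (@theta_modularI _ _ _ u); first exact: Sp2gZ_inv.
  move=> e f.
  have ue (h : 'cV['I_2]_g) : (upd i e (h i 0) == h) = (upd i h (e i 0) == e).
    by apply/eqP/eqP => hh; rewrite -hh upd_upd upd_id.
  rewrite (eq_bigr (fun h : 'cV['I_2]_g => (upd i h (e i 0) == e)%:R * (sgn2 R (h i 0) (e i 0) * r *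
     ((u f h)^*)%C))) => [|h _]; last by rewrite /u ue -!mulrA.
  rewrite sum_upd.
  rewrite (eq_bigr (fun v => (upd i f ord0 == upd i e ord0)%:R * 2^-1 *
     (sgn2 R v (e i 0) * sgn2 R v (f i 0)))) => [|v _]; last first.
    rewrite /u updE !rmorphM rmorph_nat /= s_real r_real.
    have -> : (upd i f v == upd i e v) = (upd i f ord0 == upd i e ord0).
      by apply/eqP/eqP => h; [rewrite -(upd_upd i f v)|rewrite -(upd_upd i f ord0)];
          rewrite h upd_upd.
    by rewrite -r2; ring.
  rewrite -mulr_sumr sgn2_sum -mulrA [2^-1 * _]mulrA mulVf ?pnatr_eq0// mul1r -natrM mulnb.
  congr (nat_of_bool _)%:R; apply/andP/eqP => [[/eqP h /eqP ef]|->]; last by rewrite !eqxx.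
  by rewrite -[e](upd_id i) -[f](upd_id i) ef -(upd_upd i e ord0) -h upd_upd.
move=> tau /(thnull_inv i)[c hc]; exists (c * r^-1) => e.
rewrite hc -mulrA; congr (_ * _).
rewrite (eq_bigr (fun f : 'cV['I_2]_g => (upd i f (e i 0) == e)%:R * (thnull tau f *
    (sgn2 R (e i 0) (f i 0) * r)))) => [|f _]; last by rewrite /u mulrCA.
rewrite sum_upd mulr_sumr; apply: eq_bigr => v _.
by rewrite updE; field.
Qed.

Lemma theta_modular_Sp2gZ (M : 'M[int]_(g + g)) : Sp2gZ M -> theta_modular R M.
Proof.
apply: Sp2gZ_ind.
- exact: theta_modular_shear.
- exact: theta_modular_levi.
- exact: theta_modular_inv.
- exact: theta_modular_mul.
Qed.

End ThetaModularAll.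

(** * The theta constants have no common zero *)

Section Nonvanishing.
Variables (R : realType) (g : nat).
Implicit Types (tau : 'M[R[i]]_g) (m n : 'cV[int]_g) (e : 'cV['I_2]_g) (x y : 'cV[R]_g).

Definition idot m y : R := \sum_i (m i 0)%:~R * y i 0.

Lemma idotDl m n y : idot (m + n) y = idot m y + idot n y.
Proof. by rewrite -big_split; apply: eq_bigr => i _; rewrite mxE intrD mulrDl. Qed.

Lemma idotNl m y : idot (- m) y = - idot m y.
Proof. by rewrite -sumrN; apply: eq_bigr => i _; rewrite mxE mulrNz mulNr. Qed.

Lemma idotNr m y : idot m (- y) = - idot m y.
Proof. by rewrite -sumrN; apply: eq_bigr => i _; rewrite mxE mulrN. Qed.

Lemma qf_parallelogram tau x y :
  qf tau (x + y) + qf tau (x - y) = 2 * qf tau x + 2 * qf tau y.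
Proof.
rewrite !mulr_sumr -!big_split; apply: eq_bigr => i _ /=.
rewrite !mulr_sumr -!big_split; apply: eq_bigr => j _ /=.
by rewrite !mxE !(rmorphM, rmorphD, rmorphN) /=; ring.
Qed.

Lemma qfN tau x : qf tau (- x) = qf tau x.
Proof.
apply: eq_bigr => i _; apply: eq_bigr => j _.
by rewrite !mxE mulrNN.
Qed.

Lemma qfZ c tau x : qf (c *: tau) x = c * qf tau x.
Proof.
have := qf_linear c tau 0 x; rewrite addr0 => ->.
by rewrite [qf 0 x]big1 ?addr0// => i _; rewrite big1// => j _; rewrite mxE mulr0.
Qed.

(** The classical Riemann theta series [sum exp (pi i m^T tau m + 2 pi i m^T y)] at real [y]:
    halving [tau] turns [2 pi i] into [pi i]. *)
Definition riemann_theta tau y : R[i] :=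
  csum (fun m => thterm (2^-1 *: tau) 0 m * phase (idot m y)).

Lemma absum_riemann_theta d tau y : 0 < d -> im_coercive d tau ->
  absum (fun m => thterm (2^-1 *: tau) 0 m * phase (idot m y)).
Proof.
move=> d0 hd; have hd2 : im_coercive (d / 2) (2^-1 *: tau).
  move=> x; rewrite qfZ mulrAC.
  have -> : Im (2^-1 * qf tau x) = Im (qf tau x) / 2.
    by rewrite mulrC complex_half.
  by rewrite ler_pM2r ?invr_gt0//; exact: hd.
apply: (absum_le (absum_thterm 0 (divr_gt0 d0 (ltr0n _ 2)) hd2)) => m.
by rewrite normcM normc_phase mulr1.
Qed.

Lemma riemann_thetaN d tau y : 0 < d -> im_coercive d tau ->
  riemann_theta tau (- y) = riemann_theta tau y.
Proof.
move=> d0 hd; have nb : bijective (fun m : 'cV[int]_g => - m).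
  by exists (fun m => - m) => m; rewrite opprK.
rewrite /riemann_theta -[RHS](csum_bij nb (absum_riemann_theta y d0 hd)).
congr csum; apply/funext => m /=; rewrite idotNl idotNr; congr (_ * _).
by rewrite /thterm !addr0 -[in RHS]qfN map_mxN opprK.
Qed.

(** Sorts pairs [(m, n)] of lattice vectors by the parity [e] of [m - n = 2 q + e]. *)
Definition sum_diff (p : 'cV['I_2]_g * ('cV[int]_g * 'cV[int]_g)) :=
  (p.2.1 + p.2.2 + lift2 p.1, p.2.1 - p.2.2).

Lemma sum_diff_bij : bijective sum_diff.
Proof.
pose half (v : 'cV[int]_g) : 'cV[int]_g := \col_i (v i 0%R %/ 2)%Z.
have halfE v : v = lift2 (mod2 v) + 2 *: half v.
  apply/matrixP => i j; rewrite !ord1.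
  rewrite mxE_add mxE_scale [lift2 _ _ _]mxE mod2E [(\col__ _) _ _]mxE.
  by rewrite {1}(divz_eq (v i 0) 2) mulrC addrC.
have aux (a : nat) (b : int) : (a < 2)%N -> ((a%:Z + 2 * b) %/ 2)%Z = b by lia.
have aux1 (a : nat) (b : int) : (a < 2)%N -> ((a%:Z + 2 * b) %% 2)%Z = a by lia.
exists (fun p => (mod2 (p.1 - p.2), (p.2 + half (p.1 - p.2), half (p.1 - p.2)))).
  move=> [e [p q]]; rewrite /sum_diff /=.
  have -> : p + q + lift2 e - (p - q) = lift2 e + 2 *: q.
    apply/matrixP => i j; rewrite !(mxE_add, mxE_opp, mxE_scale); ring.
  have E1 : mod2 (lift2 e + 2 *: q) = e.
    apply/matrixP => i j; rewrite !ord1; apply/ord_inj/eqP; rewrite -eqz_nat mod2E.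
    rewrite mxE_add mxE_scale [lift2 _ _ _]mxE.
    exact/eqP/aux1.
  have E2 : half (lift2 e + 2 *: q) = q.
    apply/matrixP => i j; rewrite !ord1 mxE mxE_add mxE_scale [lift2 _ _ _]mxE.
    exact: aux.
  by rewrite E1 E2 subrK.
move=> [m n]; rewrite /sum_diff /= addrK; congr pair.
apply/matrixP => i j; have := congr1 (fun v : 'cV[int]_g => v i j) (halfE (m - n)).
have aux2 (a b c d : int) : c - d = b + 2 * a -> d + a + a + b = c by lia.
by rewrite !(mxE_add, mxE_opp, mxE_scale) => /aux2.
Qed.

(** By evenness one factor is taken at [- y], so the phase depends only on [m - n = 2 q + e]. By the
    parallelogram law the quadratic exponents separate into the points [p + e / 2] and [q + e / 2],
    and the sum over [p] splits off as a theta constant. *)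
Lemma riemann_theta_sqr d tau y : 0 < d -> im_coercive d tau ->
  riemann_theta tau y * riemann_theta tau y = \sum_e thnull tau e *
    csum (fun q => thterm tau (half_real R e) q * phase (idot (2 *: q + lift2 e) y)).
Proof.
move=> d0 hd; rewrite -[X in _ * X](riemann_thetaN y d0 hd).
have a1 := absum_riemann_theta y d0 hd; have a2 := absum_riemann_theta (- y) d0 hd.
rewrite /riemann_theta -csum_prod//.
have ap := absum_prod a1 a2.
rewrite -(csum_bij sum_diff_bij ap) csum_fubini; last exact: (absum_inj (bij_inj sum_diff_bij) ap).
rewrite csum_fin; apply: eq_bigr => e _.
have at1 := absum_thterm (half_real R e) d0 hd.
rewrite /thnull -csum_prod//; last first.
  by apply: (absum_le at1) => q; rewrite normcM normc_phase mulr1.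
congr csum; apply/funext => -[p q] /=.
have ph : phase (idot (p + q + lift2 e) y) * phase (idot (p - q) (- y)) =
    phase (idot (2 *: q + lift2 e) y).
  rewrite -phaseD idotNr -idotNl -idotDl; congr (phase (idot _ y)).
  by apply/matrixP => i j; rewrite !(mxE_add, mxE_opp, mxE_scale); ring.
have e1 : map_mx intr (p + q + lift2 e) + 0 =
    (map_mx intr p + half_real R e) + (map_mx intr q + half_real R e) :> 'cV[R]_g.
  by apply/matrixP => i j; rewrite !ord1 !mxE !intrD -!pmulrn; field.
have e2 : map_mx intr (p - q) + 0 =
    (map_mx intr p + half_real R e) - (map_mx intr q + half_real R e) :> 'cV[R]_g.
  by apply/matrixP => i j; rewrite !ord1 !mxE intrD mulrNz; ring.
have th : thterm (2^-1 *: tau) 0 (p + q + lift2 e) * thterm (2^-1 *: tau) 0 (p - q)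
    = thterm tau (half_real R e) p * thterm tau (half_real R e) q.
  rewrite /thterm -!cexpD e1 e2 !qfZ -!mulrDr qf_parallelogram -mulrDr mulKf ?pnatr_eq0//.
by rewrite mulrACA ph th mulrA.
Qed.

Definition grid (N : nat) (y : 'cV['I_N.+1]_g) : 'cV[R]_g :=
  \col_i ((y i 0 : nat)%:R / N.+1%:R).

(** Orthogonality of characters on the group of [N + 1]-division points. In the second case,
    translating by one step in a coordinate [i] with [m i 0] not divisible multiplies the sum by a
    root of unity other than 1. *)
Lemma grid_sum N m : \sum_y phase (idot m (@grid N y)) =
  if [forall i, (N.+1%:Z %| m i 0%R)%Z] then #|{: 'cV['I_N.+1]_g}|%:R else 0.
Proof.
have nR : (N.+1%:R : R) != 0 by rewrite pnatr_eq0.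
case: ifPn => [/forallP h|/forallPn[i hi]].
  rewrite (eq_bigr (fun=> 1)) => [|y _]; first by rewrite sumr_const.
  have -> : idot m (grid y) = (\sum_i (m i 0%R %/ N.+1)%Z * (y i 0 : nat)%:Z)%:~R.
    have -> : forall F : 'I_g -> int, (\sum_i F i)%:~R = \sum_i (F i)%:~R :> R.
      by move=> F; rewrite raddf_sum.
    apply: eq_bigr => i _; rewrite mxE intrM.
    have := h i => /divzK {1}<-; rewrite intrM.
    by rewrite -[(N.+1%:Z)%:~R]/(N.+1%:R : R); field.
  exact: phase_int.
pose z : R[i] := phase ((m i 0)%:~R / N.+1%:R).
have z1 : z != 1.
  have := cexp_div_neq1 R (ltn0Sn N) hi.
  by rewrite /z /phase fmorph_div rmorph_int rmorph_nat.
pose c : 'cV['I_N.+1]_g := \col_k (if k == i then inZp 1 else 0).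
set S := \sum_y _; suff : S = z * S.
  move=> h; apply/eqP; have : (z - 1) * S == 0 by rewrite mulrBl mul1r -h subrr.
  by rewrite mulf_eq0 subr_eq0 (negbTE z1).
rewrite {1}/S (reindex_inj (addIr c)) mulr_sumr; apply: eq_bigr => y _.
rewrite /z -phaseD.
have e1 k : k != i -> (grid (y + c)) k 0 = grid y k 0.
  move=> ki; rewrite mxE [RHS]mxE; congr (_%:R / _).
  by rewrite mxE [c k 0]mxE (negbTE ki) addr0.
have [q hq] : exists q : int, (m i 0)%:~R * grid (y + c) i 0 =
    (m i 0)%:~R / N.+1%:R + (m i 0)%:~R * grid y i 0 + q%:~R :> R.
  have gE (w : 'cV['I_N.+1]_g) : grid w i 0 = (w i 0 : nat)%:R / N.+1%:R by rewrite mxE.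
  set y' : nat := (y : 'cV['I_N.+1]_g) i 0.
  have yc : ((y + c)%R i 0%R : nat) = ((y' + 1) %% N.+1)%N.
    by rewrite mxE [c i 0]mxE eqxx /= modnDmr.
  rewrite !gE yc -/y'; move: y' {yc} => k.
  exists (- (m i 0 * ((k + 1) %/ N.+1)%N%:Z)).
  have e : (k%:R + 1 : R) = ((k + 1) %/ N.+1)%N%:R * N.+1%:R + ((k + 1) %% N.+1)%N%:R.
    by rewrite -natrM -natrD -divn_eq natrD.
  have -> : (((k + 1) %% N.+1)%N%:R : R) = k%:R + 1 - ((k + 1) %/ N.+1)%N%:R * N.+1%:R.
    by rewrite e addrAC subrr add0r.
  by rewrite mulrNz intrM -[(_%:Z)%:~R]/(_%:R : R); field.
have -> : idot m (grid (y + c)) = (m i 0)%:~R / N.+1%:R + idot m (grid y) + q%:~R.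
  rewrite /idot (bigD1 i)//= hq [in RHS](bigD1 i)//=.
  rewrite [X in _ = _ + (_ + X) + _](eq_bigr (fun k => (m k 0)%:~R * grid (y + c) k 0)); last first.
    by move=> k ki; rewrite e1.
  ring.
by rewrite [LHS]phaseD phase_int mulr1.
Qed.

(** If all theta constants vanish, so does [riemann_theta tau]. Averaging it over the grid of mesh
    [1 / (N + 1)] leaves the coefficients whose index is divisible by [N + 1]. Their sum is 0 and
    the one at 0 is 1, so the others sum to -1 for every [N]; but by dominated convergence that sum
    tends to 0. *)
Lemma thnull_neq0 tau : siegel_half_space tau -> exists e, thnull tau e != 0.
Proof.
move=> ht; have [d d0 hd] := siegel_coercive ht.
have [//|h0] := pselect (exists e, thnull tau e != 0).
have th0 e : thnull tau e = 0 by apply/eqP/negPn/negP => h; apply: h0; exists e.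
have rt0 y : riemann_theta tau y = 0.
  apply/eqP; rewrite -[_ == 0]orbb -mulf_eq0 (riemann_theta_sqr y d0 hd).
  by rewrite big1// => e _; rewrite th0 mul0r.
pose a m : R[i] := thterm (2^-1 *: tau) 0 m.
have aa : absum a.
  have := absum_riemann_theta 0 d0 hd; congr absum; apply/funext => m.
  rewrite (_ : idot m 0 = 0); last by rewrite /idot big1// => i _; rewrite mxE mulr0.
  by have := phase_int R 0; rewrite mulr0z => ->; rewrite mulr1.
have a0 : a 0 = 1.
  rewrite /a /thterm addr0 (_ : qf _ _ = 0) ?mulr0 ?cexp0//.
  by rewrite /qf big1// => i _; rewrite big1// => j _; rewrite !mxE mul0r mul0r.
pose dv N m := [forall i, (N.+1%:Z %| m i 0%R)%Z].
pose b N m : R[i] := if dv N m then a m else 0.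
have ba N : absum (b N).
  by apply: (absum_le aa) => m; rewrite /b; case: ifP; rewrite ?normc0 ?normc_ge0.
have b0 N : csum (b N) = 0.
  have c0 : (#|{: 'cV['I_N.+1]_g}|%:R : R[i]) != 0.
    by rewrite pnatr_eq0 -lt0n; apply/card_gt0P; exists 0.
  apply: (mulfI c0); rewrite mulr0 -csumZ//.
  have -> : (fun m => #|{: 'cV['I_N.+1]_g}|%:R * b N m) =
     (fun m => \sum_y a m * phase (idot m (@grid N y))).
    apply/funext => m; rewrite -mulr_sumr grid_sum -/(dv N m) /b.
    by case: ifP; rewrite ?mulr0// mulrC.
  rewrite csum_bigsum; last by move=> y; exact: (absum_riemann_theta _ d0 hd).
  by rewrite big1// => y _; exact: rt0.
pose u N m : R[i] := if m == 0 then 0 else b N m.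
have u1 N : csum (u N) = -1.
  have := csum_split [fset 0]%fset (ba N).
  rewrite b0 big_seq_fset1 {1}/b (_ : dv N 0); last first.
    by apply/forallP => i; rewrite mxE dvdz0.
  rewrite a0 => /esym/eqP; rewrite addrC addr_eq0 => /eqP <-.
  by congr csum; apply/funext => m; rewrite inE.
have : seqlim (fun N => csum (u N)) 0.
  apply: (csum_tannery aa) => [N m|m e e0].
    by rewrite /u /b; case: ifP => _; [|case: ifP => _]; rewrite ?normc0 ?normc_ge0.
  exists (\sum_i absz (m i 0%R))%N => N hN; rewrite subr0 /u /b.
  case: eqP => [_|m0]; first by rewrite normc0 ltW.
  case: ifP => [/forallP hd'|_]; last by rewrite normc0 ltW.
  case: m0; apply/matrixP => i j; rewrite !ord1 mxE.
  have := hd' i; rewrite dvdzE => /dvdn_leq.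
  have : (absz (m i 0%R) <= N)%N.
    by apply: leq_trans hN; rewrite (bigD1 i)//= leq_addr.
  by move: (m i 0) => k /=; lia.
move=> /(_ (1 / 2) (divr_gt0 ltr01 (ltr0n _ 2)))[N /(_ N (leqnn N))].
rewrite u1 subr0 normcN ComplexField.Normc.normc1.
by rewrite ler_pdivlMr// mul1r lern1.
Qed.

Lemma theta_null_neq0 tau : siegel_half_space tau -> theta_null tau != 0.
Proof.
move=> /thnull_neq0[e]; apply: contra => /eqP h.
have := theta_nullE tau (enum_rank e); rewrite enum_rankK => <-.
by rewrite h mxE.
Qed.

End Nonvanishing.

(** * Differentials *)

Section ComplexLimits.
Variable R : realType.
Implicit Types (f : R[i] -> R[i]) (l : R[i]).

Definition clim f l := forall e : R, 0 < e -> exists2 d : R, 0 < d &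
  forall h : R[i], h != 0 -> normc h < d -> normc (f h - l) <= e.

Definition mclim m n (f : R[i] -> 'M[R[i]]_(m, n)) (L : 'M[R[i]]_(m, n)) :=
  forall e : R, 0 < e -> exists2 d : R, 0 < d &
  forall h : R[i], h != 0 -> normc h < d -> mxsum_norm (f h - L) <= e.

Lemma clim_near_ext f f' l (d : R) : 0 < d ->
  (forall h, h != 0 -> normc h < d -> f h = f' h) -> clim f l -> clim f' l.
Proof.
move=> d0 ff hf e /hf[d' d'0 hd']; exists (Num.min d d'); first by rewrite lt_min d0.
by move=> h h0; rewrite lt_min => /andP[h1 h2]; rewrite -ff//; exact: hd'.
Qed.

Lemma clim_cst l : clim (fun=> l) l.
Proof. by move=> e e0; exists 1 => // h _ _; rewrite subrr normc0 ltW. Qed.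

Lemma climD f f' l l' : clim f l -> clim f' l' -> clim (fun h => f h + f' h) (l + l').
Proof.
move=> hf hf' e e0; have e20 : 0 < e / 2 by rewrite divr_gt0.
have [d d0 hd] := hf _ e20; have [d' d'0 hd'] := hf' _ e20.
exists (Num.min d d'); first by rewrite lt_min d0.
move=> h h0; rewrite lt_min => /andP[/(hd _ h0) h1 /(hd' _ h0) h2].
rewrite opprD addrACA; apply: le_trans (normcD _ _) _.
by rewrite (splitr e); exact: lerD.
Qed.

Lemma climM f f' l l' : clim f l -> clim f' l' -> clim (fun h => f h * f' h) (l * l').
Proof.
move=> hf hf' e e0.
pose a := normc l; pose b := normc l'.
have a0 : 0 <= a := normc_ge0 _; have b0 : 0 <= b := normc_ge0 _.
pose r := Num.min 1 (e / (a + b + 1)).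
have s0 : 0 < a + b + 1 by rewrite ltr_wpDl// addr_ge0.
have r0 : 0 < r by rewrite lt_min ltr01 divr_gt0.
have [d d0 hd] := hf _ r0; have [d' d'0 hd'] := hf' _ r0.
exists (Num.min d d'); first by rewrite lt_min d0.
move=> h h0; rewrite lt_min => /andP[/(hd _ h0) h1 /(hd' _ h0) h2].
have -> : f h * f' h - l * l' = (f h - l) * (f' h - l') + (f h - l) * l' + l * (f' h - l').
  by ring.
have re : r * (a + b + 1) <= e by rewrite -ler_pdivlMr// ge_min lexx orbT.
have r1 : r <= 1 by rewrite ge_min lexx.
apply: le_trans (normcD _ _) _; rewrite normcM.
apply: le_trans (lerD (normcD _ _) (lexx _)) _; rewrite !normcM -/a -/b.
have n0 := normc_ge0 (f h - l); have n1 := normc_ge0 (f' h - l').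
apply: le_trans re.
have m1 : normc (f h - l) * normc (f' h - l') <= r * 1.
  by apply: ler_pM => //; exact: le_trans h2 r1.
have m2 := ler_wpM2r b0 h1; have m3 := ler_wpM2l a0 h2.
apply: le_trans (lerD (lerD m1 m2) m3) _.
by rewrite le_eqVlt; apply/orP; left; apply/eqP; ring.
Qed.

Lemma clim_uniq f l l' : clim f l -> clim f l' -> l = l'.
Proof.
move=> hf hf'; apply/subr0_eq/normc_lt_small => e e0.
have e20 : 0 < e / 2 by rewrite divr_gt0.
have [d d0 hd] := hf _ e20; have [d' d'0 hd'] := hf' _ e20.
pose r := Num.min d d' / 2.
have m0 : 0 < Num.min d d' by rewrite lt_min d0.
have r0 : 0 < r by rewrite divr_gt0.
have rm : r < Num.min d d' by rewrite /r gtr_pMr// invf_lt1// ltr1n.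
have hr : normc (r%:C%C) = r by rewrite normc_real gtr0_norm.
have h0 : r%:C%C != 0 :> R[i] by rewrite fmorph_eq0 gt_eqF.
have h1 : normc r%:C%C < d by rewrite hr (lt_le_trans rm)// ge_min lexx.
have h2 : normc r%:C%C < d' by rewrite hr (lt_le_trans rm)// ge_min lexx orbT.
have := hd _ h0 h1; have := hd' _ h0 h2.
have -> : l - l' = (f r%:C%C - l') - (f r%:C%C - l) by ring.
move=> u v; apply: le_trans (normcD _ _) _; rewrite normcN.
by rewrite (splitr e); exact: lerD.
Qed.

Lemma clim_sum (I : Type) (r : seq I) (f : I -> R[i] -> R[i]) (l : I -> R[i]) :
  (forall i, clim (f i) (l i)) ->
  clim (fun h => \sum_(i <- r) f i h) (\sum_(i <- r) l i).
Proof.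
move=> hf; elim: r => [|i r ih].
  by rewrite big_nil; under eq_fun do rewrite big_nil; exact: clim_cst.
rewrite big_cons; under eq_fun do rewrite big_cons.
exact: climD.
Qed.

Lemma mclim_entry m n (f : R[i] -> 'M[R[i]]_(m, n)) L i j : mclim f L ->
  clim (fun h => f h i j) (L i j).
Proof.
move=> hf e /hf[d d0 hd]; exists d => // h h0 hd'.
apply: le_trans (hd h h0 hd'); rewrite -[X in normc X]/(f h i j - L i j).
by have := mxsum_norm_entry (f h - L) i j; rewrite mxE_add mxE_opp.
Qed.

Definition quot f h := h^-1 * (f h - f 0).

Lemma clim_quot_cont f l : clim (quot f) l -> clim f (f 0).
Proof.
move=> hf.
have hid : clim (fun h => h) 0.
  by move=> e e0; exists e => // h _ /ltW; rewrite subr0.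
have := climD (climM hid hf) (clim_cst (f 0)); rewrite mul0r add0r.
apply: clim_near_ext ltr01 _ => h h0 _.
by rewrite /quot mulrA mulfV// mul1r subrK.
Qed.

Lemma clim_quotM f f' l l' : clim (quot f) l -> clim (quot f') l' ->
  clim (quot (fun h => f h * f' h)) (l * f' 0 + f 0 * l').
Proof.
move=> hf hf'.
have := climD (climM hf (clim_quot_cont hf')) (climM (clim_cst (f 0)) hf').
by apply: clim_near_ext ltr01 _ => h h0 _; rewrite /quot; ring.
Qed.

Lemma derive_clim m n p q (F : 'M[R[i]]_(m, n) -> 'M[R[i]]_(p, q))
  (x v : 'M[R[i]]_(m, n)) (L : 'M[R[i]]_(p, q)) :
  (forall i j, clim (quot (fun h => F (x + h *: v) i j)) (L i j)) ->
  'D_v F x = L.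
Proof.
move=> hF; apply: cvg_lim; first exact: norm_hausdorff.
apply/cvg_ballP => e e0.
have [re Ie] : 0 < Re e /\ Im e = 0.
  by move: e0; rewrite ltcE => /andP[/eqP -> ->].
pose K : numFieldType := R[i].
have near_ij i j : \forall h \near (0 : K)^',
    ball (L i j : K) e ((h^-1 *: ((F \o shift x) (h *: v) - F x)) i j).
  have re2 : 0 < Re e / 2 by rewrite divr_gt0.
  have [d d0 hd] := hF i j _ re2.
  have dc0 : 0 < d%:C%C :> R[i] by rewrite ltcR.
  exists d%:C%C => //= h /=; rewrite sub0r normrN => hdh h0.
  have hdh' : normc h < d by rewrite -ltcR.
  have := hd h h0 hdh'; rewrite /quot scale0r addr0 => hq.
  rewrite /ball /= distrC mxE_scale mxE_add mxE_opp [h *: v + x]addrC.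
  rewrite ltcE Ie eqxx andTb; apply: le_lt_trans hq _.
  by rewrite gtr_pMr// invf_lt1// ltr1n.
have nr : \forall h \near (0 : K)^', forall ij : 'I_p * 'I_q,
    ball (L ij.1 ij.2 : K) e ((h^-1 *: ((F \o shift x) (h *: v) - F x)) ij.1 ij.2).
  by apply: filter_forall => -[i j]; exact: near_ij.
apply: filterS nr => h hh; split => // i j.
exact: (hh (i, j)).
Qed.

End ComplexLimits.

(** * Derivatives of the action and of the theta constants *)

Section Differentials.
Variables (R : realType) (g : nat).
Implicit Types (M : 'M[int]_(g + g)) (tau sigma V H : 'M[R[i]]_g).

Lemma siegel_half_space_near tau V : siegel_half_space tau -> V^T = V ->
  exists2 d : R, 0 < d & forall h, normc h < d -> siegel_half_space (tau + h *: V).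
Proof.
move=> ht hV; have [d d0 hd] := siegel_coercive ht; have [ts _] := ht.
have v0 := mxsum_norm_ge0 V.
have v1 : 0 < mxsum_norm V + 1 by rewrite ltr_wpDl.
exists (d / 2 / (mxsum_norm V + 1)); first by rewrite !divr_gt0.
move=> h; rewrite ltr_pdivlMr// => hh; split.
  by rewrite linearD linearZ /= ts hV.
have hn : mxsum_norm (h *: V) <= d / 2.
  rewrite mxsum_normZ; apply: le_trans (ltW hh).
  by rewrite ler_wpM2l ?normc_ge0// lerDl.
move=> x x0; rewrite -Im_qf; apply: lt_le_trans (im_coercive_near hd hn x).
rewrite mulr_gt0 ?divr_gt0// /nsq lt_def sumr_ge0 ?andbT; last by move=> i _; exact: sqr_ge0.
apply: contra x0; rewrite psumr_eq0 => [/allP h0|i _]; last exact: sqr_ge0.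
apply/eqP/matrixP => i j; rewrite !ord1 mxE; apply/eqP.
by have := h0 i (mem_index_enum _); rewrite /= sqrf_eq0.
Qed.

(* [siegel_action M] maps the line [tau + h V] to a curve whose difference
   quotients are [(den tau)^-T V (den (tau + h V))^-1]. *)
Lemma siegel_action_mclim M tau V : Sp2gZ M -> siegel_half_space tau -> V^T = V ->
  mclim (fun h => h^-1 *: (siegel_action M (tau + h *: V) - siegel_action M tau))
    ((invmx (den_mx M tau))^T *m V *m invmx (den_mx M tau)).
Proof.
move=> hM ht hV e e0.
have [d d0 hd] := siegel_half_space_near ht hV.
have u0 := den_unit hM ht.
set q0 := den_mx M tau in u0 *.
pose B := cmx R (dlsubmx M) *m V.
pose n0 := mxsum_norm (invmx q0); pose C := mxsum_norm (B *m invmx q0).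
pose D := mxsum_norm ((invmx q0)^T *m V).
have n00 : 0 <= n0 := mxsum_norm_ge0 _; have C0 : 0 <= C := mxsum_norm_ge0 _.
have D0 : 0 <= D := mxsum_norm_ge0 _.
(* The term [2 C] secures [|h| C <= 1 / 2], the product is the coefficient of [|h|] in the final
   error, and 1 keeps [k] positive. *)
pose k := 2 * C + D * (2 * n0 * C) + 1.
have k0 : 0 < k by rewrite ltr_wpDl// addr_ge0 ?mulr_ge0.
exists (Num.min d (Num.min 1 e / k)).
  by rewrite lt_min d0 divr_gt0// lt_min ltr01.
move=> h h0; rewrite lt_min => /andP[h1]; rewrite ltr_pdivlMr// lt_min => /andP[hk1 hke].
have hk0 := normc_ge0 h.
have uh := den_unit hM (hd h h1); set qh := den_mx M (tau + h *: V) in uh *.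
have qhE : qh = q0 + h *: B.
  by rewrite /qh /q0 /den_mx mulmxDr -scalemxAr addrAC.
(* The resolvent identity for the inverses of [q0] and [q0 + h B]. *)
have dif : invmx qh - invmx q0 = - h *: (invmx qh *m (B *m invmx q0)).
  apply: (can_inj (mulKmx uh)); apply: (can_inj (mulmxK u0)).
  rewrite -scalemxAr mulKVmx// -scalemxAl mulmxKV// mulmxBr mulmxBl mulmxV// mul1mx.
  by rewrite mulmxKV// qhE opprD addrA subrr sub0r scaleNr.
set nh := mxsum_norm (invmx qh).
have nh0 : 0 <= nh := mxsum_norm_ge0 _.
have nd : mxsum_norm (invmx qh - invmx q0) <= normc h * (nh * C).
  by rewrite dif mxsum_normZ normcN ler_wpM2l// mxsum_normM.
have DC0 : 0 <= D * (2 * n0 * C) by rewrite !mulr_ge0.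
have hC : normc h * C <= 1 / 2.
  have : normc h * (2 * C) <= 1.
    apply: le_trans (ltW hk1); rewrite ler_wpM2l// /k -addrA lerDl addr_ge0//.
  by rewrite mulrCA; move: (_ * C) => z; lra.
(* Absorption: the resolvent identity gives [nh <= nh / 2 + n0]. *)
have nhb : nh <= 2 * n0.
  have : nh <= mxsum_norm (invmx qh - invmx q0) + n0.
    by rewrite /nh -{1}(subrK (invmx q0) (invmx qh)) mxsum_normD.
  move=> hn; have := le_trans hn (lerD nd (lexx _)).
  have := ler_wpM2l nh0 hC; rewrite mulrCA; move: (normc h * _) => z; lra.
rewrite siegel_actionB// -/q0 -/qh addrAC subrr add0r.
rewrite -scalemxAr -scalemxAl scalerA mulVf// scale1r -mulmxBr.
apply: le_trans (mxsum_normM _ _) _; rewrite -/D.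
apply: le_trans (ler_wpM2l D0 nd) _.
apply: le_trans (ltW hke); rewrite mulrCA ler_wpM2l//.
apply: le_trans (_ : D * (2 * n0 * C) <= _).
  by rewrite ler_wpM2l// ler_wpM2r.
by rewrite /k addrAC lerDr addr_ge0 ?mulr_ge0.
Qed.

(** Chain rule along a curve whose difference quotients [Q] tend to [H]. [theta_taylor] at the
    increment [h Q] leaves a remainder of order [|h|] after division by [h], and the rest is
    [dtheta] at [Q - H], which is small by its linear bound. *)
Lemma theta_clim d (sigma : R[i] -> 'M[R[i]]_g) H u : 0 < d -> im_coercive d (sigma 0) ->
  mclim (fun h => h^-1 *: (sigma h - sigma 0)) H ->
  clim (quot (fun h => csum (thterm (sigma h) u))) (dtheta (sigma 0) u H).
Proof.
move=> d0 hd hs e e0; have [K K0 [hL hT]] := theta_taylor u d0 hd.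
pose N := mxsum_norm H + 1.
have N0 : 0 < N by rewrite ltr_wpDl// mxsum_norm_ge0.
have K1 : 0 < K + 1 by rewrite ltr_wpDl.
pose r := Num.min 1 (e / 2 / (K + 1)).
have r0 : 0 < r by rewrite lt_min ltr01 !divr_gt0.
have [d1 d10 hd1] := hs _ r0.
pose q := Num.min (d / 4 / N) (e / 2 / ((K + 1) * N ^+ 2)).
have N2 : 0 < N ^+ 2 by rewrite exprn_gt0.
have q0 : 0 < q by rewrite lt_min !divr_gt0// mulr_gt0.
exists (Num.min d1 q); first by rewrite lt_min d10.
move=> h h0; rewrite !lt_min => /and3P[h1 h2 h3].
have hh := hd1 h h0 h1; set Q := h^-1 *: (sigma h - sigma 0) in hh.
have sE : sigma h = sigma 0 + h *: Q by rewrite /Q scalerA mulfV// scale1r addrC subrK.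
have r1 : r <= 1 by rewrite ge_min lexx.
have QN : mxsum_norm Q <= N.
  rewrite -(subrK H Q) addrC; apply: le_trans (mxsum_normD _ _) _.
  by rewrite lerD2l (le_trans hh).
have hQ : mxsum_norm (h *: Q) <= d / 4.
  rewrite mxsum_normZ; apply: le_trans (ler_wpM2l (normc_ge0 _) QN) _.
  by move: h2; rewrite ltr_pdivlMr// => /ltW.
have := hT _ hQ; rewrite -sE => hrem.
have lin : dtheta (sigma 0) u (h *: Q) = h * dtheta (sigma 0) u Q.
  have := dtheta_linear u h Q 0 d0 hd; rewrite addr0 => ->.
  have z : dtheta (sigma 0) u 0 = 0.
    by have := dtheta_linear u (-1) 0 0 d0 hd; rewrite scaler0 addr0 mulN1r addNr.
  by rewrite z addr0.
have linB : dtheta (sigma 0) u (Q - H) = dtheta (sigma 0) u Q - dtheta (sigma 0) u H.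
  have := dtheta_linear u (-1) H Q d0 hd.
  by rewrite scaleN1r mulN1r addrC [in RHS]addrC => ->.
rewrite /quot; set T1 := csum (thterm (sigma h) u) in hrem *.
set T0 := csum (thterm (sigma 0) u) in hrem *.
have -> : h^-1 * (T1 - T0) - dtheta (sigma 0) u H =
   h^-1 * (T1 - T0 - dtheta (sigma 0) u (h *: Q)) + dtheta (sigma 0) u (Q - H).
  by rewrite lin linB [X in _ = X + _]mulrBr mulKf// addrA subrK.
apply: le_trans (normcD _ _) _; rewrite (splitr e); apply: lerD.
  rewrite normcM ComplexField.Normc.normcV.
  have hp : 0 < normc h by rewrite normc_gt0.
  rewrite mulrC ler_pdivrMr//; apply: le_trans hrem _.
  rewrite mxsum_normZ exprMn.
  have QN2 : mxsum_norm Q ^+ 2 <= N ^+ 2.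
    by rewrite ler_sqr ?nnegrE ?mxsum_norm_ge0// ltW.
  have := ltW h3; rewrite ler_pdivlMr ?mulr_gt0// => h4.
  apply: le_trans (_ : (normc h * ((K + 1) * N ^+ 2)) * normc h <= _); last first.
    by rewrite ler_wpM2r// ltW.
  rewrite (_ : normc h * ((K + 1) * N ^+ 2) * normc h =
     (K + 1) * (normc h ^+ 2 * N ^+ 2)); last by ring.
  apply: ler_pM => //; first by rewrite mulr_ge0 ?sqr_ge0.
    by rewrite lerDl.
  by rewrite ler_wpM2l ?sqr_ge0.
apply: le_trans (hL _) _; apply: le_trans (ler_wpM2l K0 hh) _.
have rr : r * (K + 1) <= e / 2 by rewrite -ler_pdivlMr// ge_min lexx orbT.
by apply: le_trans rr; rewrite mulrC ler_wpM2l ?(ltW r0)// lerDl.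
Qed.

Lemma clim_mulmx m n (f : R[i] -> 'rV[R[i]]_m) (l : 'rV[R[i]]_m) (U : 'M[R[i]]_(m, n)) k :
  (forall j, clim (quot (fun h => f h 0 j)) (l 0 j)) ->
  clim (quot (fun h => (f h *m U) 0 k)) ((l *m U) 0 k).
Proof.
move=> hf; rewrite mxE.
have cs := clim_sum (index_enum _) (fun j => climM (hf j) (clim_cst (U j k))).
apply: (clim_near_ext ltr01 _ cs).
move=> h _ _; rewrite /quot 2!mxE -sumrB mulr_sumr.
by apply: eq_bigr => j _; rewrite -mulrA mulrBl.
Qed.

Definition dtheta_null tau H : 'rV[R[i]]_#|{: 'cV['I_2]_g}| :=
  \row_k dtheta tau (half_real R (enum_val k)) H.

Lemma theta_null_clim (sigma : R[i] -> 'M[R[i]]_g) H k :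
  siegel_half_space (sigma 0) ->
  mclim (fun h => h^-1 *: (sigma h - sigma 0)) H ->
  clim (quot (fun h => theta_null (sigma h) 0 k)) (dtheta_null (sigma 0) H 0 k).
Proof.
move=> /siegel_coercive[d d0 hd] hs.
have e : (fun h => theta_null (sigma h) 0 k) =
    (fun h => csum (thterm (sigma h) (half_real R (enum_val k)))).
  by apply/funext => h; rewrite theta_nullE.
have -> : dtheta_null (sigma 0) H 0 k = dtheta (sigma 0) (half_real R (enum_val k)) H.
  exact: mxE.
rewrite e; exact: theta_clim d0 hd hs.
Qed.

Lemma line_mclim tau V : mclim (fun h => h^-1 *: ((tau + h *: V) - (tau + 0 *: V))) V.
Proof.
move=> e e0; exists 1 => // h h0 _.
rewrite scale0r addr0 addrAC subrr add0r scalerA mulVf// scale1r subrr.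
rewrite /mxsum_norm big1 ?ltW// => i _; rewrite big1// => j _.
by rewrite mxE normc0.
Qed.

Lemma derive_theta_null tau V : siegel_half_space tau ->
  'D_V (@theta_null R g) tau = dtheta_null tau V.
Proof.
move=> ht; apply: derive_clim => i k; rewrite ord1.
have := @theta_null_clim (fun h => tau + h *: V) V k.
rewrite scale0r addr0 => /(_ ht); apply.
by have := line_mclim tau V; rewrite scale0r addr0.
Qed.

Lemma derive_siegel_action M tau V : Sp2gZ M -> siegel_half_space tau -> V^T = V ->
  'D_V (siegel_action M) tau = (invmx (den_mx M tau))^T *m V *m invmx (den_mx M tau).
Proof.
move=> hM ht hV; apply: derive_clim => i j.
have := mclim_entry i j (siegel_action_mclim hM ht hV).
apply: clim_near_ext ltr01 _ => h _ _.
by rewrite /quot scale0r addr0 mxE_scale mxE_add mxE_opp.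
Qed.

(* Differentiating the vanishing minors [X_k Y_l - X_l Y_k] at [0]. *)
Lemma clim_parallel n (X Y : R[i] -> 'rV[R[i]]_n) (X' Y' : 'rV[R[i]]_n) (d : R) c : 0 < d ->
  (forall h, normc h < d -> exists c, X h = c *: Y h) ->
  (forall k, clim (quot (fun h => X h 0 k)) (X' 0 k)) ->
  (forall k, clim (quot (fun h => Y h 0 k)) (Y' 0 k)) ->
  Y 0 != 0 -> X 0 = c *: Y 0 -> exists s, X' = s *: Y 0 + c *: Y'.
Proof.
move=> d0 hd Xq Yq Y0 X0.
have par k l h : normc h < d -> X h 0 l * Y h 0 k = X h 0 k * Y h 0 l.
  by move=> /hd[c' ->]; rewrite !mxE_scale mulrAC.
have XY k l : X' 0 k * Y 0 0 l + X 0 0 k * Y' 0 l = X' 0 l * Y 0 0 k + X 0 0 l * Y' 0 k.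
  apply: (clim_uniq (clim_quotM (Xq k) (Yq l))).
  apply: (clim_near_ext d0 _ (clim_quotM (Xq l) (Yq k))) => h _ hh.
  by rewrite /quot !(par k l)// normc0.
have [l Yl] : exists l, Y 0 0 l != 0.
  apply/existsP; apply: contraNT Y0; rewrite negb_exists => /forallP h.
  by apply/eqP/rowP => l; rewrite [RHS]mxE; apply/eqP/negPn/h.
exists ((X' 0 l - c * Y' 0 l) / Y 0 0 l).
apply/rowP => k; rewrite mxE_add !mxE_scale.
apply: (mulIf Yl); rewrite mulrDl mulrAC divfK//.
have := XY k l; rewrite X0 !mxE_scale => /(canRL (addrK _)) ->.
move: (X' 0 l) (Y 0 0 k) (Y 0 0 l) (Y' 0 k) (Y' 0 l) => a b e f v; ring.
Qed.

(** Symmetry of [V] keeps [tau + h V] in the half space for small [h], so both vectors are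
    proportional there, with an unknown factor for each [h]. [clim_parallel] then relates the
    derivatives through the single value [c] at [h = 0]. *)
Lemma derive_theta_modular M tau V c (U : 'M[R[i]]_#|{: 'cV['I_2]_g}|) :
  Sp2gZ M -> siegel_half_space tau -> V^T = V -> unitary U ->
  (forall tau, siegel_half_space tau -> exists c,
     theta_null (siegel_action M tau) = c *: (theta_null tau *m U)) ->
  theta_null (siegel_action M tau) = c *: (theta_null tau *m U) ->
  exists s, dtheta_null (siegel_action M tau) ('D_V (siegel_action M) tau) =
     (s *: theta_null tau + c *: dtheta_null tau V) *m U.
Proof.
move=> hM ht hV hU hall hc.
have [d d0 hd] := siegel_half_space_near ht hV.
pose X h : 'rV[R[i]]_#|{: 'cV['I_2]_g}| := theta_null (siegel_action M (tau + h *: V)).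
pose Y h : 'rV[R[i]]_#|{: 'cV['I_2]_g}| := theta_null (tau + h *: V) *m U.
set X' := dtheta_null _ _; pose Y' := dtheta_null tau V *m U.
have t0 : tau + 0 *: V = tau by rewrite scale0r addr0.
have Xq k : clim (quot (fun h => X h 0 k)) (X' 0 k).
  rewrite /X' derive_siegel_action//.
  have := @theta_null_clim (fun h => siegel_action M (tau + h *: V))
    ((invmx (den_mx M tau))^T *m V *m invmx (den_mx M tau)) k.
  rewrite t0; apply; first exact: siegel_action_half_space.
  exact: siegel_action_mclim.
have Yq k : clim (quot (fun h => Y h 0 k)) (Y' 0 k).
  apply: clim_mulmx => l.
  have := @theta_null_clim (fun h => tau + h *: V) V l.
  by rewrite t0 => /(_ ht); apply; have := line_mclim tau V; rewrite t0.
have Z0 := theta_null_neq0 ht.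
have Y00 : Y 0 = theta_null tau *m U by rewrite /Y t0.
have X0 : X 0 = c *: Y 0 by rewrite /X t0 hc Y00.
have Y0 : Y 0 != 0.
  apply: contra Z0 => /eqP h; rewrite Y00 in h.
  by rewrite -[theta_null tau]mulmx1 -hU mulmxA h mul0mx.
have par h : normc h < d -> exists c', X h = c' *: Y h.
  by move=> hh; have [c' hc'] := hall _ (hd h hh); exists c'; exact: hc'.
have [s es] := clim_parallel d0 par Xq Yq Y0 X0.
exists s; rewrite es Y00 {X0 Y0 Xq Yq par es}/Y' mulmxDl.
by rewrite (scalemxAl s) (scalemxAl c).
Qed.

Lemma theta_fubini_studyE tau V W : siegel_half_space tau ->
  theta_fubini_study tau V W =
  fubini_study (theta_null tau) (dtheta_null tau V) (dtheta_null tau W).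
Proof.
move=> h; rewrite /theta_fubini_study /pullback.
by rewrite (derive_theta_null V h) (derive_theta_null W h).
Qed.

End Differentials.

Theorem proposition3p3 (R : realType) (g : nat) (hg : (0 < g)%N)
    (M : 'M[int]_(g + g)) (hM : Sp2gZ M)
    (tau : 'M[R[i]]_g) (htau : siegel_half_space tau)
    (V W : 'M[R[i]]_g) (hV : V^T = V) (hW : W^T = W) :
  pullback (siegel_action M) (@theta_fubini_study R g) tau V W
    = @theta_fubini_study R g tau V W.
Proof.
have [_ [U [hU hmod]]] := theta_modular_Sp2gZ R hM.
have hs := siegel_action_half_space hM htau.
have [c hc] := hmod tau htau.
have Z0 := theta_null_neq0 htau.
(* Otherwise the theta constants would all vanish at the image point, which also lies in the half
   space. *)
have c0 : c != 0.
  apply/eqP => h; have := theta_null_neq0 hs.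
  by rewrite hc h scale0r eqxx.
have [s es] := derive_theta_modular hM htau hV hU hmod hc.
have [t et] := derive_theta_modular hM htau hW hU hmod hc.
apply: (etrans (theta_fubini_studyE _ _ hs)).
apply: (etrans (f_equal3 (@fubini_study R _) hc es et)).
apply: (etrans _ (esym (theta_fubini_studyE _ _ htau))).
exact: (fubini_study_invariant s t (dtheta_null tau V) (dtheta_null tau W) hU c0 Z0).
Qed.
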